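(* Let $x\in\mathbb{R}^n$ be a fixed nonzero vector. Suppose that $K=C_0\log n$ for some constant $C_0>0$, that $a_i\sim\mathcal N(0,I_n)$, $i=1,\ldots,\tilde m K$, are i.i.d. Gaussian random vectors, that $y_i=|\langle a_i,x\rangle|$ for all $i$, and that the step size is constant, $\mu=c$ for some sufficiently small constant $c>0$. Assume that the random initialization $z_0\in\mathbb{R}^n$ is independent of $\{a_i\}$ and obeys $$\frac{|\langle z_0,x\rangle|}{\|x\|}\ge \frac{1}{2\sqrt{n\log n}}\qquad\text{and}\qquad \Big(1-\frac{1}{\log n}\Big)\|x\|\le\|z_0\|\le\Big(1+\frac1{\log n}\Big)\|x\|.$$ Let $(z_k)_{k\ge0}$ be the iterates of the resampled Reshaped Wirtinger Flow (RWF) algorithm (recalled in the context) with this data, step size and initialization. Then there exist a sufficiently small absolute constant $0<\gamma<1$ and $T_\gamma\lesssim\log n$ such that, with probability at least $1-O(\exp(-c_1 n))-O(\tilde m^{-10})$, $$\mathrm{dist}(z_k,x)\le\gamma(1-\rho)^{k-T_\gamma}\|x\|\qquad\text{for all } k\ge T_\gamma,$$ for some universal constant $0<\rho<1$, provided $\tilde m\ge Cn\log n\,\log^3\tilde m$ for some sufficiently large constant $C>0$. Here $c_1>0$ is an absolute constant.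
   Context: $\|\cdot\|$ is the Euclidean norm on $\mathbb{R}^n$. $\mathrm{dist}(z,x)=\min\{\|z-x\|,\|z+x\|\}$. $\sigma(a)$ denotes the sign of $a\in\mathbb{R}$, with $\sigma(0)=0$. $A\lesssim B$ means that there is a constant $c'>0$ with $A\le c'B$. Resampled RWF: the data $\{(a_i,y_i)\}_{i=1}^{\tilde mK}$ are partitioned into $K$ disjoint blocks $\{(a_i,y_i)\}_{i\in\mathcal I_t}$, indexed by the residues $t=0,\ldots,K-1$ modulo $K$, each block containing $\tilde m$ samples ($K=C_0\log n$ is understood as an integer). Starting from $z_0$, for $k=0,1,2,\ldots$ one sets $$z_{k+1}=z_k-\frac{\mu}{\tilde m}\sum_{i\in\mathcal I_t}\big(|a_i^\top z_k|-y_i\big)\,\sigma(a_i^\top z_k)\,a_i,\qquad t=k \bmod K,$$ with a constant step size $\mu\in(0,0.5]$.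
   Formalization: The constants C, the one in T_γ≲log n, those in O(·), and how large C_0 must be may depend on an upper bound for ‖x‖ (C_0 is taken sufficiently large), since the initialization bound on |⟨z_0,x⟩|/‖x‖ is not scale invariant; γ, ρ, c_1 do not. *)

(* Defs.v *)
From HB Require Import structures.
From mathcomp Require Import all_boot all_order all_algebra.
From mathcomp Require Import all_classical all_reals all_analysis.

Set Implicit Arguments.
Unset Strict Implicit.
Unset Printing Implicit Defensive.

Import Order.TTheory GRing.Theory Num.Theory.
Import numFieldNormedType.Exports.

Local Open Scope classical_set_scope.
Local Open Scope ring_scope.

Section Euclidean.
Context {R : realType} {n : nat}.
Implicit Types u v z x : 'cV[R]_n.

Definition dotv u v : R := \sum_(j < n) u j 0 * v j 0.

(* The library norm `|u| on matrices is the sup norm. *)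
Definition enorm u : R := Num.sqrt (dotv u u).

Definition distpm z x : R := Num.min (enorm (z - x)) (enorm (z + x)).

End Euclidean.

(* blk i is the block of sample i; the k-th step uses the block k mod K.
   Num.sg 0 = 0. *)
Fixpoint rwf {R : realType} {n m K : nat} (mu : R) (blk : 'I_(m * K) -> 'I_K)
    (a : 'I_(m * K) -> 'cV[R]_n) (y : 'I_(m * K) -> R) (z0 : 'cV[R]_n)
    (k : nat) : 'cV[R]_n :=
  if k is k'.+1 then
    let z := rwf mu blk a y z0 k' in
    z - (mu / m%:R) *:
      \sum_(i < m * K | blk i == (k' %% K)%N :> nat)
        ((`|dotv (a i) z| - y i) * Num.sg (dotv (a i) z)) *: a i
  else z0.

Section RandomVectors.
Context {d : measure_display} {Omega : measurableType d} {R : realType}.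
Variable P : probability Omega R.

Definition gen_sigma (J : Type) (X : J -> Omega -> R) : set (set Omega) :=
  <<s \bigcup_(j in [set: J]) preimage_set_system setT (X j) measurable >>.

Definition random_vector (n : nat) (V : Omega -> 'cV[R]_n) : Prop :=
  forall j : 'I_n, measurable_fun setT (fun w => V w j 0).

(* N(0, I_n) as the product of n standard normal laws, which is determined by
   its values on boxes. *)
Definition std_gaussian_vector (n : nat) (V : Omega -> 'cV[R]_n) : Prop :=
  random_vector V /\
  forall B : 'I_n -> set R, (forall j, measurable (B j)) ->
    P [set w | forall j, B j (V w j 0)] =
    (\prod_(j < n) normal_prob (0 : R) 1 (B j))%E.

(* Subfamilies are covered by taking E i = setT outside of them. *)
Definition mutually_independent (n N : nat)
    (V : 'I_N -> Omega -> 'cV[R]_n) : Prop :=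
  forall E : 'I_N -> set Omega,
    (forall i, gen_sigma (fun (j : 'I_n) w => V i w j 0) (E i)) ->
    P (\bigcap_(i in [set: 'I_N]) E i) = (\prod_(i < N) P (E i))%E.

Definition independent_of_family (n N : nat)
    (Z : Omega -> 'cV[R]_n) (V : 'I_N -> Omega -> 'cV[R]_n) : Prop :=
  forall E F : set Omega,
    gen_sigma (fun (j : 'I_n) w => Z w j 0) E ->
    gen_sigma (fun (p : 'I_N * 'I_n) w => V p.1 w p.2 0) F ->
    P (E `&` F) = (P E * P F)%E.

End RandomVectors.

(* Main.v *)
Require Import Defs.
From HB Require Import structures.
From mathcomp Require Import all_boot all_order all_algebra.
From mathcomp Require Import all_classical all_reals all_analysis.
From mathcomp Require Import measurable_realfun.
From mathcomp Require Import ring lra.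
Set Implicit Arguments.
Unset Strict Implicit.
Unset Printing Implicit Defensive.
Import Order.TTheory GRing.Theory Num.Theory.
Import numFieldNormedType.Exports.
Local Open Scope classical_set_scope.
Local Open Scope ring_scope.

(** Why the theorem is true.

    Write X for the norm of x, and S for the average over a block of the
    operators z |-> (a_i . z) a_i.  One step of the algorithm reads
    z+ = z - mu S z + mu v(z), where v(z) averages |a_i . x| sg(a_i . z) a_i.
    Every block satisfies, with overwhelming probability, two bounds that are
    uniform in the argument: S is close to the identity ([gram_bounds]),
    and the part of |a_i . u| exceeding a large multiple L of
    |u| |a_i . x| / X is small in mean square ([excess_bound]).  Both follow
    from a union bound over a grid of mesh 1 / (n q) in the cube
    ([net_bounds]): the coordinate vectors are grid points, so the trace of S
    is at most 2 n, and this crude bound already absorbs the rounding error.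
    The grid has exp(O(n log n)) points, which is what m >= C n log n pays for.

    Near the target the iteration contracts.  With h = z - x, a residual
    differs from a_i . h only where the signs of a_i . z and a_i . x disagree,
    and there |a_i . h| >= |a_i . x|; this error is controlled by the excess
    bound as soon as 2 L |h| <= X ([update_split], [gstep_contract]).  Since
    these bounds are uniform, blocks may be reused, and the phase lasts
    for ever.

    The first phase brings z near x or -x.  Let A = <z, x> / X^2 and let t be
    the cosine of the angle of z and x.  When the block is independent of z,
    the average of the update along x is computed by a two-dimensional
    Gaussian integral, and up to fluctuations
    A+ >= (1 - mu) A + mu h(t) with h(t) >= t + min(t, 1 - t) / 1000
    ([growth], [growth_bound], [integral2_signal]).  As the norm of z stays
    below (1 + tau) X ([gstep_norm]), B = A / (1 + tau) is at most t, hence is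
    multiplied by a fixed factor at every step until it reaches 1 - zeta, which
    forces z to be close to x ([near_target]).  From the initial value
    1 / sqrt (n log n) this takes O(log n) steps, fewer than the number K of
    blocks, so every step sees a fresh block ([signal_bad_prob]).  The fluctuation
    must stay below a small multiple of 1 / sqrt (n log n); by a Bernstein
    inequality ([block_tail]) this fails with probability at most
    exp(- c m / (n log n)), a high negative power of m.  The deterministic part
    is [trajectory]; the probabilistic part is [failure].

    Gaussian facts are reduced to integrals over the line.  The law of
    (a . u, a . v) is obtained by adding one coordinate at a time
    ([gauss_merge]), using only the rotation invariance of the planar Gaussian
    measure, itself proved by factoring a rotation into three shears. *)

(** * Independence and conditioning *)
Section Independence.
Context d (Omega : measurableType d) (R : realType) (P : probability Omega R).
Implicit Types G : set (set Omega).
Local Open Scope ereal_scope.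

Definition indep_sets G1 G2 :=
  forall A B, G1 A -> G2 B -> P (A `&` B) = P A * P B.

Lemma indep_setsC G1 G2 : indep_sets G1 G2 -> indep_sets G2 G1.
Proof. by move=> H A B GA GB; rewrite setIC H// muleC. Qed.

(** Both sides of the product rule are finite measures in the first argument,
    so the uniqueness theorem for measures on pi-systems applies. *)
Lemma indep_sets_sigmal G1 G2 :
  G1 setT -> setI_closed G1 -> G1 `<=` measurable -> G2 `<=` measurable ->
  indep_sets G1 G2 -> indep_sets <<s G1 >> G2.
Proof.
move=> G1T G1I G1m G2m ind A B sA GB.
have mB : measurable B by exact: G2m.
pose c : {nonneg R} := NngNum (fine_ge0 (measure_ge0 P B)).
have := @g_sigma_algebra_measure_unique _ R Omega G1 G1m (fun=> setT) _ _
  (mrestr P mB) (mscale c P) G1I.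
move=> /(_ _ _ _ _ A) uniq.
transitivity (mscale c P A).
  apply: uniq => //.
  - by rewrite bigcup_const//; exists 0%N.
  - move=> C GC; transitivity (P C * P B); first exact: ind.
    by rewrite -[P B](fineK (fin_num_measure P _ mB)) muleC.
  - move=> _; rewrite /mrestr/=; apply: (@le_lt_trans _ _ 1); rewrite ?ltry//.
    by apply: probability_le1; apply: measurableI.
by rewrite -[P B in RHS](fineK (fin_num_measure P _ mB)) muleC.
Qed.

Lemma indep_sets_sigma G1 G2 :
  G1 setT -> G2 setT -> setI_closed G1 -> setI_closed G2 ->
  G1 `<=` measurable -> G2 `<=` measurable ->
  indep_sets G1 G2 -> indep_sets <<s G1 >> <<s G2 >>.
Proof.
move=> G1T G2T G1I G2I G1m G2m ind.
apply: indep_setsC; apply: indep_sets_sigmal => //.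
  exact: (smallest_sub (@sigma_algebra_measurable _ Omega) G1m).
by apply: indep_setsC; exact: indep_sets_sigmal.
Qed.

Section family.
Variables (J : finType) (G : J -> set (set Omega)).

(** Independence of finitely many pi-systems. *)
Definition indep_family :=
  [/\ forall j, G j setT, forall j, setI_closed (G j),
      forall j, G j `<=` measurable &
      forall E : J -> set Omega, (forall j, G j (E j)) ->
        P (\bigcap_(j in [set: J]) E j) = \prod_j P (E j)].

Definition sub_family (S : set J) := \bigcup_(j in S) G j.

Let boxes (S : set J) : set (set Omega) :=
  [set A | exists E : J -> set Omega, [/\ forall j, G j (E j),
     forall j, ~ S j -> E j = setT & A = \bigcap_(j in [set: J]) E j]].

(** Finite intersections of members of the families form pi-systems that generate
    the two joint sigma-algebras, and on them the product rule is immediate. *)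
Lemma indep_sub_family (S1 S2 : set J) : indep_family -> S1 `&` S2 = set0 ->
  indep_sets <<s sub_family S1 >> <<s sub_family S2 >>.
Proof.
move=> [GT GI Gm GP] S12.
have boxT S : boxes S setT.
  by exists (fun=> setT); split => //; rewrite bigcapT.
have boxI S : setI_closed (boxes S).
  move=> _ _ [E [GE ET ->]] [F [GF FT ->]]; exists (fun j => E j `&` F j).
  split=> [j|j nS|]; first exact: GI.
    by rewrite ET// FT// setTI.
  by rewrite bigcapI.
have boxm S : boxes S `<=` measurable.
  move=> _ [E [GE _ ->]]; apply: fin_bigcap_measurable => //; last first.
    by move=> j _; apply: (Gm j).
have subbox S : sub_family S `<=` boxes S.
  move=> A [j Sj GA]; exists (fun k => if k == j then A else setT); split.
  - by move=> k; case: eqP => [->|].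
  - by move=> k nSk; case: eqP => // kj; rewrite kj in nSk.
  - apply/seteqP; split=> [w Aw k _|w /(_ j Logic.I)]; last by rewrite eqxx.
    by case: eqP.
have sig S : <<s sub_family S >> `<=` <<s boxes S >>.
  exact: sub_smallest2r.
move=> A B /sig sA /sig sB; move: A B sA sB; apply: indep_sets_sigma => //.
move=> _ _ [E [GE ET ->]] [F [GF FT ->]].
rewrite -bigcapI// GP; last by move=> j; exact: GI.
rewrite !GP// -big_split/=; apply: eq_bigr => j _.
have [Sj|nSj] := pselect (S1 j); last by rewrite ET// setTI probability_setT mul1e.
rewrite FT ?setIT ?probability_setT ?mule1// => S2j.
by have : (S1 `&` S2) j by []; rewrite S12.
Qed.

End family.

Section fubini.
Variables G1 G2 : set (set Omega).
Hypotheses (G1m : G1 `<=` measurable) (G2m : G2 `<=` measurable).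
Hypothesis ind : indep_sets <<s G1 >> <<s G2 >>.
Local Notation T1 := (g_sigma_algebraType G1).
Local Notation T2 := (g_sigma_algebraType G2).

Let sG1m : <<s G1 >> `<=` measurable.
Proof. exact: (smallest_sub (@sigma_algebra_measurable _ Omega) G1m). Qed.
Let sG2m : <<s G2 >> `<=` measurable.
Proof. exact: (smallest_sub (@sigma_algebra_measurable _ Omega) G2m). Qed.

Let id1 : Omega -> T1 := idfun.
Let id2 : Omega -> T2 := idfun.
Let mid1 : measurable_fun setT id1.
Proof. by move=> _ A mA; rewrite setTI; apply: sG1m. Qed.
Let mid2 : measurable_fun setT id2.
Proof. by move=> _ A mA; rewrite setTI; apply: sG2m. Qed.

Let diag (w : Omega) : T1 * T2 := (w, w).
Let mdiag : measurable_fun setT diag.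
Proof. by apply/measurable_fun_pairP; split; [exact: mid1|exact: mid2]. Qed.

Let X1 : {RV P >-> T1} := HB.pack id1 (isMeasurableFun.Build _ _ _ _ id1 mid1).
Let X2 : {RV P >-> T2} := HB.pack id2 (isMeasurableFun.Build _ _ _ _ id2 mid2).
Let X12 : {RV P >-> (T1 * T2)%type} :=
  HB.pack diag (isMeasurableFun.Build _ _ _ _ diag mdiag).

Let jointE A : measurable A ->
  (distribution P X1 \x distribution P X2)%E A = distribution P X12 A.
Proof. by apply: product_measure_unique => {}A B mA mB; exact: ind. Qed.

(** The two sub-sigma-algebras turn the identity of Omega into two independent
    random variables, so the law of the diagonal is a product measure and
    Tonelli applies. *)
Lemma indep_integral (f : (T1 * T2)%type -> \bar R) :
  measurable_fun setT f -> (forall x, 0 <= f x) ->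
  \int[P]_w f (w, w) = \int[P]_w \int[P]_v f (w, v).
Proof.
move=> mf f0.
transitivity (\int[distribution P X12]_x f x).
  by rewrite ge0_integral_distribution.
transitivity (\int[distribution P X1 \x distribution P X2]_x f x).
  by apply: eq_measure_integral => A mA _; apply/esym; exact: (jointE mA).
rewrite fubini_tonelli1// ge0_integral_distribution//=.
- apply: eq_integral => w _; rewrite /fubini_F ge0_integral_distribution//.
  exact: measurableT_comp.
- exact: measurable_fun_fubini_tonelli_F.
- by move=> x; apply: integral_ge0.
Qed.

Lemma indep_prod (X : T1 -> \bar R) (Y : T2 -> \bar R) :
  measurable_fun setT X -> measurable_fun setT Y ->
  (forall x, 0 <= X x) -> (forall x, 0 <= Y x) ->
  \int[P]_w (X w * Y w) = \int[P]_w X w * \int[P]_w Y w.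
Proof.
move=> mX mY X0 Y0.
have mX' : measurable_fun [set: Omega] X.
  by move=> _ A mA; have := mX measurableT A mA; exact: sG1m.
have mY' : measurable_fun [set: Omega] Y.
  by move=> _ A mA; have := mY measurableT A mA; exact: sG2m.
rewrite (@indep_integral (fun x => X x.1 * Y x.2)); first last.
- by move=> x; exact: mule_ge0.
- by apply: emeasurable_funM; exact: measurableT_comp.
rewrite -ge0_integralZr//; last exact: integral_ge0.
by apply: eq_integral => w _; rewrite /= ge0_integralZl.
Qed.

(** Conditioning: an event that has probability at most p whatever the value of
    the first component has probability at most p when that component is random
    and independent of the second. *)
Lemma indep_section_le (B : set (T1 * T2)) (p : \bar R) : measurable B ->
  (forall w, P [set v | B (w, v)] <= p) -> P [set w | B (w, w)] <= p.
Proof.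
move=> mB Bp.
have -> : P [set w | B (w, w)] = (distribution P X1 \x distribution P X2)%E B.
  by rewrite jointE.
rewrite /product_measure1.
have p0 : 0 <= p by apply: le_trans (Bp point); exact: measure_ge0.
apply: (@le_trans _ _ (\int[distribution P X1]_w p)).
  apply: ge0_le_integral => //; first exact: measurable_fun_xsection.
  move=> w _; apply: le_trans (Bp w) => /=.
  rewrite le_eqVlt; apply/orP; left; apply/eqP; congr (P _).
  by apply/seteqP; split=> v; rewrite /xsection/= inE.
by rewrite integral_cst// [X in _ * X](_ : _ = 1) ?mule1//; exact: probability_setT.
Qed.

End fubini.

Lemma indep_family_prod (J : finType) (G : J -> set (set Omega)) (s : seq J)
    (f : forall j, g_sigma_algebraType (G j) -> \bar R) :
  indep_family G -> uniq s ->
  (forall j, measurable_fun setT (f j)) -> (forall j w, 0 <= f j w) ->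
  \int[P]_w (\prod_(j <- s) f j w) = \prod_(j <- s) \int[P]_w f j w.
Proof.
move=> iG us mf f0; elim: s us => [_|j s IH /= /andP[js us]].
  rewrite !big_nil; under eq_integral do rewrite big_nil.
  by rewrite integral_cst// [X in _ * X](_ : _ = 1) ?mule1//; exact: probability_setT.
rewrite big_cons; under eq_integral do rewrite big_cons.
have [GT GI Gm _] := iG.
have subm (S : set J) : sub_family G S `<=` measurable.
  by move=> A [k _]; exact: Gm.
have mfS (S : set J) k : S k ->
    measurable_fun setT (f k : g_sigma_algebraType (sub_family G S) -> \bar R).
  move=> Sk _ A mA; have := mf k measurableT A mA.
  have sub : <<s G k >> `<=` <<s sub_family G S >>.
    by apply: sub_sigma_algebra2 => B GB; exists k.
  exact: sub.
rewrite -IH// (@indep_prod (sub_family G [set j]) (sub_family G [set` s])) => //.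
- apply: indep_sub_family => //; apply/seteqP; split=> k // [/= -> js'].
  by rewrite js' in js.
- exact: mfS.
- suff : forall r, {subset r <= s} -> measurable_fun setT
      ((fun w => \prod_(k <- r) f k w) :
        g_sigma_algebraType (sub_family G [set` s]) -> \bar R) by apply.
  elim=> [_|k r IHr rs].
    rewrite [X in measurable_fun _ X](_ : _ = cst 1); first exact: measurable_cst.
    by apply/funext => w; rewrite big_nil.
  rewrite [X in measurable_fun _ X](_ : _ =
      (fun w => f k w * \prod_(l <- r) f l w)); last first.
    by apply/funext => w; rewrite big_cons.
  apply: emeasurable_funM.
    by apply: mfS; apply: rs; exact: mem_head.
  by apply: IHr => l lr; apply: rs; rewrite inE lr orbT.
- by move=> w; apply: prode_ge0.
Qed.

End Independence.

(** * Rotation invariance of the planar Gaussian measure *)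
Section Gaussian.
Context {R : realType}.
Local Open Scope ereal_scope.
Local Notation leb := (@lebesgue_measure R).

Definition gauss : probability (measurableTypeR R) R := normal_prob (0 : R) 1.
Definition gpdf (x : R) : R := normal_pdf (0 : R) 1 x.

Lemma gpdfE (x : R) : gpdf x = ((Num.sqrt (pi *+ 2))^-1 * expR (- (x ^+ 2 / 2)))%R.
Proof.
rewrite /gpdf normal_pdfE ?oner_eq0// /normal_peak /normal_fun subr0 expr1n mul1r.
by rewrite mulNr.
Qed.

Lemma gpdf_ge0 x : (0 <= gpdf x)%R. Proof. exact: normal_pdf_ge0. Qed.

Lemma measurable_gpdf : measurable_fun setT gpdf.
Proof. exact: measurable_normal_pdf. Qed.

(** Changing the measure introduces a Radon-Nikodym derivative, which agrees almost
    everywhere with the explicit density. *)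
Lemma integral_gauss (f : R -> \bar R) :
  measurable_fun setT f -> (forall x, 0 <= f x) ->
  \int[gauss]_x f x = \int[leb]_x (f x * (gpdf x)%:E).
Proof.
move=> mf f0.
have dom : gauss `<< leb := @normal_prob_dominates R 0 1.
have := @Radon_Nikodym_SigmaFinite.change_of_variables _ _ R gauss leb dom f setT f0 measurableT mf.
move=> <-.
apply: ae_eq_integral => //.
- apply: emeasurable_funM => //; apply: measurable_int.
  exact: Radon_Nikodym_SigmaFinite.f_integrable.
- by apply: emeasurable_funM => //; apply/measurable_EFinP; exact: measurable_gpdf.
apply: ae_eqe_mul2l.
apply: integral_ae_eq => //.
- exact: Radon_Nikodym_SigmaFinite.f_integrable.
- by apply/measurable_EFinP; exact: measurable_gpdf.
- by move=> E _ mE; rewrite -Radon_Nikodym_SigmaFinite.f_integral.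
Qed.

Lemma integral_shift (f : R -> \bar R) (t : R) :
  measurable_fun setT f -> (forall x, 0 <= f x) ->
  \int[leb]_x f (x + t)%R = \int[leb]_x f x.
Proof.
move=> mf f0.
pose phi : measurableTypeR R -> measurableTypeR R := fun x => (x + t)%R.
have mphi : measurable_fun setT phi by exact: measurable_funD.
transitivity (\int[pushforward leb phi]_x f x).
  by rewrite ge0_integral_pushforward.
apply: eq_measure_integral => A mA _.
apply/esym/lebesgue_measure_unique => //= _ [[a b]] _ <-.
rewrite /pushforward (_ : phi @^-1` _ = `]a - t, b - t]%classic)%R; last first.
  by apply/seteqP; split => x /=; rewrite !in_itv/= ltrBlDr lerBrDr.
rewrite !lebesgue_measure_itv/= !lte_fin ltrD2r; case: ifP => // _.
by congr _%:E; ring.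
Qed.

Local Notation RR := (measurableTypeR R * measurableTypeR R)%type.

Lemma integral_shear1 (f : RR -> \bar R) (t : R) :
  measurable_fun setT f -> (forall x, 0 <= f x) ->
  \int[leb]_x \int[leb]_y f (x + t * y, y)%R = \int[leb]_x \int[leb]_y f (x, y).
Proof.
move=> mf f0.
have mf1 : measurable_fun setT (fun z : RR => f (z.1 + t * z.2, z.2)%R).
  apply: measurableT_comp => //; apply: measurable_fun_pair => //.
  by apply: measurable_funD => //; apply: measurable_funM.
have := @fubini_tonelli _ _ _ _ _ leb leb _ mf1 => /= -> //.
rewrite (@fubini_tonelli _ _ _ _ _ leb leb _ mf f0); apply: eq_integral => y _ /=.
by rewrite (integral_shift (f := fun x => f (x, y)))//; exact: measurableT_comp.
Qed.

Lemma integral_shear2 (f : RR -> \bar R) (t : R) :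
  measurable_fun setT f -> (forall x, 0 <= f x) ->
  \int[leb]_x \int[leb]_y f (x, y + t * x)%R = \int[leb]_x \int[leb]_y f (x, y).
Proof.
move=> mf f0; apply: eq_integral => x _.
by rewrite (integral_shift (f := fun y => f (x, y)))//; exact: measurableT_comp.
Qed.

(** A rotation is a product of three shears with parameters -u, s, -u, where u is
    the tangent of the half angle; c >= 0 keeps u finite.  Shears preserve the
    plane measure by Tonelli and translation invariance, so no change of
    variables in dimension two is needed. *)
Lemma integral_rotation_leb (f : RR -> \bar R) (c s : R) :
  (0 <= c)%R -> (c ^+ 2 + s ^+ 2 = 1)%R ->
  measurable_fun setT f -> (forall x, 0 <= f x) ->
  \int[leb]_x \int[leb]_y f (c * x - s * y, s * x + c * y)%R =
  \int[leb]_x \int[leb]_y f (x, y).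
Proof.
move=> c0 cs mf f0; set u := (s / (1 + c))%R.
have c1 : (1 + c != 0)%R by rewrite gt_eqF// ltr_pwDl.
have su : (u * s = 1 - c)%R.
  have ss : (s * s = (1 - c) * (1 + c))%R.
    have -> : (s * s = 1 - c ^+ 2)%R by rewrite -cs -expr2; ring.
    by ring.
  by rewrite /u mulrAC ss mulfK.
have uc : (u * (1 + c) = s)%R by rewrite /u divfK.
have msh (g : RR -> \bar R) t : measurable_fun setT g ->
    measurable_fun setT (fun z : RR => g (z.1 + t * z.2, z.2)%R).
  move=> mg; apply: measurableT_comp => //; apply: measurable_fun_pair => //.
  by apply: measurable_funD => //; apply: measurable_funM.
have msh2 (g : RR -> \bar R) t : measurable_fun setT g ->
    measurable_fun setT (fun z : RR => g (z.1, z.2 + t * z.1)%R).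
  move=> mg; apply: measurableT_comp => //; apply: measurable_fun_pair => //.
  by apply: measurable_funD => //; apply: measurable_funM.
rewrite -[RHS](integral_shear1 (- u))//.
rewrite -[RHS](integral_shear2 (f := fun z : RR => f (z.1 + - u * z.2, z.2)%R) s)//=; last exact: msh.
rewrite -[RHS](integral_shear1 (f := fun z : RR => f (z.1 + - u * (z.2 + s * z.1), z.2 + s * z.1)%R) (- u))//=; last first.
  exact: (msh2 _ s (msh _ (- u)%R mf)).
apply: eq_integral => x _; apply: eq_integral => y _; congr (f (_, _)).
  have -> : (x + - u * y + - u * (y + s * (x + - u * y)) =
    x * (1 - u * s) + y * (- u - u + u * (u * s)))%R by ring.
  rewrite su; have -> : (- u - u + u * (1 - c) = - (u * (1 + c)))%R by ring.
  by rewrite uc; ring.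
have -> : (y + s * (x + - u * y) = s * x + (1 - u * s) * y)%R by ring.
by rewrite su; ring.
Qed.

Lemma gauss_rotation (f : RR -> \bar R) (c s : R) :
  (0 <= c)%R -> (c ^+ 2 + s ^+ 2 = 1)%R ->
  measurable_fun setT f -> (forall x, 0 <= f x) ->
  \int[gauss]_x \int[gauss]_y f (c * x - s * y, s * x + c * y)%R =
  \int[gauss]_x \int[gauss]_y f (x, y).
Proof.
move=> c0 cs mf f0.
have dens (g : RR -> \bar R) : measurable_fun setT g -> (forall x, 0 <= g x) ->
    \int[gauss]_x \int[gauss]_y g (x, y) =
    \int[leb]_x \int[leb]_y (g (x, y) * (gpdf x * gpdf y)%:E).
  move=> mg g0; rewrite integral_gauss.
  - apply: eq_integral => x _; rewrite integral_gauss//; last exact: measurableT_comp.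
    rewrite -ge0_integralZr//.
    + by apply: eq_integral => y _; rewrite EFinM muleCA muleC muleA.
    + apply: emeasurable_funM; first exact: measurableT_comp.
      by apply/measurable_EFinP; exact: measurable_gpdf.
    + by move=> y _; rewrite mule_ge0// lee_fin gpdf_ge0.
    + by rewrite lee_fin gpdf_ge0.
  - exact: (measurable_fun_fubini_tonelli_F (m2 := gauss)).
  - by move=> x; exact: integral_ge0.
have mrot : measurable_fun setT (fun z : RR => (c * z.1 - s * z.2, s * z.1 + c * z.2)%R).
  apply: measurable_fun_pair.
    by apply: measurable_funB; apply: measurable_funM.
  by apply: measurable_funD; apply: measurable_funM.
rewrite (dens (fun z : RR => f (c * z.1 - s * z.2, s * z.1 + c * z.2)%R))//; last first.
  exact: (measurableT_comp mf mrot).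
rewrite (dens f mf f0).
pose g (z : RR) := f z * (gpdf z.1 * gpdf z.2)%:E.
rewrite -[RHS](integral_rotation_leb (f := g) c0 cs); first last.
- by move=> z; rewrite mule_ge0// lee_fin mulr_ge0// gpdf_ge0.
- apply: emeasurable_funM => //; apply/measurable_EFinP.
  by apply: measurable_funM; apply: measurableT_comp => //; exact: measurable_gpdf.
apply: eq_integral => x _; apply: eq_integral => y _; rewrite /g /=; congr (_ * _%:E).
rewrite !gpdfE mulrACA -expRD [RHS]mulrACA -expRD; congr (_ * expR _)%R.
have : (c ^+ 2 = 1 - s ^+ 2)%R by rewrite -cs addrK.
by move=> c2; field: c2.
Qed.

End Gaussian.

(** * Joint law of two linear forms of a Gaussian vector *)
Section merge.
Context {R : realType}.
Local Open Scope ereal_scope.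
Local Notation N := (@gauss R).
Local Notation RR := (measurableTypeR R * measurableTypeR R)%type.

Lemma measurable_lin2 (a b : R) :
  measurable_fun setT (fun z : RR => (a * z.1 + b * z.2)%R).
Proof. by apply: measurable_funD; apply: measurable_funM. Qed.

Lemma rotation_coeff (a b : R) : (0 <= a)%R -> exists c s rho : R,
  [/\ (0 <= c)%R, (c ^+ 2 + s ^+ 2 = 1)%R, (0 <= rho)%R,
      a = (rho * c)%R & b = (rho * s)%R].
Proof.
move=> a0; set rho := Num.sqrt (a ^+ 2 + b ^+ 2).
have rho2 : (rho ^+ 2 = a ^+ 2 + b ^+ 2)%R.
  by rewrite sqr_sqrtr// addr_ge0 ?sqr_ge0.
have [r0|r0] := eqVneq rho 0%R.
  exists 1%R, 0%R, 0%R; rewrite expr1n expr0n/= addr0 !mul0r; split=> //.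
  - by move: rho2; rewrite r0 expr0n/= => /esym/eqP;
    rewrite paddr_eq0 ?sqr_ge0// !sqrf_eq0 => /andP[/eqP].
  - by move: rho2; rewrite r0 expr0n/= => /esym/eqP;
    rewrite paddr_eq0 ?sqr_ge0// !sqrf_eq0 => /andP[_ /eqP].
exists (a / rho)%R, (b / rho)%R, rho; split.
- by rewrite divr_ge0// sqrtr_ge0.
- by rewrite !exprMn -mulrDl -rho2 exprVn divff// sqrf_eq0.
- exact: sqrtr_ge0.
- by rewrite mulrC divfK.
- by rewrite mulrC divfK.
Qed.

Lemma integral_gauss_cst (c : \bar R) : \int[N]_x c = c.
Proof.
rewrite integral_cst// [X in _ * X](_ : _ = 1) ?mule1//.
exact: (probability_setT N).
Qed.

Lemma gauss_add (a b : R) : (0 <= a)%R ->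
  exists rho : R, [/\ (0 <= rho)%R, (rho ^+ 2 = a ^+ 2 + b ^+ 2)%R &
   forall g : R -> \bar R, measurable_fun setT g -> (forall x, 0 <= g x) ->
   \int[N]_x \int[N]_y g (a * x + b * y)%R = \int[N]_x g (rho * x)%R].
Proof.
move=> a0; have [c [s [rho [c0 cs rho0 ac bs]]]] := rotation_coeff b a0.
exists rho; split => // [|g mg g0]; first by rewrite ac bs !exprMn -mulrDr cs mulr1.
have mG : measurable_fun setT (fun z : RR => g (a * z.1 + b * z.2)%R).
  exact: measurableT_comp mg (measurable_lin2 a b).
have /= <- := gauss_rotation c0 cs mG (fun z => g0 _).
apply: eq_integral => x _; rewrite -[RHS](integral_gauss_cst).
apply: eq_integral => y _; congr g; rewrite ac bs.
transitivity (rho * (c ^+ 2 + s ^+ 2) * x)%R; first by ring.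
by rewrite cs mulr1.
Qed.

(** The triple (p, q, r) is the triangular factor of a 2 x 2 Gram matrix.  Adding
    an independent Gaussian in the direction (u, v) rotates the coordinates x and
    z so that z disappears from the first form, then absorbs the rest of z into y
    by [gauss_add]; the squares and products transform as the Gram matrix does. *)
Lemma gauss_merge (p q r u v : R) : (0 <= p)%R -> (0 <= r)%R ->
  exists p' q' r' : R, [/\ (0 <= p')%R, (0 <= r')%R &
   [/\ (p' ^+ 2 = p ^+ 2 + u ^+ 2)%R, (p' * q' = p * q + u * v)%R,
      (q' ^+ 2 + r' ^+ 2 = q ^+ 2 + r ^+ 2 + v ^+ 2)%R &
   forall f : RR -> \bar R, measurable_fun setT f -> (forall z, 0 <= f z) ->
     \int[N]_x \int[N]_y \int[N]_z
        f (p * x + u * z, q * x + r * y + v * z)%R =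
     \int[N]_x \int[N]_y f (p' * x, q' * x + r' * y)%R]].
Proof.
move=> p0 r0; have [c [s [rho [c0 cs rho0 pc us]]]] := rotation_coeff u p0.
have [r' [r'0 r'2 addr']] := gauss_add (- q * s + v * c)%R r0.
exists rho, (q * c + v * s)%R, r'; split=> //; split.
- by rewrite pc us !exprMn -mulrDr cs mulr1.
- by rewrite pc us; ring.
- rewrite r'2.
  transitivity (r ^+ 2 + (q ^+ 2 + v ^+ 2) * (c ^+ 2 + s ^+ 2))%R; first by ring.
  by rewrite cs; ring.
move=> f mf f0.
pose F (w : RR) (y : R) := f (p * w.1 + u * w.2, q * w.1 + r * y + v * w.2)%R.
have mF : measurable_fun setT (fun w : (RR * measurableTypeR R)%type => F w.1 w.2).
  apply: measurableT_comp => //; apply: measurable_fun_pair.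
    exact: measurableT_comp (measurable_lin2 p u) _.
  by repeat apply: measurable_funD; apply: measurable_funM => //;
     apply: measurableT_comp.
have F0 w y : 0 <= F w y by exact: f0.
transitivity (\int[N]_x \int[N]_z \int[N]_y F (x, z) y).
  apply: eq_integral => x _.
  pose H (w : RR) := F (x, w.2) w.1.
  have mH : measurable_fun setT H.
    have ms : measurable_fun setT
        (fun w : RR => (((x, w.2), w.1) : (RR * measurableTypeR R)%type)).
      by do 2 (apply: measurable_fun_pair => //).
    exact: (measurableT_comp mF ms).
  by have /= -> := @fubini_tonelli _ _ _ _ _ N N H mH (fun w => F0 _ _).
pose G (w : RR) := \int[N]_y F w y.
have mG : measurable_fun setT G.
  exact: (@measurable_fun_fubini_tonelli_F _ _ _ _ _ N _ mF (fun w => F0 _ _)).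
have G0 w : 0 <= G w by exact: integral_ge0.
have /= <- := gauss_rotation c0 cs mG G0.
apply: eq_integral => x _.
pose g (t : R) := f (rho * x, (q * c + v * s) * x + t)%R.
have mg : measurable_fun setT g.
  by apply: measurableT_comp => //; apply: measurable_fun_pair => //; exact: measurable_funD.
have := addr' g mg (fun _ => f0 _); rewrite /g => <-.
rewrite /G /F /=.
have mgl : measurable_fun setT (fun z : RR => g (r * z.1 + (- q * s + v * c) * z.2)%R).
  exact: measurableT_comp mg (measurable_lin2 _ _).
have /= -> := @fubini_tonelli _ _ _ _ _ N N _ mgl (fun w => f0 _).
apply: eq_integral => z _; apply: eq_integral => y _; rewrite /g; congr (f (_, _)).
  rewrite pc us; transitivity (rho * (c ^+ 2 + s ^+ 2) * x)%R; first by ring.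
  by rewrite cs mulr1.
by ring.
Qed.

End merge.

Section gauss_vector.
Context d (Omega : measurableType d) (R : realType) (P : probability Omega R).
Local Open Scope ereal_scope.
Local Notation N := (@gauss R).
Local Notation RR := (measurableTypeR R * measurableTypeR R)%type.
Variables (n : nat) (V : Omega -> 'cV[R]_n).
Hypothesis hV : std_gaussian_vector P V.

Let mV : forall j, measurable_fun setT (fun w => V w j 0%R).
Proof. exact: hV.1. Qed.

Lemma coord_prob (j : 'I_n) (A : set R) : measurable A ->
  P [set w | A (V w j 0%R)] = N A.
Proof.
move=> mA; apply/esym; have := hV.2 (fun k => if k == j then A else setT) (fun k => _).
rewrite (bigD1 j)//= eqxx big1 ?mule1; last first.
  by move=> k /negPf ->; exact: (probability_setT N).
move=> <-; last by move=> k; case: ifP.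
congr (P _); apply/seteqP; split => w /=; first by move=> /(_ j); rewrite eqxx.
by move=> Aw k; case: ifP => [/eqP ->|].
Qed.

Lemma coord_law (j : 'I_n) (f : R -> \bar R) :
  measurable_fun setT f -> (forall x, 0 <= f x) ->
  \int[P]_w f (V w j 0%R) = \int[N]_x f x.
Proof.
move=> mf f0.
have mX : @measurable_fun _ _ Omega (measurableTypeR R) setT (fun w => V w j 0%R).
  exact: mV.
pose X : {RV P >-> measurableTypeR R} :=
  HB.pack (fun w => V w j 0%R) (isMeasurableFun.Build _ _ _ _ _ mX).
transitivity (\int[distribution P X]_x f x); first by rewrite ge0_integral_distribution.
apply: eq_measure_integral => A mA _.
exact: (coord_prob j mA).
Qed.

Let G (j : 'I_n) : set (set Omega) :=
  preimage_set_system setT (fun w => V w j 0%R) measurable.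

Let Gfam : indep_family P G.
Proof.
split.
- by move=> j; exists setT; rewrite ?preimage_setT ?setIT.
- by move=> j _ _ [A mA <-] [B mB <-]; exists (A `&` B); [exact: measurableI|rewrite !setTI].
- by move=> j _ [A mA <-]; exact: mV.
- move=> E GE.
  have /choice[B BE] : forall j, exists B, measurable B /\ E j = (fun w => V w j 0%R) @^-1` B.
    by move=> j; have [B mB <-] := GE j; exists B; rewrite setTI.
  have mB j : measurable (B j) by have [] := BE j.
  rewrite (_ : \bigcap_(j in setT) E j = [set w | forall j, B j (V w j 0%R)]); last first.
    apply/seteqP; split => w h j; first by have := h j Logic.I; rewrite (BE j).2.
    by rewrite (BE j).2 => _; exact: h.
  rewrite hV.2//; apply: eq_bigr => j _.
  by rewrite -(coord_prob j (mB j)) (BE j).2.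
Qed.

(** Induction on the coordinates: [gauss_merge] adds one independent coordinate
    at a time.  The conclusion is the Cholesky factorisation of the covariance
    of the two linear forms. *)
Lemma gauss_vector_law (u v : 'cV[R]_n) :
  exists p q r : R, [/\ (0 <= p)%R, (0 <= r)%R &
   [/\ (p ^+ 2 = dotv u u)%R, (p * q = dotv u v)%R,
      (q ^+ 2 + r ^+ 2 = dotv v v)%R &
   forall f : RR -> \bar R, measurable_fun setT f -> (forall z, 0 <= f z) ->
     \int[P]_w f (dotv (V w) u, dotv (V w) v) =
     \int[N]_x \int[N]_y f (p * x, q * x + r * y)%R]].
Proof.
rewrite /dotv.
suff : forall s : seq 'I_n, uniq s -> exists p q r : R, [/\ (0 <= p)%R, (0 <= r)%R &
   [/\ (p ^+ 2 = \sum_(j <- s) u j 0 * u j 0)%R, (p * q = \sum_(j <- s) u j 0 * v j 0)%R,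
      (q ^+ 2 + r ^+ 2 = \sum_(j <- s) v j 0 * v j 0)%R &
   forall f : RR -> \bar R, measurable_fun setT f -> (forall z, 0 <= f z) ->
     \int[P]_w f (\sum_(j <- s) V w j 0%R * u j 0, \sum_(j <- s) V w j 0%R * v j 0)%R =
     \int[N]_x \int[N]_y f (p * x, q * x + r * y)%R]].
  by apply; exact: index_enum_uniq.
elim=> [_|j s IH /= /andP[js us]].
  exists 0%R, 0%R, 0%R; split=> //; split; rewrite ?big_nil ?expr0n/= ?mul0r ?addr0//.
  move=> f mf f0; under eq_integral do rewrite !big_nil.
  rewrite integral_cst// [X in _ * X](_ : _ = 1) ?mule1//; last exact: probability_setT.
  under [RHS]eq_integral do under eq_integral do rewrite !mul0r addr0.
  by rewrite !integral_gauss_cst.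
have [p [q [r [p0 r0 [pp pq qr law]]]]] := IH us.
have [p' [q' [r' [p'0 r'0 [pp' pq' qr' merge]]]]] := gauss_merge q (u j 0%R) (v j 0%R) p0 r0.
exists p', q', r'; split=> //; rewrite !big_cons; split=> //.
- by rewrite pp' pp -expr2 addrC.
- by rewrite pq' pq addrC.
- by rewrite qr' qr -expr2 addrC.
move=> f mf f0; rewrite -merge//.
pose F (z : RR) := \int[N]_x f (z.1 + u j 0 * x, z.2 + v j 0 * x)%R.
have mf' : measurable_fun setT (fun t : (RR * measurableTypeR R)%type =>
    f (t.1.1 + u j 0 * t.2, t.1.2 + v j 0 * t.2)%R).
  apply: measurableT_comp => //; apply: measurable_fun_pair; apply: measurable_funD.
  - exact: measurableT_comp.
  - exact: measurable_funM.
  - exact: measurableT_comp.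
  - exact: measurable_funM.
have mF : measurable_fun setT F.
  exact: (@measurable_fun_fubini_tonelli_F _ _ _ _ _ N _ mf' (fun w => f0 _)).
have F0 z : 0 <= F z by exact: integral_ge0.
rewrite -[RHS](law F mF F0).
pose G1 := sub_family G [set` s]; pose G2 := sub_family G [set j].
have [_ _ Gm _] := Gfam.
have subm (S : set 'I_n) : sub_family G S `<=` measurable by move=> A [k _]; exact: Gm.
have ind : indep_sets P <<s G1 >> <<s G2 >>.
  apply: indep_sub_family => //; apply/seteqP; split=> k //= [sk kj].
  by move: js; rewrite -kj sk.
have mcoord (S : set 'I_n) k : S k -> measurable_fun setT
   ((fun w => V w k 0%R) : g_sigma_algebraType (sub_family G S) -> R).
  move=> Sk _ A mA; rewrite setTI; apply: sub_sigma_algebra; exists k => //.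
  by exists A => //; rewrite setTI.
have msum (c : 'cV[R]_n) : measurable_fun setT
   ((fun w => \sum_(k <- s) V w k 0%R * c k 0)%R : g_sigma_algebraType G1 -> R).
  suff : forall r, {subset r <= s} -> measurable_fun setT
     ((fun w => \sum_(k <- r) V w k 0%R * c k 0)%R : g_sigma_algebraType G1 -> R) by apply.
  elim=> [_|k t IHt ts].
    rewrite [X in measurable_fun _ X](_ : _ = cst 0%R); first exact: measurable_cst.
    by apply/funext => w; rewrite big_nil.
  rewrite [X in measurable_fun _ X](_ : _ =
      (fun w => V w k 0%R * c k 0 + \sum_(l <- t) V w l 0%R * c l 0)%R); last first.
    by apply/funext => w; rewrite big_cons.
  apply: measurable_funD; last by apply: IHt => l lt; apply: ts; rewrite inE lt orbT.
  by apply: measurable_funM => //; apply: mcoord; apply: ts; exact: mem_head.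
pose g (z : (g_sigma_algebraType G1 * g_sigma_algebraType G2)%type) : \bar R :=
  f (\sum_(k <- s) V z.1 k 0 * u k 0 + u j 0 * V z.2 j 0,
     \sum_(k <- s) V z.1 k 0 * v k 0 + v j 0 * V z.2 j 0)%R.
have mg : measurable_fun setT g.
  apply: measurableT_comp => //; apply: measurable_fun_pair; apply: measurable_funD.
  - exact: (measurableT_comp (msum u)).
  - by apply: measurable_funM => //; apply: (measurableT_comp (mcoord [set j] j _)).
  - exact: (measurableT_comp (msum v)).
  - by apply: measurable_funM => //; apply: (measurableT_comp (mcoord [set j] j _)).
transitivity (\int[P]_w g (w, w)).
  by apply: eq_integral => w _; rewrite /g/= !big_cons; congr (f (_, _)); rewrite addrC mulrC.
rewrite (indep_integral (subm _) (subm _) ind mg) => [|z]; last exact: f0.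
apply: eq_integral => w _; rewrite /g/= /F.
rewrite -(coord_law j (f := fun x => f (\sum_(k <- s) V w k 0%R * u k 0 + u j 0 * x,
     \sum_(k <- s) V w k 0%R * v k 0 + v j 0 * x)%R))//.
by apply: measurableT_comp => //; apply: measurable_fun_pair; apply: measurable_funD => //;
  apply: measurable_funM.
Qed.

End gauss_vector.

(** * Gaussian moments *)
Section pi_bounds.
Context {R : realType}.
Implicit Types x : R.

Lemma ge0_of_derive (f g : R -> R) : f 0 = 0 -> (forall x, is_derive x 1 f (g x)) ->
  (forall x, 0 <= x -> 0 <= g x) -> forall x, 0 <= x -> 0 <= f x.
Proof.
move=> f0 fg g0 x x0; rewrite -f0.
apply: (@ger0_derive1_ndecry _ f 0) => //.
- by move=> y; rewrite in_itv/= andbT => y0; rewrite derive1E (@derive_val _ _ _ _ _ _ _ (fg y)) g0// ltW.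
- apply: continuous_subspaceT => y; apply: differentiable_continuous.
  by apply/derivable1_diffP; have [] := fg y.
Qed.

Lemma cos_ge x : 0 <= x -> 0 <= cos x - 1 + x ^+ 2 / 2.
Proof.
have sinle (y : R) : 0 <= y -> 0 <= y - sin y.
  move: y; apply: (@ge0_of_derive (fun y => y - sin y) (fun y => 1 - cos y)).
  - by rewrite sin0 subrr.
  - by move=> z _; rewrite subr_ge0 cos_le1.
move: x; apply: (@ge0_of_derive (fun y => cos y - 1 + y ^+ 2 / 2) (fun y => y - sin y)) => //.
- by rewrite cos0 subrr expr0n/= mul0r addr0.
- by move=> z; apply: is_derive_eq; rewrite /GRing.scale/=; field.
Qed.

Lemma sin_ge x : 0 <= x -> x - x ^+ 3 / 6 <= sin x.
Proof.
move=> x0; rewrite -subr_ge0; move: x x0.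
apply: (@ge0_of_derive (fun x => sin x - (x - x ^+ 3 / 6)) (fun y => cos y - 1 + y ^+ 2 / 2)) => //.
- by rewrite sin0 expr0n/= mul0r !subr0.
- by move=> z; apply: is_derive_eq; rewrite /GRing.scale/=; field.
- exact: cos_ge.
Qed.

Lemma cos_pi4 : cos (pi / 4 : R) ^+ 2 = 1 / 2.
Proof.
have := cos_mulr2n (pi / 4 : R).
have -> : (pi / 4) *+ 2 = pi / 2 :> R by rewrite -mulr_natr; field.
by rewrite cos_pihalf => h; lra.
Qed.

(** Taylor bounds at pi / 4, where sine and cosine are both the square root of
    1/2.  The upper bound is just sharp enough for [growth_bound]. *)
Lemma pi_bounds : 3 <= (pi : R) <= 319%:R / 100%:R.
Proof.
have s2 : sin (pi / 4 : R) ^+ 2 = 1 / 2 by rewrite sin2cos2 cos_pi4; lra.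
have p2 := @pi_ge2 R; have p4 : (pi : R) < 4 by have := @pihalf_lt2 R; lra.
apply/andP; split.
- rewrite leNgt; apply/negP => p3.
  have := @cos_ge (pi / 4) _; rewrite divr_ge0 ?pi_ge0// => /(_ isT).
  have y34 : (pi / 4 : R) ^+ 2 <= 9%:R / 16%:R by nra.
  have := cos_pi4; set c := cos _ => c2 cg.
  have : 23%:R / 32%:R <= c by lra.
  by nra.
- rewrite leNgt; apply/negP => p3.
  set y := (pi / 4 : R); have y1 : 7975%:R / 10000%:R <= y by rewrite /y; lra.
  have y2 : y <= 1 by rewrite /y; lra.
  have := @sin_ge y; rewrite -/y in s2 => /(_ ltac:(lra)) sy.
  have yy : y ^+ 2 <= (17975%:R * y - 7975%:R) / 10000%:R by nra.
  have y3 : y ^+ 3 <= (17975%:R * y ^+ 2 - 7975%:R * y) / 10000%:R.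
    rewrite exprSr; apply: (le_trans (ler_wpM2r _ yy)); first lra.
    by rewrite expr2; lra.
  have : 712%:R / 1000%:R <= y - y ^+ 3 / 6 by lra.
  move=> h; have : 712%:R / 1000%:R <= sin y by lra.
  by move=> h2; nra.
Qed.
End pi_bounds.

Section moments.
Context {R : realType}.
Local Open Scope ereal_scope.
Local Notation N := (@gauss R).
Local Notation leb := (@lebesgue_measure R).

Definition gpeak : R := ((Num.sqrt (pi *+ 2))^-1)%R.

Let E (x : R) : R := expR (- (x ^+ 2 / 2)).

Let E_derive (x : R) : is_derive x (1%R : R) E (- x * E x)%R.
Proof.
by apply: is_derive_eq; rewrite /E /GRing.scale/=; field.
Qed.

(** From exp u >= u^3 / 6 at u = x^2 / 2 and x^2 + 2 <= 3 x^2. *)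
Let E_bound (x : R) : (1 <= x)%R -> ((x ^+ 2 + 2) * E x <= 144%:R * x^-1)%R.
Proof.
move=> x1; have x0 : (0 < x)%R by lra.
have u0 : (0 <= x ^+ 2 / 2)%R by rewrite divr_ge0// sqr_ge0.
have := expR_ge1Dxn 2 u0; rewrite -/(3`!)%N (_ : 3`! = 6)%N// => hE.
rewrite /E expRN ler_pdivrMr ?expR_gt0//.
rewrite -ler_pdivrMl ?mulr_gt0// ?invr_gt0//.
apply: le_trans hE; rewrite invrM ?unitfE ?invr_eq0 ?gt_eqF// invrK.
have x3 : (x ^+ 3 <= x ^+ 6)%R by rewrite ler_weXn2l.
have x6 : (x ^+ 1 <= x ^+ 6)%R by rewrite ler_weXn2l.
have -> : (x / 144%:R * (x ^+ 2 + 2) = (x ^+ 3 + 2 * x) / 144%:R)%R by field.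
have -> : ((x ^+ 2 / 2) ^+ 3 / 6%:R = x ^+ 6 / 48%:R)%R by field.
by rewrite expr1 in x6; lra.
Qed.

Let lim_bound (F : R -> R) : (forall x, (1 <= x)%R -> (`|F x| <= (x ^+ 2 + 2) * E x)%R) ->
  F x @[x --> +oo%R] --> (0 : R)%R.
Proof.
move=> FE.
have c : (144%:R * x^-1 @[x --> +oo%R] --> (0 : R))%R.
  rewrite -[X in _ --> X](mulr0 144%:R); apply: cvgM; first exact: cvg_cst.
  apply/gtr0_cvgV0; last exact: cvg_id.
  exact: nbhs_pinfty_gt.
apply/norm_cvg0P; apply: (squeeze_cvgr _ (cvg_cst _) c).
near=> x; rewrite normr_ge0/=; apply: le_trans (E_bound _); first apply: FE.
all: near: x; exact: nbhs_pinfty_ge.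
Unshelve. all: by end_near. Qed.

Let half_FTC (f F : R -> R) (a l : R) :
  (forall x, is_derive x (1%R : R) F (f x)) -> continuous f ->
  F x @[x --> +oo%R] --> l -> (forall x, (a <= x)%R -> (0 <= f x)%R) ->
  \int[leb]_(x in `[a, +oo[) (f x)%:E = (l - F a)%:E.
Proof.
move=> Ff cf Fl f0.
have dF x : derivable F x 1 by have [] := Ff x.
rewrite (@ge0_continuous_FTC2y _ f F a l) ?EFinB//.
- exact: continuous_subspaceT.
- apply: cvg_at_right_filter.
  by apply: differentiable_continuous; exact/derivable1_diffP.
- by move=> x _; rewrite derive1E (@derive_val _ _ _ _ _ _ _ (Ff x)).
Qed.

Let seg_FTC (f F : R -> R) (a b : R) : (a < b)%R ->
  (forall x, is_derive x (1%R : R) F (f x)) -> continuous f ->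
  \int[leb]_(x in `[a, b]) (f x)%:E = (F b - F a)%:E.
Proof.
move=> ab Ff cf.
have dF x : derivable F x 1 by have [] := Ff x.
have cF x : {for x, continuous F}.
  by apply: differentiable_continuous; exact/derivable1_diffP.
rewrite (@continuous_FTC2 _ f F a b) ?EFinB//.
- exact: continuous_subspaceT.
- split=> //; [exact: cvg_at_right_filter (cF a)|exact: cvg_at_left_filter (cF b)].
- by move=> x _; rewrite derive1E (@derive_val _ _ _ _ _ _ _ (Ff x)).
Qed.

Let half_split (f : R -> R) (b : R) : (0 <= b)%R -> measurable_fun setT f ->
  (forall x, (0 <= x)%R -> (0 <= f x)%R) ->
  \int[leb]_(x in `[0%R, +oo[) (f x)%:E =
  \int[leb]_(x in `[0%R, b]) (f x)%:E + \int[leb]_(x in `[b, +oo[) (f x)%:E.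
Proof.
move=> b0 mf f0; rewrite -integral_itv_obnd_cbnd; last first.
  by apply/measurable_EFinP; exact: measurable_funTS.
rewrite (@itv_bndbnd_setU _ _ _ (BRight b))// ge0_integral_setU//.
- by apply/measurable_EFinP; exact: measurable_funTS.
- move=> x [/=|/=]; rewrite in_itv/= lee_fin; first by move=> /andP[/f0].
  by rewrite andbT => bx; apply: f0; lra.
- apply/disj_set2P; apply/seteqP; split=> x //=; rewrite !in_itv/= andbT => -[/andP[_ xb] bx].
  by move: (le_lt_trans xb bx); rewrite ltxx.
Qed.

Let cE : continuous E.
Proof.
by move=> x; apply: differentiable_continuous; apply/derivable1_diffP;
  have [] := E_derive x.
Qed.

Let gpdf_E x : gpdf x = (gpeak * E x)%R. Proof. exact: gpdfE. Qed.

Lemma gpeak_gt0 : (0 < gpeak)%R.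
Proof. by rewrite invr_gt0 sqrtr_gt0 mulrn_wgt0// pi_gt0. Qed.

Lemma gpeak2 : (gpeak ^+ 2 = (2 * pi)^-1)%R.
Proof.
by rewrite exprVn sqr_sqrtr ?mulr_natl// mulrn_wge0// pi_ge0.
Qed.

Let gauss_even (f : R -> R) : continuous f -> (forall x, (0 <= f x)%R) ->
  (forall x, f (- x)%R = f x) ->
  \int[N]_x (f x)%:E = (2 * gpeak)%:E * \int[leb]_(x in `[0%R, +oo[) (f x * E x)%:E.
Proof.
move=> cf f0 fN.
have mfE : measurable_fun setT (fun x => f x * E x)%R.
  by apply: continuous_measurable_fun => x; apply: continuousM; [exact: cf|exact: cE].
have E0 x : (0 <= E x)%R by exact: expR_ge0.
rewrite integral_gauss//=.
- under eq_integral do rewrite gpdf_E -EFinM mulrCA EFinM.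
  rewrite ge0_integralZl//; first last.
  + by rewrite lee_fin ltW// gpeak_gt0.
  + by move=> x _; rewrite lee_fin mulr_ge0.
  + exact/measurable_EFinP.
  rewrite (ge0_symfun_integralT (f := fun x : R => f x * E x)%R).
  + by rewrite -set_itvcy EFinM muleA; congr (_ * _); rewrite muleC.
  + by move=> x; rewrite mulr_ge0.
  + by move=> x; apply: continuousM; [exact: cf|exact: cE].
  + by move=> x /=; rewrite fN /E sqrrN.
- by apply/measurable_EFinP; exact: continuous_measurable_fun.
Qed.

Let half_mass : (2 * gpeak)%:E * \int[leb]_(x in `[0%R, +oo[) (E x)%:E = 1.
Proof.
have c1 : continuous (fun _ : R => 1%R : R) by move=> x; exact: cst_continuous.
have := gauss_even c1 (fun=> ler01) (fun=> erefl).
under [X in _ = _ * X -> _]eq_integral do rewrite mul1r.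
by move=> <-; rewrite integral_gauss_cst.
Qed.

Lemma gauss_abs : \int[N]_x (`|x|%R)%:E = (2 * gpeak)%:E.
Proof.
rewrite gauss_even//; last 2 first.
- exact: norm_continuous.
- by move=> x; rewrite normrN.
rewrite (_ : \int[leb]_(x in _) _ = 1) ?mule1//.
transitivity (\int[leb]_(x in `[0%R, +oo[) (x * E x)%:E).
  apply: eq_integral; by move=> x; rewrite inE/= in_itv/= andbT => x0; rewrite ger0_norm.
have dF (x : R) : is_derive x (1%R : R) (fun x : R => (- E x)%R) (x * E x)%R.
  by apply: is_derive_eq; rewrite /E /GRing.scale/=; field.
rewrite (@half_FTC _ _ 0%R 0%R dF).
- by rewrite /E expr0n/= mul0r oppr0 expR0 opprK add0r.
- by move=> x; apply: continuousM; [exact: id|exact: cE].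
- apply: lim_bound => x x1; rewrite normrN ger0_norm ?expR_ge0// ler_peMl ?expR_ge0//.
  nra.
- by move=> x x0; rewrite mulr_ge0// expR_ge0.
Qed.

Lemma gauss_abs3 : \int[N]_x ((`|x| ^+ 3)%R)%:E = (4 * gpeak)%:E.
Proof.
have c3 : continuous (fun x : R => `|x| ^+ 3 : R)%R.
  move=> x; rewrite (_ : (fun x : R => `|x| ^+ 3)%R = (fun x => `|x| * (`|x| * `|x|))%R).
    by apply: continuousM; [|apply: continuousM]; exact: norm_continuous.
  by apply/funext => y; rewrite !exprS expr0 mulr1.
rewrite (gauss_even c3); first last.
- by move=> x; rewrite normrN.
- by move=> x; rewrite exprn_ge0.
have -> : (\int[leb]_(x in `[0%R, +oo[) (`|x| ^+ 3 * E x)%:E) =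
    \int[leb]_(x in `[0%R, +oo[) (x ^+ 3 * E x)%:E.
  apply: eq_integral; by move=> x; rewrite inE/= in_itv/= andbT => x0; rewrite ger0_norm.
have dF (x : R) : is_derive x (1%R : R) (fun x : R => (- ((x ^+ 2 + 2) * E x))%R) (x ^+ 3 * E x)%R.
  by apply: is_derive_eq; rewrite /E /GRing.scale/=; field.
rewrite (@half_FTC _ _ 0%R 0%R dF).
- by rewrite /E expr0n/= mul0r oppr0 expR0 -EFinM; congr _%:E; ring.
- move=> x; apply: (@continuousM _ _ (fun y : R => y ^+ 3)%R E); [exact: exprn_continuous|exact: cE].
- apply: lim_bound => x x1; rewrite normrN ger0_norm// mulr_ge0 ?expR_ge0//.
  nra.
- by move=> x x0; rewrite mulr_ge0 ?expR_ge0// exprn_ge0.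
Qed.

(** (x^2 - 1) E is minus the derivative of x E, and x E vanishes at 0 and at
    infinity.  Its sign changes at 1, so the half line is split there in order to
    integrate nonnegative functions only. *)
Lemma gauss_sqr : \int[N]_x ((x ^+ 2)%R)%:E = 1.
Proof.
have c2 : continuous (fun x : R => x ^+ 2 : R)%R by move=> x; exact: exprn_continuous.
rewrite (gauss_even c2); first last.
- by move=> x; rewrite sqrrN.
- by move=> x; rewrite sqr_ge0.
rewrite -half_mass; congr (_ * _).
have mE : measurable_fun setT E by exact: continuous_measurable_fun.
have m2 : measurable_fun setT (fun x : R => x ^+ 2 * E x)%R.
  by apply: measurable_funM => //; exact: measurable_funX.
have E0 x : (0 <= E x)%R by exact: expR_ge0.
have cf (c : R) : continuous (fun x : R => (c * (x ^+ 2 - 1)) * E x)%R.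
  move=> x; apply: (@continuousM _ _ (fun x : R => c * (x ^+ 2 - 1))%R E); last exact: cE.
  apply: continuousM; first exact: cst_continuous.
  by apply: continuousB; [exact: exprn_continuous|exact: cst_continuous].
have dF (c x : R) : is_derive x (1%R : R) (fun x : R => (- c * x * E x)%R) (c * (x ^+ 2 - 1) * E x)%R.
  by apply: is_derive_eq; rewrite /E /GRing.scale/=; field.
rewrite (half_split ler01 m2); last by move=> x _; rewrite mulr_ge0// sqr_ge0.
rewrite (half_split ler01 mE); last by [].
have -> : \int[leb]_(x in `[0%R, 1%R]) (E x)%:E =
    \int[leb]_(x in `[0%R, 1%R]) (x ^+ 2 * E x)%:E + (E 1)%:E.
  rewrite (_ : (E 1)%:E = \int[leb]_(x in `[0%R, 1%R]) (- 1 * (x ^+ 2 - 1) * E x)%:E).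
    rewrite -ge0_integralD//.
    - by apply: eq_integral => x _; rewrite -EFinD; congr _%:E; ring.
    - by move=> x _; rewrite lee_fin mulr_ge0// sqr_ge0.
    - by apply/measurable_EFinP; exact: measurable_funTS.
    - move=> x /=; rewrite in_itv/= => /andP[x0 x1]; rewrite lee_fin mulr_ge0//; nra.
    - by apply/measurable_EFinP; apply: measurable_funTS; exact: (continuous_measurable_fun (cf _)).
  by rewrite (@seg_FTC _ _ 0%R 1%R ltr01 (dF (- 1)%R) (cf _)); congr _%:E; ring.
have -> : \int[leb]_(x in `[1%R, +oo[) (x ^+ 2 * E x)%:E =
    \int[leb]_(x in `[1%R, +oo[) (E x)%:E + (E 1)%:E.
  rewrite (_ : (E 1)%:E = \int[leb]_(x in `[1%R, +oo[) (1 * (x ^+ 2 - 1) * E x)%:E).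
    rewrite -ge0_integralD//.
    - by apply: eq_integral => x _; rewrite -EFinD; congr _%:E; ring.
    - by move=> x _; rewrite lee_fin.
    - by apply/measurable_EFinP; exact: measurable_funTS.
    - move=> x /=; rewrite in_itv/= andbT => x1; rewrite lee_fin mulr_ge0//; nra.
    - by apply/measurable_EFinP; apply: measurable_funTS; exact: (continuous_measurable_fun (cf _)).
  rewrite (@half_FTC _ _ 1%R 0%R (dF 1%R) (cf _)).
  - by congr _%:E; ring.
  - apply: lim_bound => x x1; have x0 : (0 <= x)%R by lra.
    have -> : (- 1 * x * E x = - (x * E x))%R by ring.
    by rewrite normrN ger0_norm ?mulr_ge0// ler_wpM2r//; nra.
  - by move=> x x1; rewrite mulr_ge0//; nra.
by rewrite addeA addeAC.
Qed.

(** The density is bounded by its peak, and the truncated square has an explicit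
    primitive. *)
Lemma gauss_tail (b t : R) : (0 <= b)%R -> (0 < t)%R ->
  \int[N]_x ((Num.max (b - t * `|x|) 0 ^+ 2)%R)%:E <= (2 * gpeak * b ^+ 3 / (3 * t))%:E.
Proof.
move=> b0 t0; pose f (x : R) := (Num.max (b - t * `|x|) 0 ^+ 2)%R.
have f0 x : (0 <= f x)%R by rewrite sqr_ge0.
have mf : measurable_fun setT f.
  apply: measurable_funX; apply: measurable_maxr => //.
  by apply: measurable_funB => //; apply: measurable_funM => //; exact: measurableT_comp.
have fE x : f x = (((b - t * `|x|) + `|b - t * `|x| |) / 2 * (((b - t * `|x|) + `|b - t * `|x| |) / 2))%R.
  rewrite /f; set z := (b - t * `|x|)%R; case: (lerP 0 z) => s0.
    by rewrite ger0_norm//; field.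
  by rewrite ltr0_norm//; field.
have cs : continuous (fun x : R => b - t * `|x| : R)%R.
  move=> x; apply: cvgB; first exact: cvg_cst.
  by apply: cvgM; [exact: cvg_cst|exact: norm_continuous].
have cf : continuous f.
  rewrite (_ : f = (fun x => ((b - t * `|x|) + `|b - t * `|x| |) / 2 *
    (((b - t * `|x|) + `|b - t * `|x| |) / 2))%R); last by apply/funext => x; exact: fE.
  have c1 : continuous (fun x : R => ((b - t * `|x|) + `|b - t * `|x| |) / 2 : R)%R.
    move=> x; apply: cvgM; last exact: cvg_cst.
    apply: cvgD; first exact: cs.
    by apply: (@continuous_comp _ _ _ (fun x : R => b - t * `|x| : R)%R Num.norm);
      [exact: cs|exact: norm_continuous].
  by move=> x; apply: cvgM; exact: c1.
rewrite (gauss_even cf f0); last by move=> x; rewrite /f normrN.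
have k0 : (0 <= 2 * gpeak)%R by rewrite mulr_ge0// ltW// gpeak_gt0.
have -> : (2 * gpeak * b ^+ 3 / (3 * t) = (2 * gpeak) * (b ^+ 3 / (3 * t)))%R by rewrite mulrA.
rewrite [leRHS]EFinM; apply: lee_wpmul2l; first by rewrite lee_fin.
apply: (@le_trans _ _ (\int[leb]_(x in `[0%R, +oo[) (f x)%:E)).
  apply: ge0_le_integral => //.
  - by move=> x _; rewrite lee_fin mulr_ge0// expR_ge0.
  - apply/measurable_EFinP/measurable_funTS; apply: measurable_funM => //.
    exact: continuous_measurable_fun.
  - by apply/measurable_EFinP; exact: measurable_funTS.
  - move=> x _; rewrite lee_fin ler_piMr//.
    by rewrite /E expR_le1 oppr_le0 divr_ge0// sqr_ge0.
have bt : (0 <= b / t)%R by rewrite divr_ge0// ltW.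
rewrite (half_split bt mf); last by move=> x _; exact: f0.
have -> : \int[leb]_(x in `[(b / t)%R, +oo[) (f x)%:E = 0.
  apply: integral0_eq => x /=; rewrite in_itv/= andbT => btx; rewrite /f.
  have x0 : (0 <= x)%R by lra.
  rewrite ger0_norm// max_r ?expr0n//.
  by rewrite subr_le0 mulrC -ler_pdivrMr.
rewrite adde0.
have [b00|bN0] := eqVneq b 0%R.
  rewrite b00 mul0r expr0n/= mul0r set_itv1 integral_set1//.
have b1 : (0 < b)%R by rewrite lt_neqAle eq_sym bN0.
have -> : \int[leb]_(x in `[0%R, (b / t)%R]) (f x)%:E =
    \int[leb]_(x in `[0%R, (b / t)%R]) ((b - t * x) ^+ 2)%:E.
  apply: eq_integral => x; rewrite inE/= in_itv/= => /andP[x0 xb]; rewrite /f ger0_norm// max_l//.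
  by rewrite subr_ge0 mulrC -ler_pdivlMr.
have dF (x : R) : is_derive x (1%R : R) (fun x : R => - ((b - t * x) ^+ 3 / (3 * t)))%R ((b - t * x) ^+ 2)%R.
  apply: is_derive_eq; rewrite /GRing.scale/=; field; lra.
rewrite (@seg_FTC _ _ 0%R (b / t)%R _ dF); first last.
- move=> x; rewrite (_ : (fun x : R => (b - t * x) ^+ 2)%R = (fun x => (b - t * x) * (b - t * x))%R).
    by apply: cvgM; (apply: cvgB; first exact: cvg_cst);
      (apply: cvgM; first exact: cvg_cst); exact: cvg_id.
  by apply/funext => y; rewrite expr2.
- by rewrite divr_gt0.
rewrite lee_fin le_eqVlt; apply/orP; left; apply/eqP; field; lra.
Qed.

(** Multiplied by the standard normal density, the integrand is sqrt 2 times the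
    centred normal density of variance 2. *)
Lemma gauss_exp : \int[N]_x (expR (x ^+ 2 / 4))%:E = (Num.sqrt 2)%:E.
Proof.
rewrite integral_gauss.
- rewrite -[RHS]mule1 -(@integral_normal_pdf R 0 (Num.sqrt 2)).
  rewrite -ge0_integralZl; first last.
  + by rewrite lee_fin sqrtr_ge0.
  + by move=> x _; rewrite lee_fin normal_pdf_ge0.
  + by apply/measurable_EFinP; exact: measurable_normal_pdf.
  + exact: measurableT.
  apply: eq_integral => x _; rewrite -!EFinM; congr _%:E.
  have s2 : (Num.sqrt 2 != 0 :> R)%R by rewrite gt_eqF// sqrtr_gt0.
  rewrite gpdf_E normal_pdfE// /normal_peak /normal_fun subr0 sqr_sqrtr// /gpeak /E.
  rewrite mulrCA -expRD.
  have -> : ((2 : R) * pi *+ 2 = 2 * (pi *+ 2))%R by rewrite -mulrnAr.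
  rewrite (@sqrtrM _ 2) ?ler0n// invfM !mulrA mulfV// mul1r; congr (_ * expR _)%R.
  by field.
- apply/measurable_EFinP; apply: measurableT_comp => //.
  by apply: measurable_funM => //; exact: measurable_funX.
- by move=> x; rewrite lee_fin expR_ge0.
Qed.

End moments.

(** * Planar Gaussian integrals and the growth of the correlation *)
Section plane.
Context {R : realType}.
Local Open Scope ereal_scope.
Local Notation N := (@gauss R).
Local Notation RR := (measurableTypeR R * measurableTypeR R)%type.

Lemma gauss_opp (f : R -> \bar R) : measurable_fun setT f -> (forall x, 0 <= f x) ->
  \int[N]_x f (- x)%R = \int[N]_x f x.
Proof.
move=> mf f0; have mfN : measurable_fun setT (fun x : R => f (- x)%R).
  exact: measurableT_comp.
have m1 : measurable_fun setT (fun x : R => f x * (gpdf x)%:E).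
  by apply: emeasurable_funM => //; apply/measurable_EFinP; exact: measurable_gpdf.
rewrite !integral_gauss//.
transitivity (\int[pushforward lebesgue_measure (-%R : measurableTypeR R -> measurableTypeR R)]_x (f x * (gpdf x)%:E)).
  have mN : measurable_fun setT (-%R : measurableTypeR R -> measurableTypeR R).
    exact: oppr_measurable.
  rewrite (ge0_integral_pushforward mN _ measurableT m1); last first.
    by move=> x _; rewrite mule_ge0// lee_fin gpdf_ge0.
  by apply: eq_integral => x _ /=; rewrite !gpdfE sqrrN.
by apply: eq_measure_integral => A mA _; exact: lebesgue_measureN.
Qed.

Lemma integral2_sym (g : RR -> R) : measurable_fun setT g -> (forall z, (0 <= g z)%R) ->
  \int[N]_x \int[N]_y (g (x, y))%:E =
  \int[N]_x \int[N]_y ((g (x, y) + g (x, - y)%R) / 2)%:E.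
Proof.
move=> mg g0; apply: eq_integral => x _.
have mx : measurable_fun setT (fun y : R => g (x, y)) by exact: measurableT_comp.
have mxN : measurable_fun setT (fun y : R => g (x, - y)%R).
  exact: (measurableT_comp mx).
transitivity (2^-1%:E * (\int[N]_y (g (x, y))%:E + \int[N]_y (g (x, - y)%R)%:E)).
  rewrite (gauss_opp (f := fun y => (g (x, y))%:E)); last 2 first.
  - exact/measurable_EFinP.
  - by move=> y; rewrite lee_fin.
  rewrite -[X in X + X]mul1e -ge0_muleDl// -EFinD muleA -EFinM.
  by rewrite (_ : 2^-1 * (1 + 1) = 1 :> R)%R ?mul1e//; field.
rewrite -ge0_integralD//; last 4 first.
- by move=> y _; rewrite lee_fin.
- exact/measurable_EFinP.
- by move=> y _; rewrite lee_fin.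
- exact/measurable_EFinP.
rewrite -ge0_integralZl//.
- by apply: eq_integral => y _; rewrite -EFinD -EFinM mulrC.
- by apply: emeasurable_funD; exact/measurable_EFinP.
- by move=> y _; rewrite adde_ge0// lee_fin.
Qed.

Lemma integral2_sqr (A B : R) : (0 <= A)%R -> (0 <= B)%R ->
  \int[N]_x \int[N]_y (A * x ^+ 2 + B * y ^+ 2)%:E = (A + B)%:E.
Proof.
move=> A0 B0.
have msq : measurable_fun setT (fun x : R => (x ^+ 2)%:E).
  by apply/measurable_EFinP; exact: measurable_funX.
have sq (c : R) : (0 <= c)%R -> \int[N]_x (c * x ^+ 2)%:E = c%:E.
  move=> c0; under eq_integral do rewrite EFinM.
  by rewrite ge0_integralZl// ?gauss_sqr ?mule1// => x _; rewrite lee_fin sqr_ge0.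
have mc (c : R) : measurable_fun setT (fun x : R => (c * x ^+ 2)%:E).
  by apply/measurable_EFinP; apply: measurable_funM => //; exact: measurable_funX.
transitivity (\int[N]_x ((A * x ^+ 2)%:E + B%:E)).
  apply: eq_integral => x _; under eq_integral do rewrite EFinD.
  rewrite ge0_integralD//.
  - by rewrite integral_gauss_cst sq.
  - by move=> y _; rewrite lee_fin mulr_ge0// sqr_ge0.
  - by move=> y _; rewrite lee_fin mulr_ge0// sqr_ge0.
  - exact: mc.
rewrite (@ge0_integralD _ _ _ N setT measurableT (fun x => (A * x ^+ 2)%:E) (cst B%:E))//.
- by rewrite integral_gauss_cst sq// EFinD.
- by move=> y _; rewrite lee_fin mulr_ge0// sqr_ge0.
- exact: mc.
Qed.

Lemma integral2_abs (c : R) : (0 <= c)%R ->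
  \int[N]_x \int[N]_y (c * (`|x| * `|y|))%:E = (2 * c / pi)%:E.
Proof.
move=> c0; have mabs : measurable_fun setT (fun x : R => `|x|%:E).
  by apply/measurable_EFinP; exact: normr_measurable.
have ab (k : R) : (0 <= k)%R -> \int[N]_x (k * `|x|)%:E = (k * (2 * gpeak))%:E.
  move=> k0; under eq_integral do rewrite EFinM.
  by rewrite ge0_integralZl// gauss_abs EFinM.
transitivity (\int[N]_x (c * (2 * gpeak) * `|x|)%:E).
  apply: eq_integral => x _; transitivity (\int[N]_y (c * `|x| * `|y|)%:E).
    by apply: eq_integral => y _; rewrite mulrA.
  by rewrite ab ?mulr_ge0//; congr _%:E; ring.
have g0 := @gpeak_gt0 R.
rewrite ab ?mulr_ge0//; last by rewrite ltW.
congr _%:E; transitivity (4 * c * gpeak ^+ 2)%R; first by ring.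
have pn : (pi : R) != 0%R by rewrite gt_eqF// pi_gt0.
by rewrite gpeak2; move: (pi : R) pn => q qn; field.
Qed.

Lemma measurable_max2 (r t : R) :
  measurable_fun setT (fun z : RR => (Num.max (r * `|z.2| - t * `|z.1|) 0) ^+ 2)%R.
Proof.
apply: measurable_funX; apply: measurable_maxr => //.
by apply: measurable_funB; apply: measurable_funM => //; apply: measurableT_comp => //;
  exact: measurableT_comp.
Qed.

Lemma integral2_tail (r t : R) : (0 <= r)%R -> (0 < t)%R ->
  \int[N]_x \int[N]_y ((Num.max (r * `|y| - t * `|x|) 0) ^+ 2)%:E <=
  (4 / (3 * pi) * (r ^+ 3 / t))%:E.
Proof.
move=> r0 t0.
have mf : measurable_fun setT (EFin \o (fun z : RR => (Num.max (r * `|z.2| - t * `|z.1|) 0) ^+ 2)%R).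
  by apply/measurable_EFinP; exact: measurable_max2.
have /= -> := @fubini_tonelli _ _ _ _ _ N N _ mf (fun z => _); last first.
  by move=> z; rewrite lee_fin sqr_ge0.
have g0 := @gpeak_gt0 R; have p0 := @pi_gt0 R.
have mabs : measurable_fun setT (fun x : R => (`|x| ^+ 3)%:E).
  by apply/measurable_EFinP; apply: measurable_funX; exact: normr_measurable.
pose c := (2 * gpeak * r ^+ 3 / (3 * t))%R.
have c0 : (0 <= c)%R.
  by rewrite divr_ge0// ?mulr_ge0// ?exprn_ge0// ltW.
apply: (@le_trans _ _ (\int[N]_y (c * `|y| ^+ 3)%:E)).
  apply: ge0_le_integral => //.
  - by move=> y _; apply: integral_ge0 => x _; rewrite lee_fin sqr_ge0.
  - exact: (@measurable_fun_fubini_tonelli_G _ _ _ _ _ N _ mf (fun z => sqr_ge0 _)).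
  - under eq_fun do rewrite EFinM.
    by apply: emeasurable_funM.
  - move=> y _; apply: (le_trans (gauss_tail _ t0)); first exact: mulr_ge0.
    by rewrite lee_fin /c exprMn le_eqVlt; apply/orP; left; apply/eqP; field; rewrite gt_eqF.
under eq_integral do rewrite EFinM.
rewrite ge0_integralZl//.
rewrite gauss_abs3 -EFinM lee_fin /c.
have -> : (2 * gpeak * r ^+ 3 / (3 * t) * (4 * gpeak) = 8 * gpeak ^+ 2 * r ^+ 3 / (3 * t) :> R)%R by ring.
rewrite gpeak2 le_eqVlt; apply/orP; left; apply/eqP.
by move: (pi : R) p0 => q q0; field; rewrite !gt_eqF.
Qed.

Lemma le_integral2 (f g : RR -> R) : measurable_fun setT f -> measurable_fun setT g ->
  (forall z, (0 <= f z)%R) -> (forall z, (f z <= g z)%R) ->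
  \int[N]_x \int[N]_y (f (x, y))%:E <= \int[N]_x \int[N]_y (g (x, y))%:E.
Proof.
move=> mf mg f0 fg.
have mF : measurable_fun setT (EFin \o f) by exact/measurable_EFinP.
have mG : measurable_fun setT (EFin \o g) by exact/measurable_EFinP.
have g0 z : (0 <= g z)%R by exact: le_trans (fg z).
apply: ge0_le_integral => //.
- by move=> x _; apply: integral_ge0 => y _; rewrite lee_fin.
- exact: (@measurable_fun_fubini_tonelli_F _ _ _ _ _ N _ mF (fun z => f0 _)).
- exact: (@measurable_fun_fubini_tonelli_F _ _ _ _ _ N _ mG (fun z => g0 _)).
move=> x _; apply: ge0_le_integral => //.
- by move=> y _; rewrite lee_fin.
- exact: (measurableT_comp mF (pair1_measurable x)).
- exact: (measurableT_comp mG (pair1_measurable x)).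
by move=> y _; rewrite lee_fin.
Qed.

(** Since |q|, |r| <= 2, the excess is at most (2 |y| - (L - 2) |x|)_+, to which
    [integral2_tail] applies. *)
Lemma integral2_excess (q r L : R) : (2 < L)%R -> (q ^+ 2 + r ^+ 2 <= 4)%R ->
  \int[N]_x \int[N]_y ((Num.max (`|q * x + r * y| - L * `|x|) 0) ^+ 2)%:E <=
  (6 / (L - 2))%:E.
Proof.
move=> L2 qr; have L20 : (0 < L - 2)%R by lra.
have q2 : (`|q| <= 2)%R.
  rewrite -(ler_pXn2r (n := 2))// ?nnegrE// real_normK ?num_real//.
  by have := sqr_ge0 r; lra.
have r2 : (`|r| <= 2)%R.
  rewrite -(ler_pXn2r (n := 2))// ?nnegrE// real_normK ?num_real//.
  by have := sqr_ge0 q; lra.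
have mF : measurable_fun setT (fun z : RR =>
    (Num.max (`|q * z.1 + r * z.2| - L * `|z.1|) 0) ^+ 2)%R.
  apply: measurable_funX; apply: measurable_maxr => //.
  apply: measurable_funB.
    apply: (measurableT_comp (@normr_measurable R setT)).
    exact: measurable_lin2.
  by apply: measurable_funM => //; apply: measurableT_comp => //; exact: normr_measurable.
apply: (@le_trans _ _ (\int[N]_x \int[N]_y
    ((Num.max (2 * `|y| - (L - 2) * `|x|) 0) ^+ 2)%:E)).
  apply: (le_integral2 mF (measurable_max2 2 (L - 2)) (fun z => sqr_ge0 _)) => -[x y] /=.
  rewrite ler_pXn2r//; last 2 first.
  - by rewrite nnegrE le_max lexx orbT.
  - by rewrite nnegrE le_max lexx orbT.
  rewrite ge_max; apply/andP; split; last by rewrite le_max lexx orbT.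
  rewrite le_max; apply/orP; left.
  have : (`|q * x + r * y| <= `|q| * `|x| + `|r| * `|y|)%R.
    by apply: (le_trans (ler_normD _ _)); rewrite !normrM.
  have : (`|q| * `|x| <= 2 * `|x|)%R by rewrite ler_wpM2r.
  have : (`|r| * `|y| <= 2 * `|y|)%R by rewrite ler_wpM2r.
  by lra.
apply: (le_trans (integral2_tail (ler0n _ 2) L20)); rewrite lee_fin.
have p0 := @pi_gt0 R; have /andP[p3 _] := @pi_bounds R.
rewrite mulrA ler_wpM2r//; first by rewrite invr_ge0 ltW.
move: (pi : R) p0 p3 => w w0 w3.
have -> : (4 / (3 * w) * 2 ^+ 3 = 32%:R / (3 * w) :> R)%R by field; rewrite gt_eqF.
by rewrite ler_pdivrMr ?mulr_gt0//; lra.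
Qed.

(** Averaging over the reflection y |-> - y turns the indefinite integrand into a
    function of |x| and |y|. *)
Lemma signed_square_sym (p q r x y : R) : (0 < p)%R -> (0 <= q)%R -> (0 <= r)%R ->
  let F := fun s t : R => ((`|s| - `|t|) * Num.sg s * t)%R in
  ((F (p * x) (q * x + r * y) + F (p * x) (q * x + r * - y)) / 2 =
   p * q * x ^+ 2 -
   (2 * (q * `|x|) * (r * `|y|) + (Num.max (q * `|x| - r * `|y|) 0) ^+ 2))%R.
Proof.
move=> p0 q0 r0 F.
have main (u v : R) : (0 <= u)%R -> (0 <= v)%R ->
    ((`|u + v| * (u + v) + `|u - v| * (u - v)) / 2 =
     2 * u * v + (Num.max (u - v) 0) ^+ 2)%R.
  move=> u0 v0; rewrite (ger0_norm (addr_ge0 u0 v0)).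
  case: (lerP v u) => uv.
    by rewrite max_l ?subr_ge0//; field.
  by rewrite max_r ?subr_le0 1?ltW//; field.
have mainy (u : R) : (0 <= u)%R ->
    ((`|u + r * y| * (u + r * y) + `|u + r * - y| * (u + r * - y)) / 2 =
     2 * u * (r * `|y|) + (Num.max (u - r * `|y|) 0) ^+ 2)%R.
  move=> u0; have [y0|y0] := lerP 0%R y.
    by rewrite mulrN (main _ _ u0 (mulr_ge0 r0 y0)) ?(ger0_norm y0).
  have y1 : (0 <= - y)%R by lra.
  have E := main _ _ u0 (mulr_ge0 r0 y1).
  by rewrite ?(ltr0_norm y0) -E [in LHS]addrC !mulrN opprK.
have [x0|x0|<-] := ltrgtP 0%R x; last first.
- rewrite /F mulr0 sgr0 !mulr0 !mul0r normr0 mulr0 sub0r max_r ?oppr_le0 ?mulr_ge0//.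
  by rewrite !expr0n/= !mulr0 !mul0r; field.
- have nx : (0 <= - x)%R by lra.
  have := mainy _ (mulr_ge0 q0 nx).
  rewrite /F !sgrM (gtr0_sg p0) (ltr0_sg x0) (ltr0_norm x0) => E.
  rewrite -E normrM (gtr0_norm p0) (ltr0_norm x0).
  have -> : (q * - x + r * y = - (q * x + r * - y))%R by ring.
  have -> : (q * - x + r * - y = - (q * x + r * y))%R by ring.
  by rewrite !normrN; field.
- have := mainy _ (mulr_ge0 q0 (ltW x0)).
  rewrite /F !sgrM (gtr0_sg p0) (gtr0_sg x0) (gtr0_norm x0) => E.
  by rewrite -E normrM (gtr0_norm p0) (gtr0_norm x0); field.
Qed.

(** A lower bound for the mean update of the correlation at cosine q: it exceeds q
    by a fixed fraction of the distance to the two fixed points 0 and 1. *)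
Definition growth (q : R) : R := (q + Num.min q (1 - q) / 1000%:R)%R.

(** With a = q |g| and b = r |g'|, the mean update is E[2 a b + (a - b)_+^2].
    Dropping the square gives 4 q r / pi, which is good for small q; rewriting it
    as E[a^2 + b^2 - (b - a)_+^2] = 1 - E[(b - a)_+^2] and using [integral2_tail]
    gives the second bound, good for large q.  The two regimes meet at q = 3/5,
    where r >= 4/5. *)
Lemma growth_bound (q r : R) : (0 <= q)%R -> (0 <= r)%R -> (q ^+ 2 + r ^+ 2 = 1)%R ->
  (growth q <= 4 * q * r / pi)%R \/
  (0 < q)%R /\ (growth q <= 1 - 4 / (3 * pi) * (r ^+ 3 / q))%R.
Proof.
have /andP[] := @pi_bounds R; have := @pi_gt0 R.
move: (pi : R) => w w0 w3 w4 q0 r0 qr.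
have q1 : (q <= 1)%R.
  by rewrite -(ler_pXn2r (n := 2))// ?nnegrE// expr1n -qr lerDl sqr_ge0.
have [q35|q35] := lerP q (3 / 5)%R; [left|right; split; first lra].
  have r45 : (4 / 5 <= r)%R.
    rewrite -(ler_pXn2r (n := 2))// ?nnegrE ?divr_ge0//.
    have : (q ^+ 2 <= (3 / 5) ^+ 2)%R by rewrite ler_pXn2r// nnegrE divr_ge0.
    lra.
  rewrite ler_pdivlMr//.
  have : (growth q <= q * (1001%:R / 1000%:R))%R.
    rewrite /growth; have : (Num.min q (1 - q) <= q)%R by rewrite ge_min lexx.
    lra.
  move=> gq; apply: (@le_trans _ _ (q * (1001%:R / 1000%:R) * (319%:R / 100%:R))%R).
    have m0 : (0 <= Num.min q (1 - q))%R by rewrite le_min q0 subr_ge0.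
    have g0 : (0 <= growth q)%R by rewrite /growth; lra.
    by apply: (ler_pM g0 (ltW w0) gq w4).
  have -> : (4 * q * r = q * (4 * r))%R by ring.
  rewrite -mulrA; apply: (ler_wpM2l q0); lra.
have r2 : (r ^+ 2 = (1 - q) * (1 + q))%R.
  have -> : ((1 - q) * (1 + q) = 1 - q ^+ 2)%R by ring.
  by rewrite -qr addrC addKr.
(* The left-hand side decreases for q >= 1/2 and equals 8/5 * 4/5 at q = 3/5. *)
have s1 : ((1 + q) * r <= 128%:R / 100%:R)%R.
  rewrite -(ler_pXn2r (n := 2))// ?nnegrE; last 2 first.
  - by rewrite mulr_ge0//; lra.
  - by rewrite divr_ge0.
  rewrite exprMn r2 -subr_ge0; set u := (q - 3 / 5)%R.
  have u0 : (0 <= u)%R by rewrite /u; lra.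
  have -> : ((128 / 100) ^+ 2 - (1 + q) ^+ 2 * ((1 - q) * (1 + q)) =
    u * (128 / 125 + 144 / 25 * u + 22 / 5 * u ^+ 2 + u ^+ 3) :> R)%R by rewrite /u; field.
  by rewrite mulr_ge0// !addr_ge0// ?mulr_ge0// ?exprn_ge0.
have : (growth q <= q + (1 - q) / 1000%:R)%R.
  rewrite /growth; have : (Num.min q (1 - q) <= 1 - q)%R by rewrite ge_min lexx orbT.
  by lra.
move=> gq; apply: (le_trans gq).
have q00 : (0 < q)%R by lra.
have -> : (4 / (3 * w) * (r ^+ 3 / q) = (1 - q) * ((1 + q) * r) * 4 / (3 * w * q) :> R)%R.
  rewrite (exprSr r 2) r2; field.
  by rewrite !gt_eqF.
have : ((1 - q) * ((1 + q) * r) * 4 / (3 * w * q) <= (1 - q) * (999%:R / 1000%:R))%R.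
  rewrite ler_pdivrMr ?mulr_gt0//.
  rewrite -!mulrA ler_wpM2l//; first lra.
  have : (3 * (3 / 5) <= w * q)%R by apply: ler_pM => //; lra.
  lra.
by lra.
Qed.

End plane.

Section signal.
Context {R : realType}.
Local Open Scope ereal_scope.
Local Notation N := (@gauss R).
Local Notation RR := (measurableTypeR R * measurableTypeR R)%type.

Lemma integral2D (f g : RR -> R) : measurable_fun setT f -> measurable_fun setT g ->
  (forall z, (0 <= f z)%R) -> (forall z, (0 <= g z)%R) ->
  \int[N]_x \int[N]_y (f (x, y) + g (x, y))%:E =
  \int[N]_x \int[N]_y (f (x, y))%:E + \int[N]_x \int[N]_y (g (x, y))%:E.
Proof.
move=> mf mg f0 g0.
have mF : measurable_fun setT (EFin \o f) by exact/measurable_EFinP.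
have mG : measurable_fun setT (EFin \o g) by exact/measurable_EFinP.
rewrite -ge0_integralD//.
- apply: eq_integral => x _; rewrite -ge0_integralD//.
  + by move=> y _; rewrite lee_fin.
  + exact: (measurableT_comp mF (pair1_measurable x)).
  + by move=> y _; rewrite lee_fin.
  + exact: (measurableT_comp mG (pair1_measurable x)).
- by move=> x _; apply: integral_ge0 => y _; rewrite lee_fin.
- exact: (@measurable_fun_fubini_tonelli_F _ _ _ _ _ N _ mF (fun z => f0 _)).
- by move=> x _; apply: integral_ge0 => y _; rewrite lee_fin.
- exact: (@measurable_fun_fubini_tonelli_F _ _ _ _ _ N _ mG (fun z => g0 _)).
Qed.

Lemma measurable_sqr2 (A B : R) :
  measurable_fun setT (fun z : RR => A * z.1 ^+ 2 + B * z.2 ^+ 2)%R.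
Proof.
by apply: measurable_funD; apply: measurable_funM => //; apply: measurable_funX;
  [exact: measurable_fst|exact: measurable_snd].
Qed.

(** One summand of the update along x, as a function of the pair (a . z, a . x). *)
Definition sgn_corr (z : R * R) : R := ((`|z.1| - `|z.2|) * Num.sg z.1 * z.2)%R.

Lemma measurable_sgr : measurable_fun setT (Num.sg : R -> R).
Proof.
rewrite (_ : Num.sg = fun x : R => (\1_`]0%R, +oo[ x - \1_`]-oo, 0%R[ x)%R).
  by apply: measurable_funB; exact: measurable_indic.
apply/funext => x; rewrite !indicE !mem_setE !in_itv/= andbT.
have [x0|x0|->] := ltrgtP x 0%R.
- by rewrite ltr0_sg// sub0r.
- by rewrite gtr0_sg// subr0.
- by rewrite sgr0 subr0.
Qed.

Lemma measurable_sgn_corr : measurable_fun setT (sgn_corr : RR -> R).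
Proof.
apply: measurable_funM; last exact: measurable_snd.
apply: measurable_funM.
  by apply: measurable_funB; apply: (measurableT_comp (@normr_measurable R setT));
    [exact: measurable_fst|exact: measurable_snd].
by apply: (measurableT_comp measurable_sgr); exact: measurable_fst.
Qed.

Lemma sgn_corr_le (z : R * R) : (`|sgn_corr z| <= 2 * (z.1 ^+ 2 + z.2 ^+ 2))%R.
Proof.
rewrite /sgn_corr !normrM.
have sg1 : (`|Num.sg z.1| <= 1)%R by rewrite normr_sg lern1 leq_b1.
apply: (@le_trans _ _ ((`|z.1| + `|z.2|) * 1 * `|z.2|)%R).
  apply: ler_wpM2r => //; apply: ler_pM => //.
  by apply: (le_trans (ler_normB _ _)); rewrite !normr_id.
rewrite mulr1 -(real_normK (num_real z.1)) -(real_normK (num_real z.2)).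
have := normr_ge0 z.1; have := normr_ge0 z.2; nra.
Qed.

(** This says E[sgn_corr] <= p q - growth q.  Adding twice the sum of the squares,
    whose mean is 2 (p^2 + 1), makes the integrand nonnegative, so that extended
    real integrals can be manipulated without integrability conditions.  The two
    cases are the two regimes of [growth_bound]. *)
Lemma integral2_signal (p q r : R) : (0 < p)%R -> (0 <= q)%R -> (0 <= r)%R ->
  (q ^+ 2 + r ^+ 2 = 1)%R ->
  \int[N]_x \int[N]_y (sgn_corr (p * x, q * x + r * y)%R +
     2 * ((p * x) ^+ 2 + (q * x + r * y) ^+ 2))%:E <=
  ((p * q - growth q) + 2 * (p ^+ 2 + 1))%:E.
Proof.
move=> p0 q0 r0 qr.
pose g (z : RR) : R := (sgn_corr (p * z.1, q * z.1 + r * z.2) +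
     2 * ((p * z.1) ^+ 2 + (q * z.1 + r * z.2) ^+ 2))%R.
have mg : measurable_fun setT g.
  apply: measurable_funD.
    apply: (measurableT_comp measurable_sgn_corr); apply: measurable_fun_pair.
      by apply: measurable_funM => //; exact: measurable_fst.
    exact: measurable_lin2.
  apply: measurable_funM => //; apply: measurable_funD; apply: measurable_funX.
    by apply: measurable_funM => //; exact: measurable_fst.
  exact: measurable_lin2.
have g0 z : (0 <= g z)%R.
  have := sgn_corr_le (p * z.1, q * z.1 + r * z.2)%R; rewrite ler_norml => /andP[+ _].
  by rewrite /g /=; lra.
rewrite (integral2_sym mg g0).
have symE x y : ((g (x, y) + g (x, - y)) / 2 = (p * q + 2 * p ^+ 2 + 2 * q ^+ 2) * x ^+ 2 +
   2 * r ^+ 2 * y ^+ 2 - (2 * (q * `|x|) * (r * `|y|) + (Num.max (q * `|x| - r * `|y|) 0) ^+ 2))%R.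
  have : ((sgn_corr (p * x, q * x + r * y) + sgn_corr (p * x, q * x + r * - y)) / 2 =
    p * q * x ^+ 2 - (2 * (q * `|x|) * (r * `|y|) + (Num.max (q * `|x| - r * `|y|) 0) ^+ 2))%R.
    exact: signed_square_sym.
  rewrite /g /=; move: (sgn_corr _) (sgn_corr _) => s1 s2.
  set H := (2 * (q * `|x|) * _ + _)%R => E.
  have -> : (H = p * q * x ^+ 2 - (s2 + s1) / 2)%R by rewrite E; ring.
  by field.
have sg0 (z : RR) : (0 <= (g z + g (z.1, - z.2)) / 2)%R by rewrite divr_ge0// addr_ge0.
have msg : measurable_fun setT (fun z : RR => (g z + g (z.1, - z.2)) / 2)%R.
  apply: measurable_funM => //; apply: measurable_funD => //.
  apply: (measurableT_comp mg); apply: measurable_fun_pair => //.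
  by apply: measurableT_comp => //; exact: measurable_snd.
have pq0 : (0 <= p * q)%R by rewrite mulr_ge0// ltW.
have p20 := sqr_ge0 p; have q20 := sqr_ge0 q; have r20 := sqr_ge0 r.
have A0 : (0 <= p * q + 2 * p ^+ 2 + 2 * q ^+ 2)%R by lra.
have A1 : (0 <= p * q + 2 * p ^+ 2 + q ^+ 2)%R by lra.
have B0 : (0 <= 2 * r ^+ 2)%R by lra.
have [gA|[q00 gB]] := growth_bound q0 r0 qr.
- pose K (z : RR) : R := ((p * q + 2 * p ^+ 2 + 2 * q ^+ 2) * z.1 ^+ 2 +
    2 * r ^+ 2 * z.2 ^+ 2 - 2 * q * r * (`|z.1| * `|z.2|))%R.
  have mab : measurable_fun setT (fun z : RR => 2 * q * r * (`|z.1| * `|z.2|))%R.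
    by apply: measurable_funM => //; apply: measurable_funM;
      apply: (measurableT_comp (@normr_measurable R setT));
      [exact: measurable_fst|exact: measurable_snd].
  have mK : measurable_fun setT K by apply: measurable_funB => //; exact: measurable_sqr2.
  have leK (z : RR) : ((g z + g (z.1, - z.2)) / 2 <= K z)%R.
    case: z => x y; rewrite symE /K /=; have := sqr_ge0 (Num.max (q * `|x| - r * `|y|) 0)%R.
    by set mm := (_ ^+ 2)%R => ?; lra.
  have K0 z : (0 <= K z)%R by exact: le_trans (leK z).
  apply: (le_trans (le_integral2 msg mK sg0 leK)).
  have c0 : (0 <= 2 * q * r)%R by rewrite !mulr_ge0.
  have := integral2D mK mab K0 (fun z => mulr_ge0 c0 (mulr_ge0 (normr_ge0 _) (normr_ge0 _))).
  rewrite /= integral2_abs// => E.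
  have : \int[N]_x \int[N]_y (K (x, y))%:E + (2 * (2 * q * r) / pi)%:E <=
     (p * q + 2 * p ^+ 2 + 2 * q ^+ 2 + 2 * r ^+ 2)%:E.
    rewrite -E -(integral2_sqr A0 B0).
    rewrite le_eqVlt; apply/orP; left; apply/eqP; apply: eq_integral => x _.
    by apply: eq_integral => y _; congr _%:E; rewrite /K /= subrK.
  rewrite -leeBrDr// => /le_trans; apply; rewrite -EFinB lee_fin.
  move: gA; have -> : (2 * (2 * q * r) = 4 * q * r)%R by ring.
  by lra.
- pose K (z : RR) : R := ((p * q + 2 * p ^+ 2 + q ^+ 2) * z.1 ^+ 2 + r ^+ 2 * z.2 ^+ 2)%R.
  pose M (z : RR) : R := ((Num.max (r * `|z.2| - q * `|z.1|) 0) ^+ 2)%R.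
  have mK : measurable_fun setT K by exact: measurable_sqr2.
  have mM : measurable_fun setT M by exact: measurable_max2.
  have K0 z : (0 <= K z)%R by rewrite /K addr_ge0// mulr_ge0// sqr_ge0.
  have M0 z : (0 <= M z)%R by exact: sqr_ge0.
  have -> : \int[N]_x \int[N]_y ((g (x, y) + g (x, - y)%R) / 2)%:E =
     \int[N]_x \int[N]_y (K (x, y) + M (x, y))%:E.
    apply: eq_integral => x _; apply: eq_integral => y _; congr _%:E.
    rewrite symE /K /M /=.
    rewrite -[(x ^+ 2)%R](real_normK (num_real x)) -[(y ^+ 2)%R](real_normK (num_real y)).
    set a := `|x|%R; set b := `|y|%R.
    case: (lerP (q * a)%R (r * b)%R) => ab.
      by rewrite (max_r (y := 0%R)) ?subr_le0// max_l ?subr_ge0//; ring.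
    by rewrite max_l ?subr_ge0 1?ltW// max_r ?subr_le0 1?ltW//; ring.
  rewrite (integral2D mK mM K0 M0) /K /= (integral2_sqr A1 r20).
  apply: (le_trans (leeD2l _ (integral2_tail r0 q00))).
  by rewrite -EFinD lee_fin; lra.
Qed.

End signal.

(** * A Bernstein inequality over one block *)
Section real_ineq.
Context {R : realType}.
Implicit Types x y : R.

Lemma expR_le_quad x : expR x <= 1 + x + x ^+ 2 * expR `|x|.
Proof.
have [x0|x0] := lerP 0 x.
  have h : expR x - 1 <= x * expR x.
    have : (1 - x) * expR x <= 1.
      by rewrite -[leRHS](expRxMexpNx_1 x) mulrC ler_wpM2l ?expR_ge0// expR_ge1Dx.
    by lra.
  have : x * (expR x - 1) <= x * (x * expR x) by rewrite ler_wpM2l.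
  by rewrite ?(ger0_norm x0); nra.
have y0 : 0 < - x by lra.
have e1 : 1 <= expR `|x| by rewrite -expR0 ler_expR.
have : x ^+ 2 <= x ^+ 2 * expR `|x| by rewrite ler_peMr ?sqr_ge0.
have : expR x <= (1 - x)^-1.
  rewrite -[x in expR x]opprK expRN lef_pV2 ?posrE ?expR_gt0//; last lra.
  exact: expR_ge1Dx.
have : (1 - x)^-1 <= 1 + x + x ^+ 2.
  rewrite -div1r ler_pdivrMr; last lra.
  have -> : (1 + x + x ^+ 2) * (1 - x) = 1 + x ^+ 2 * - x by ring.
  by rewrite lerDl mulr_ge0 ?sqr_ge0// ltW.
by lra.
Qed.

Lemma sqr_le_expR y : 0 <= y -> y ^+ 2 <= 2 ^+ 15 * expR (y / 128%:R).
Proof.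
move=> y0; have v0 : 0 <= y / 128%:R by rewrite divr_ge0.
have := expR_ge1Dxn 1 v0; rewrite (_ : 2`! = 2)%N// exprMn.
by lra.
Qed.

Lemma sum_expR_le x y : expR ((x + y) / 2) <= (expR x + expR y) / 2.
Proof.
have e (z : R) : expR z = expR (z / 2) ^+ 2 by rewrite -expRM_natl; congr expR; field.
rewrite (e x) (e y) mulrDl expRD; set a := expR _; set b := expR _.
by have := sqr_ge0 (a - b); lra.
Qed.

End real_ineq.

Section mgf.
Context d (Omega : measurableType d) (R : realType) (P : probability Omega R).
Local Open Scope ereal_scope.

Lemma integral_probability_cst (c : \bar R) : \int[P]_o (cst c o) = c.
Proof.
rewrite integral_cst// [X in _ * X](_ : _ = 1) ?mule1//.
exact: probability_setT.
Qed.

Lemma integral_scale (k : R) (h : Omega -> R) : (0 <= k)%R ->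
  measurable_fun setT h -> (forall o, (0 <= h o)%R) ->
  \int[P]_o (k * h o)%:E = k%:E * \int[P]_o (h o)%:E.
Proof.
move=> k0 mh h0; under eq_integral do rewrite EFinM.
rewrite (@ge0_integralZl _ _ _ P setT measurableT (EFin \o h))//.
- exact/measurable_EFinP.
- by move=> o _; rewrite lee_fin.
Qed.

(** The hypothesis on xi + W encodes E[xi] <= M without subtracting integrals.  From
    exp s <= 1 + s + s^2 exp |s| with |s| <= W / 128, the quadratic term is
    bounded by lam^2 2^15 exp (W / 64), whose mean is at most lam^2 2^16. *)
Lemma mgf_bound (xi W : Omega -> R) (w M lam : R) :
  measurable_fun setT xi -> measurable_fun setT W ->
  (forall o, (`|xi o| <= W o)%R) ->
  \int[P]_o (W o)%:E = w%:E ->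
  \int[P]_o (xi o + W o)%:E <= (M + w)%:E ->
  \int[P]_o (expR (W o / 64%:R))%:E <= 2%:E ->
  (0 <= lam <= 128%:R^-1)%R ->
  \int[P]_o (expR (lam * xi o))%:E <= (expR (lam * M + lam ^+ 2 * 2 ^+ 16))%:E.
Proof.
move=> mxi mW xiW iW ixi iexp /andP[l0 l1].
have K0 : (0 <= 2 ^+ 15 :> R)%R by rewrite exprn_ge0 ?ler0n.
have W0 o : (0 <= W o)%R by exact: le_trans (xiW o).
have xW0 o : (0 <= xi o + W o)%R.
  by have := xiW o; rewrite ler_norml => /andP[+ _]; lra.
have mexp (h : Omega -> R) : measurable_fun setT h -> measurable_fun setT (fun o => (expR (h o))%:E).
  by move=> mh; apply/measurable_EFinP; exact: (measurableT_comp (@measurable_expR R)).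
have mlin (k : R) (h : Omega -> R) : measurable_fun setT h -> measurable_fun setT (fun o => (k * h o)%:E).
  by move=> mh; apply/measurable_EFinP; exact: measurable_funM.
have key o : (expR (lam * xi o) + lam * W o <=
    1 + lam * (xi o + W o) + lam ^+ 2 * (2 ^+ 15 * expR (W o / 64%:R)))%R.
  have h1 := expR_le_quad (lam * xi o)%R.
  have h2 : ((lam * xi o) ^+ 2 * expR `|lam * xi o| <= lam ^+ 2 * (2 ^+ 15 * expR (W o / 64%:R)))%R.
    rewrite exprMn -mulrA ler_wpM2l ?sqr_ge0//.
    rewrite -(real_normK (num_real (xi o))).
    apply: (@le_trans _ _ (2 ^+ 15 * expR (`|xi o| / 128%:R) * expR (`|xi o| / 128%:R))%R).
      apply: ler_pM; rewrite ?sqr_ge0 ?expR_ge0 ?sqr_le_expR//.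
      by rewrite ler_expR normrM (ger0_norm l0) mulrC ler_wpM2l.
    rewrite -mulrA -expRD ler_wpM2l// ler_expR.
    by have := xiW o; lra.
  by lra.
have iL : \int[P]_o (expR (lam * xi o) + lam * W o)%:E =
    \int[P]_o (expR (lam * xi o))%:E + (lam * w)%:E.
  rewrite (@ge0_integralD _ _ _ P setT measurableT (fun o => (expR (lam * xi o))%:E) (fun o => (lam * W o)%:E))//.
  - by rewrite integral_scale// iW.
  - by apply: mexp; exact: measurable_funM.
  - by move=> o _; rewrite lee_fin mulr_ge0.
  - exact: mlin.
have iR : \int[P]_o (1 + lam * (xi o + W o) + lam ^+ 2 * (2 ^+ 15 * expR (W o / 64%:R)))%:E <=
    (1 + lam * (M + w) + lam ^+ 2 * 2 ^+ 16)%:E.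
  have mD : measurable_fun setT (fun o => xi o + W o)%R by exact: measurable_funD.
  have mE : measurable_fun setT (fun o => 2 ^+ 15 * expR (W o / 64%:R))%R.
    apply: measurable_funM => //; apply: (measurableT_comp (@measurable_expR R)).
    exact: measurable_funM.
  rewrite (@ge0_integralD _ _ _ P setT measurableT (fun o => (1 + lam * (xi o + W o))%:E) (fun o => (lam ^+ 2 * (2 ^+ 15 * expR (W o / 64%:R)))%:E))//; last 4 first.
  - by move=> o _; rewrite lee_fin addr_ge0// mulr_ge0.
  - by apply/measurable_EFinP; apply: measurable_funD => //; exact: measurable_funM.
  - by move=> o _; rewrite lee_fin mulr_ge0 ?sqr_ge0// mulr_ge0// expR_ge0.
  - exact: mlin.
  rewrite (@ge0_integralD _ _ _ P setT measurableT (cst 1) (fun o => (lam * (xi o + W o))%:E))//; last 2 first.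
  - by move=> o _; rewrite lee_fin mulr_ge0.
  - exact: mlin.
  rewrite !EFinD; apply: leeD; first apply: leeD.
  - by rewrite integral_probability_cst.
  - by rewrite integral_scale// EFinM lee_wpmul2l ?lee_fin.
  - have mexpW : measurable_fun setT (fun o => expR (W o / 64%:R)).
      by apply: (measurableT_comp (@measurable_expR R)); exact: measurable_funM.
    rewrite (integral_scale (sqr_ge0 lam) mE (fun o => mulr_ge0 K0 (expR_ge0 _))).
    rewrite [leRHS]EFinM; apply: lee_wpmul2l; first by rewrite lee_fin sqr_ge0.
    rewrite (integral_scale K0 mexpW (fun o => expR_ge0 _)).
    have -> : (2 ^+ 16 = 2 ^+ 15 * 2 :> R)%R by lra.
    by rewrite [leRHS]EFinM; apply: lee_wpmul2l; rewrite ?lee_fin ?K0.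
have LR : \int[P]_o (expR (lam * xi o))%:E + (lam * w)%:E <=
    (1 + lam * (M + w) + lam ^+ 2 * 2 ^+ 16)%:E.
  rewrite -iL; apply: le_trans iR; apply: ge0_le_integral => //.
  - by move=> o _; rewrite lee_fin addr_ge0// ?expR_ge0// mulr_ge0.
  - apply/measurable_EFinP; apply: measurable_funD; last exact: measurable_funM.
    by apply: (measurableT_comp (@measurable_expR R)); exact: measurable_funM.
  - apply/measurable_EFinP; apply: measurable_funD.
      by apply: measurable_funD => //; apply: measurable_funM => //; exact: measurable_funD.
    apply: measurable_funM => //; apply: measurable_funM => //.
    by apply: (measurableT_comp (@measurable_expR R)); exact: measurable_funM.
  - by move=> o _; rewrite lee_fin.
move: LR; rewrite -leeBrDr// => /le_trans; apply; rewrite -EFinB lee_fin.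
apply: le_trans (expR_ge1Dx _); lra.
Qed.

End mgf.

Section vector_measurability.
Context {R : realType} {n : nat}.

Lemma measurable_dotv d (T : measurableType d) (U V : T -> 'cV[R]_n) :
  (forall j, measurable_fun setT (fun w => U w j 0)) ->
  (forall j, measurable_fun setT (fun w => V w j 0)) ->
  measurable_fun setT (fun w => dotv (U w) (V w)).
Proof.
by move=> mU mV; apply: measurable_sum => j; exact: measurable_funM.
Qed.

End vector_measurability.

Section block_tail.
Context d (Omega : measurableType d) (R : realType) (P : probability Omega R).
Variables (n N : nat) (a : 'I_N -> Omega -> 'cV[R]_n).
Hypothesis ga : forall i, std_gaussian_vector P (a i).
Hypothesis ia : mutually_independent P a.
Local Open Scope ereal_scope.
Local Notation NN := (@gauss R).
Local Notation RR := (measurableTypeR R * measurableTypeR R)%type.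

Definition coord_sigma (i : 'I_N) : set (set Omega) :=
  gen_sigma (fun (j : 'I_n) w => a i w j 0%R).

Let ma i j : measurable_fun setT (fun w => a i w j 0%R).
Proof. exact: (ga i).1. Qed.

Lemma coord_sigma_measurable i : coord_sigma i `<=` measurable.
Proof.
apply: (smallest_sub (@sigma_algebra_measurable _ Omega)).
by move=> _ [j _ [A mA <-]]; exact: ma.
Qed.

Lemma coord_sigma_family : indep_family P coord_sigma.
Proof.
split.
- by move=> i; exact: (@measurableT _ (g_sigma_algebraType _)).
- by move=> i A B; exact: (@measurableI _ (g_sigma_algebraType _)).
- exact: coord_sigma_measurable.
- exact: ia.
Qed.

Lemma measurable_coord i j :
  measurable_fun setT ((fun w => a i w j 0%R) : g_sigma_algebraType (coord_sigma i) -> R).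
Proof.
move=> _ A mA; rewrite setTI; apply: sub_sigma_algebra; apply: sub_sigma_algebra.
by exists j => //; exists A => //; rewrite setTI.
Qed.

(** a . v is |v| times a standard normal variable and |v|^2 <= 4, so [gauss_exp]
    gives the bound sqrt 2. *)
Let expsqr i (v : 'cV[R]_n) : (dotv v v <= 4)%R ->
  \int[P]_w (expR ((dotv (a i w) v) ^+ 2 / 16%:R))%:E <= 2%:E.
Proof.
move=> v4; have [p [q [r [p0 r0 [pp _ _ law]]]]] := gauss_vector_law (ga i) v v.
pose f (z : RR) := (expR (z.1 ^+ 2 / 16%:R))%:E.
have mf : measurable_fun setT f.
  apply/measurable_EFinP; apply: (measurableT_comp (@measurable_expR R)).
  by apply: measurable_funM => //; apply: measurable_funX; exact: measurable_fst.
have f0 z : 0 <= f z by rewrite lee_fin expR_ge0.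
have := law f mf f0; rewrite /f /= => ->.
apply: (@le_trans _ _ (\int[NN]_x (expR (x ^+ 2 / 4))%:E)).
  apply: ge0_le_integral => //.
  - by move=> x _; rewrite integral_gauss_cst lee_fin expR_ge0.
  - under eq_fun do rewrite integral_gauss_cst.
    apply/measurable_EFinP; apply: (measurableT_comp (@measurable_expR R)).
    by apply: measurable_funM => //; apply: measurable_funX; exact: measurable_funM.
  - apply/measurable_EFinP; apply: (measurableT_comp (@measurable_expR R)).
    by apply: measurable_funM => //; exact: measurable_funX.
  - move=> x _; rewrite integral_gauss_cst lee_fin ler_expR exprMn pp.
    by have := sqr_ge0 x; nra.
rewrite gauss_exp lee_fin -[leRHS]ger0_norm// -sqrtr_sqr ler_wsqrtr//.
lra.
Qed.

(** Chernoff's bound with lam = eps / 2^17, which balances lam eps against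
    lam^2 2^16.  The mean of F is bounded through its planar form, as in
    [integral2_signal]. *)
Lemma block_tail (D : {set 'I_N}) (u v : 'cV[R]_n) (F : RR -> R) (M eps : R) :
  (dotv u u <= 4)%R -> (dotv v v <= 4)%R -> measurable_fun setT F ->
  (forall z, (`|F z| <= 2 * (z.1 ^+ 2 + z.2 ^+ 2))%R) ->
  (forall p q r : R, (0 <= p)%R -> (0 <= r)%R -> (p ^+ 2 = dotv u u)%R ->
     (p * q = dotv u v)%R -> (q ^+ 2 + r ^+ 2 = dotv v v)%R ->
     \int[NN]_x \int[NN]_y (F (p * x, q * x + r * y)%R +
        2 * ((p * x) ^+ 2 + (q * x + r * y) ^+ 2))%:E <=
     (M + 2 * (dotv u u + dotv v v))%:E) ->
  (0 <= eps <= 1)%R ->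
  P [set w | (#|D|%:R * (M + eps) <=
      \sum_(i in D) F (dotv (a i w) u, dotv (a i w) v))%R] <=
  (expR (- (#|D|%:R * eps ^+ 2 / 2 ^+ 18)))%:E.
Proof.
move=> u4 v4 mF FW EF /andP[e0 e1].
pose lam : R := (eps / 2 ^+ 17)%R.
have lam0 : (0 <= lam)%R by rewrite divr_ge0 ?exprn_ge0 ?ler0n.
have lam1 : (lam <= 128%:R^-1)%R.
  by rewrite /lam; lra.
pose xi i w : R := F (dotv (a i w) u, dotv (a i w) v).
pose W i w : R := (2 * ((dotv (a i w) u) ^+ 2 + (dotv (a i w) v) ^+ 2))%R.
have mdot i (c : 'cV[R]_n) : measurable_fun setT
    ((fun w => dotv (a i w) c) : g_sigma_algebraType (coord_sigma i) -> R).
  by apply: measurable_dotv => j; [exact: measurable_coord|exact: measurable_cst].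
have mdot' i (c : 'cV[R]_n) : measurable_fun setT (fun w => dotv (a i w) c).
  by apply: measurable_dotv => j; [exact: ma|exact: measurable_cst].
have mxi i : measurable_fun setT (xi i).
  exact: (measurableT_comp mF (measurable_fun_pair (mdot' i u) (mdot' i v))).
have mxi' i : measurable_fun setT (xi i : g_sigma_algebraType (coord_sigma i) -> R).
  exact: (measurableT_comp mF (measurable_fun_pair (mdot i u) (mdot i v))).
have mW i : measurable_fun setT (W i).
  by apply: measurable_funM => //; apply: measurable_funD; exact: measurable_funX.
have mgf i : \int[P]_w (expR (lam * xi i w))%:E <=
    (expR (lam * M + lam ^+ 2 * 2 ^+ 16))%:E.
  have [p [q [r [p0 r0 [pp pq qr law]]]]] := gauss_vector_law (ga i) u v.
  have msq : measurable_fun setT (fun z : RR => 2 * (z.1 ^+ 2 + z.2 ^+ 2))%R.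
    apply: measurable_funM => //; apply: measurable_funD; apply: measurable_funX;
      [exact: measurable_fst|exact: measurable_snd].
  apply: (@mgf_bound _ _ _ _ _ (W i) (2 * (dotv u u + dotv v v))%R) => //.
  - by move=> w; exact: FW.
  - have mg : measurable_fun setT (fun z : RR => (2 * (z.1 ^+ 2 + z.2 ^+ 2))%:E).
      exact/measurable_EFinP.
    have := law _ mg; rewrite /= => ->; last first.
      by move=> z; rewrite lee_fin mulr_ge0// addr_ge0 ?sqr_ge0.
    pose g (z : RR) : R := (2 * ((p * z.1) ^+ 2 + (q * z.1 + r * z.2) ^+ 2))%R.
    have mg' : measurable_fun setT g.
      have mp : measurable_fun setT (fun z : RR => p * z.1)%R.
        by apply: measurable_funM => //; exact: measurable_fst.
      exact: (measurableT_comp msq (measurable_fun_pair mp (measurable_lin2 q r))).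
    have g0 z : (0 <= g z)%R by rewrite mulr_ge0// addr_ge0 ?sqr_ge0.
    have := integral2_sym mg' g0; rewrite /g /= => ->.
    rewrite -pp -qr.
    transitivity ((2 * (p ^+ 2 + q ^+ 2) + 2 * r ^+ 2)%R%:E); last by congr _%:E; ring.
    rewrite -integral2_sqr.
    + by apply: eq_integral => x _; apply: eq_integral => y _; congr _%:E; field.
    + by rewrite mulr_ge0// addr_ge0 ?sqr_ge0.
    + by rewrite mulr_ge0 ?sqr_ge0.
  - have mg : measurable_fun setT (fun z : RR => (F z + 2 * (z.1 ^+ 2 + z.2 ^+ 2))%:E).
      by apply/measurable_EFinP; exact: measurable_funD.
    have := law _ mg; rewrite /= => ->; last first.
      by move=> z; rewrite lee_fin; have := FW z; rewrite ler_norml => /andP[+ _]; lra.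
    exact: EF.
  - apply: (@le_trans _ _ (2^-1%:E * (\int[P]_w (expR ((dotv (a i w) u) ^+ 2 / 16%:R))%:E +
       \int[P]_w (expR ((dotv (a i w) v) ^+ 2 / 16%:R))%:E))); last first.
      apply: (@le_trans _ _ (2^-1%:E * (2%:E + 2%:E))).
        by apply: lee_wpmul2l; rewrite ?lee_fin// leeD// expsqr.
      by rewrite -EFinD -EFinM lee_fin; lra.
    have me (c : 'cV[R]_n) : measurable_fun setT (fun w => expR ((dotv (a i w) c) ^+ 2 / 16%:R)).
      apply: (measurableT_comp (@measurable_expR R)); apply: measurable_funM => //.
      exact: measurable_funX.
    have e0' (c : 'cV[R]_n) w : (0 <= expR ((dotv (a i w) c) ^+ 2 / 16%:R))%R by exact: expR_ge0.
    rewrite -(@ge0_integralD _ _ _ P setT measurableT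
      (fun w => (expR ((dotv (a i w) u) ^+ 2 / 16%:R))%:E)
      (fun w => (expR ((dotv (a i w) v) ^+ 2 / 16%:R))%:E)); first last.
    + exact/measurable_EFinP.
    + by move=> w _; rewrite lee_fin.
    + exact/measurable_EFinP.
    + by move=> w _; rewrite lee_fin.
    have mD : measurable_fun setT (fun w => expR ((dotv (a i w) u) ^+ 2 / 16%:R) +
       expR ((dotv (a i w) v) ^+ 2 / 16%:R))%R by exact: measurable_funD.
    have D0 w : (0 <= expR ((dotv (a i w) u) ^+ 2 / 16%:R) +
       expR ((dotv (a i w) v) ^+ 2 / 16%:R))%R by exact: addr_ge0.
    have h0 : (0 <= 2^-1 :> R)%R by rewrite invr_ge0.
    rewrite -(integral_scale P h0 mD D0).
    apply: ge0_le_integral => //.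
    + apply/measurable_EFinP; apply: (measurableT_comp (@measurable_expR R)).
      exact: measurable_funM.
    + by apply/measurable_EFinP; exact: measurable_funM.
    + move=> w _; rewrite lee_fin [leRHS]mulrC; apply: (le_trans _ (sum_expR_le _ _)).
      by rewrite ler_expR /W le_eqVlt; apply/orP; left; apply/eqP; field.
  - by rewrite lam0.
pose c : R := (#|D|%:R * (M + eps))%R.
pose S w : R := (\sum_(i in D) xi i w)%R.
have mS : measurable_fun setT S.
  by rewrite /S; under eq_fun do rewrite big_mkcond/=; apply: measurable_sum => i; case: (i \in D).
have mA : measurable [set w | (c <= S w)%R].
  have := measurable_fun_le measurableT (measurable_cst c) mS.
  by rewrite setTI.
have prodE : \int[P]_w (expR (lam * S w))%:E = \prod_(i <- enum D) \int[P]_w (expR (lam * xi i w))%:E.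
  rewrite -(indep_family_prod (G := coord_sigma) (f := fun i w => (expR (lam * xi i w))%:E)).
  - apply: eq_integral => w _; rewrite prodEFin; congr _%:E.
    by rewrite -expR_sum /S mulr_sumr big_enum.
  - exact: coord_sigma_family.
  - exact: enum_uniq.
  - move=> i; apply/measurable_EFinP; apply: (measurableT_comp (@measurable_expR R)).
    exact: measurable_funM.
  - by move=> i w; rewrite lee_fin expR_ge0.
have prod_le : \int[P]_w (expR (lam * S w))%:E <=
    (expR (lam * M + lam ^+ 2 * 2 ^+ 16) ^+ #|D|)%:E.
  rewrite prodE cardE; elim: (enum D) => [|i s IH]; first by rewrite big_nil expr0.
  rewrite big_cons /= exprS EFinM; apply: lee_pmul => //.
  - by apply: integral_ge0 => w _; rewrite lee_fin expR_ge0.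
  - by apply: prode_ge0 => j _; apply: integral_ge0 => w _; rewrite lee_fin expR_ge0.
have mE : measurable_fun setT (fun w => expR (lam * S w)).
  by apply: (measurableT_comp (@measurable_expR R)); exact: measurable_funM.
apply: (@le_trans _ _ (\int[P]_w (expR (- (lam * c)) * expR (lam * S w))%:E)).
  rewrite -[X in P X]setIT -integral_indic//; apply: ge0_le_integral => //.
  - by apply/measurable_EFinP; exact: measurable_indic.
  - by apply/measurable_EFinP; exact: measurable_funM.
  - move=> w _; rewrite lee_fin indicE -expRD.
    have [cS|cS] := boolP (w \in _); last exact: expR_ge0.
    rewrite -[leLHS]expR0 ler_expR -mulrN -mulrDr mulr_ge0//.
    by rewrite addrC subr_ge0; move: cS; rewrite inE.
rewrite (integral_scale P (expR_ge0 _) mE (fun w => expR_ge0 _)).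
apply: (@le_trans _ _ ((expR (- (lam * c)))%:E * (expR (lam * M + lam ^+ 2 * 2 ^+ 16) ^+ #|D|)%:E)).
  by apply: lee_wpmul2l => //; rewrite lee_fin expR_ge0.
rewrite -EFinM lee_fin -expRM_natl -expRD ler_expR /c /lam le_eqVlt; apply/orP; left; apply/eqP.
by field.
Qed.

End block_tail.

(** * Deterministic analysis of one step *)
Section l2norm.
Context {R : realType} {I : finType}.
Implicit Types (A : {set I}) (f g : I -> R).

Definition l2 A f : R := Num.sqrt (\sum_(i in A) f i ^+ 2).

Lemma l2_ge0 A f : 0 <= l2 A f. Proof. exact: sqrtr_ge0. Qed.

Lemma l2_sqr A f : l2 A f ^+ 2 = \sum_(i in A) f i ^+ 2.
Proof. by rewrite sqr_sqrtr// sumr_ge0// => i _; rewrite sqr_ge0. Qed.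

(** Lagrange's identity. *)
Lemma sum_CS A f g : \sum_(i in A) f i * g i <= l2 A f * l2 A g.
Proof.
have [h|h] := leP (\sum_(i in A) f i * g i) 0.
  by apply: (le_trans h); rewrite mulr_ge0 ?l2_ge0.
rewrite -(ler_pXn2r (n := 2))// ?nnegrE ?mulr_ge0 ?l2_ge0//; last exact: ltW.
rewrite exprMn !l2_sqr -subr_ge0.
have lagrange : 0 <= \sum_(i in A) \sum_(j in A) (f i * g j - f j * g i) ^+ 2.
  by apply: sumr_ge0 => i _; apply: sumr_ge0 => j _; rewrite sqr_ge0.
suff E : \sum_(i in A) \sum_(j in A) (f i * g j - f j * g i) ^+ 2 =
   2 * ((\sum_(i in A) f i ^+ 2) * (\sum_(i in A) g i ^+ 2) -
        (\sum_(i in A) f i * g i) ^+ 2) by move: lagrange; rewrite E pmulr_rge0.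
have prodE (u v : I -> R) : (\sum_(i in A) u i) * (\sum_(i in A) v i) =
    \sum_(i in A) \sum_(j in A) u i * v j.
  by rewrite mulr_suml; apply: eq_bigr => i _; rewrite mulr_sumr.
transitivity (\sum_(i in A) \sum_(j in A) f i ^+ 2 * g j ^+ 2 +
    \sum_(i in A) \sum_(j in A) (- 2 * (f i * g i)) * (f j * g j) +
    \sum_(i in A) \sum_(j in A) g i ^+ 2 * f j ^+ 2).
  rewrite -!big_split/=; apply: eq_bigr => i _; rewrite -!big_split/=.
  by apply: eq_bigr => j _; ring.
by rewrite -!prodE -mulr_sumr; ring.
Qed.

Lemma l2_le A f g : (forall i, i \in A -> `|f i| <= `|g i|) -> l2 A f <= l2 A g.
Proof.
move=> fg; apply: ler_wsqrtr; apply: ler_sum => i iA.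
by rewrite -(real_normK (num_real (f i))) -(real_normK (num_real (g i))) ler_pXn2r ?nnegrE// fg.
Qed.

Lemma eq_l2 A f g : (forall i, i \in A -> f i = g i) -> l2 A f = l2 A g.
Proof. by move=> fg; congr Num.sqrt; apply: eq_bigr => i /fg ->. Qed.

Lemma l2D A f g : l2 A (fun i => f i + g i) <= l2 A f + l2 A g.
Proof.
rewrite -(ler_pXn2r (n := 2))// ?nnegrE ?addr_ge0 ?l2_ge0//.
rewrite l2_sqr sqrrD !l2_sqr.
have -> : \sum_(i in A) (f i + g i) ^+ 2 =
    \sum_(i in A) f i ^+ 2 + (\sum_(i in A) f i * g i) *+ 2 + \sum_(i in A) g i ^+ 2.
  by rewrite -sumrMnl -!big_split/=; apply: eq_bigr => i _; rewrite sqrrD.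
by rewrite lerD2r lerD2l lerMn2r sum_CS.
Qed.

Lemma l2Z A f c : l2 A (fun i => c * f i) = `|c| * l2 A f.
Proof.
rewrite /l2 -sqrtr_sqr -sqrtrM ?sqr_ge0// mulr_sumr.
by congr Num.sqrt; apply: eq_bigr => i _; rewrite exprMn.
Qed.

End l2norm.

Section euclid.
Context {R : realType} {n : nat}.
Implicit Types (u v w : 'cV[R]_n) (c : R).

Lemma dotvC u v : dotv u v = dotv v u.
Proof. by apply: eq_bigr => j _; rewrite mulrC. Qed.
Lemma dotvDl u v w : dotv (u + v) w = dotv u w + dotv v w.
Proof. by rewrite -big_split/=; apply: eq_bigr => j _; rewrite mxE mulrDl. Qed.
Lemma dotvDr u v w : dotv w (u + v) = dotv w u + dotv w v.
Proof. by rewrite !(dotvC w) dotvDl. Qed.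
Lemma dotvZl c u w : dotv (c *: u) w = c * dotv u w.
Proof. by rewrite mulr_sumr; apply: eq_bigr => j _; rewrite mxE mulrA. Qed.
Lemma dotvZr c u w : dotv w (c *: u) = c * dotv w u.
Proof. by rewrite !(dotvC w) dotvZl. Qed.
Lemma dotvNl u w : dotv (- u) w = - dotv u w.
Proof. by rewrite -scaleN1r dotvZl mulN1r. Qed.
Lemma dotvNr u w : dotv w (- u) = - dotv w u.
Proof. by rewrite !(dotvC w) dotvNl. Qed.
Lemma dotvBl u v w : dotv (u - v) w = dotv u w - dotv v w.
Proof. by rewrite dotvDl dotvNl. Qed.
Lemma dotvBr u v w : dotv w (u - v) = dotv w u - dotv w v.
Proof. by rewrite dotvDr dotvNr. Qed.
Lemma dotv0l w : dotv 0 w = 0.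
Proof. by rewrite -(scale0r w) dotvZl mul0r. Qed.
Lemma dotv_suml (I : finType) (A : {set I}) (F : I -> 'cV[R]_n) w :
  dotv (\sum_(i in A) F i) w = \sum_(i in A) dotv (F i) w.
Proof. by elim/big_rec2 : _ => [|i y1 y2 _ <-]; rewrite ?dotv0l ?dotvDl. Qed.

Lemma dotv_ge0 u : 0 <= dotv u u.
Proof. by apply: sumr_ge0 => j _; rewrite -expr2 sqr_ge0. Qed.

Lemma enorm_ge0 u : 0 <= enorm u. Proof. exact: sqrtr_ge0. Qed.

Lemma enorm_sqr u : enorm u ^+ 2 = dotv u u.
Proof. by rewrite sqr_sqrtr// dotv_ge0. Qed.

Lemma enormE u : enorm u = l2 [set: 'I_n] (fun j => u j 0).
Proof.
congr Num.sqrt; rewrite [RHS](eq_bigl predT); last by move=> j; rewrite inE.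
by apply: eq_bigr => j _; rewrite expr2.
Qed.

Lemma dotv_le u v : dotv u v <= enorm u * enorm v.
Proof.
rewrite !enormE; apply: le_trans (sum_CS _ _ _).
by rewrite [leRHS](eq_bigl predT)// => j; rewrite inE.
Qed.

Lemma normr_dotv_le u v : `|dotv u v| <= enorm u * enorm v.
Proof.
rewrite ler_norml dotv_le andbT lerNl -dotvNl.
apply: (le_trans (dotv_le _ _)).
by rewrite le_eqVlt /enorm dotvNl dotvNr opprK eqxx.
Qed.

Lemma enormZ c u : enorm (c *: u) = `|c| * enorm u.
Proof. by rewrite !enormE -l2Z; apply: eq_l2 => j _; rewrite mxE. Qed.

Lemma enormN u : enorm (- u) = enorm u.
Proof. by rewrite -scaleN1r enormZ normrN1 mul1r. Qed.

Lemma enormD u v : enorm (u + v) <= enorm u + enorm v.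
Proof.
by rewrite !enormE; apply: le_trans (l2D _ _ _); apply: l2_le => j _; rewrite mxE.
Qed.

Lemma enorm_eq0 u : (enorm u == 0) = (u == 0).
Proof.
apply/idP/eqP => [/eqP u0|->]; last by rewrite /enorm dotv0l sqrtr0.
have : dotv u u = 0 by rewrite -enorm_sqr u0 expr0n.
move=> /eqP; rewrite psumr_eq0; last by move=> j _; rewrite -expr2 sqr_ge0.
move=> /allP h; apply/matrixP => j k; rewrite !mxE ord1.
by have := h j (mem_index_enum _); rewrite /= -expr2 sqrf_eq0 => /eqP.
Qed.

Lemma enorm_gt0 u : (0 < enorm u) = (u != 0).
Proof. by rewrite lt_neqAle enorm_ge0 andbT eq_sym enorm_eq0. Qed.

End euclid.

Section block_geometry.
Context {R : realType} {n N : nat}.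
Variables (a : 'I_N -> 'cV[R]_n) (D : {set 'I_N}).
Hypothesis D0 : (0 < #|D|)%N.
Let m : R := #|D|%:R.
Let m0 : 0 < m. Proof. by rewrite ltr0n. Qed.
Implicit Types (h u x z : 'cV[R]_n) (eta mu : R).

(** The singular values of the block matrix lie between (1 - eta) sqrt m and
    (1 + eta) sqrt m. *)
Definition gram_bounds eta := forall u,
  (1 - eta) * Num.sqrt m * enorm u <= l2 D (fun i => dotv (a i) u) /\
  l2 D (fun i => dotv (a i) u) <= (1 + eta) * Num.sqrt m * enorm u.

Definition excess_bound L e x := forall u,
  l2 D (fun i => Num.max (`|dotv (a i) u| - L * enorm u * `|dotv (a i) x|) 0)
    <= e * Num.sqrt m * enorm u.

(** One iteration on the block D with exact data |a_i . x|; it depends on x only up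
    to sign. *)
Definition gstep mu (x z : 'cV[R]_n) : 'cV[R]_n :=
  z - (mu / m) *: \sum_(i in D)
    ((`|dotv (a i) z| - `|dotv (a i) x|) * Num.sg (dotv (a i) z)) *: a i.

Variable eta : R.
Hypothesis eta0 : 0 <= eta <= 100%:R^-1.
Hypothesis gb : gram_bounds eta.

Let sm0 : 0 < Num.sqrt m. Proof. by rewrite sqrtr_gt0. Qed.
Let sm2 : Num.sqrt m ^+ 2 = m. Proof. by rewrite sqr_sqrtr// ltW. Qed.

(** Duality: pair the vector with itself and apply the upper Gram bound to it. *)
Lemma adjoint_bound (c : 'I_N -> R) :
  enorm (\sum_(i in D) c i *: a i) <= (1 + eta) * Num.sqrt m * l2 D c.
Proof.
set y := \sum_(i in D) _; have [->|y0] := eqVneq y 0.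
  have -> : enorm (0 : 'cV[R]_n) = 0 by apply/eqP; rewrite enorm_eq0.
  have /andP[e0 _] := eta0; rewrite mulr_ge0 ?l2_ge0// mulr_ge0 ?sqrtr_ge0//; lra.
rewrite -enorm_gt0 in y0; rewrite -(ler_pM2r y0) -expr2 enorm_sqr.
rewrite {1}/y dotv_suml.
have -> : \sum_(i in D) dotv (c i *: a i) y = \sum_(i in D) c i * dotv (a i) y.
  by apply: eq_bigr => i _; rewrite dotvZl.
apply: (le_trans (sum_CS _ _ _)).
rewrite [leRHS](_ : _ = l2 D c * ((1 + eta) * Num.sqrt m * enorm y)); last by ring.
by apply: ler_wpM2l; [exact: l2_ge0 | have [] := gb y].
Qed.

Let S h : 'cV[R]_n := \sum_(i in D) dotv (a i) h *: a i.

(** In the square of the norm, |S h|^2 is bounded by a multiple of <h, S h>, and the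
    terms in S combine to a negative multiple of <h, S h>; hence only the lower
    Gram bound is needed after that. *)
Lemma gram_step mu h : 0 < mu <= 2^-1 ->
  enorm (h - (mu / m) *: S h) <= (1 - mu + 6 * eta * mu) * enorm h.
Proof.
move=> /andP[mu0 mu1]; move/andP: eta0 => [e0 e1].
pose Q := l2 D (fun i => dotv (a i) h) ^+ 2.
have hS : dotv h (S h) = Q.
  rewrite dotvC dotv_suml /Q l2_sqr; apply: eq_bigr => i _.
  by rewrite dotvZl dotvC expr2 dotvC.
have nS : enorm (S h) ^+ 2 <= (1 + eta) ^+ 2 * m * Q.
  rewrite /Q -sm2 -!exprMn; apply: lerXn2r; rewrite ?nnegrE ?enorm_ge0 ?adjoint_bound//.
  by rewrite mulr_ge0 ?l2_ge0// mulr_ge0 ?sqrtr_ge0//; lra.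
have Qlow : (1 - eta) ^+ 2 * m * enorm h ^+ 2 <= Q.
  rewrite /Q -sm2 -!exprMn; apply: lerXn2r; rewrite ?nnegrE ?l2_ge0 ?(gb h).1//.
  by rewrite mulr_ge0 ?enorm_ge0// mulr_ge0 ?sqrtr_ge0//; lra.
have k0 : 0 <= 1 - mu + 6 * eta * mu by have : 0 <= eta * mu; [rewrite mulr_ge0// ltW|lra].
rewrite -(ler_pXn2r (n := 2))// ?nnegrE ?enorm_ge0//; last by rewrite mulr_ge0 ?enorm_ge0.
rewrite exprMn {1}enorm_sqr dotvBl !dotvBr !dotvZl !dotvZr (dotvC (S h) h) hS -!enorm_sqr.
set H := enorm h ^+ 2 in Qlow *; set Y := enorm (S h) ^+ 2 in nS *.
have H0 : 0 <= H by rewrite sqr_ge0.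
pose q := Q / m; have qE : Q = q * m by rewrite /q divfK// gt_eqF.
have q1 : (1 - eta) ^+ 2 * H <= q.
  by rewrite /q ler_pdivlMr// mulrAC.
have Y1 : (mu / m) * ((mu / m) * Y) <= mu ^+ 2 * (1 + eta) ^+ 2 * q.
  apply: (@le_trans _ _ (mu / m * (mu / m * ((1 + eta) ^+ 2 * m * Q)))).
    by rewrite !ler_wpM2l// divr_ge0// ltW.
  by rewrite qE le_eqVlt; apply/orP; left; apply/eqP; field; rewrite gt_eqF.
have Q1 : mu / m * Q = mu * q by rewrite /q; field; rewrite gt_eqF.
rewrite Q1 -[leLHS]/(H - mu * q - (mu * q - mu / m * (mu / m * Y))).
have c1 : 0 <= 2 - mu * (1 + eta) ^+ 2 - (2 - mu - 3 * eta * mu).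
  have -> : 2 - mu * (1 + eta) ^+ 2 - (2 - mu - 3 * eta * mu) = mu * eta * (1 - eta) by ring.
  by rewrite !mulr_ge0//; lra.
have em0 : 0 <= eta * mu by rewrite mulr_ge0// ltW.
have em1 : eta * mu <= eta / 2 by have := ler_wpM2l e0 mu1; lra.
have c2 : (2 - mu - 6 * eta) * H <= (2 - mu * (1 + eta) ^+ 2) * q.
  apply: (@le_trans _ _ ((2 - mu - 3 * eta * mu) * q)); last first.
    by rewrite ler_wpM2r//; [apply: (le_trans _ q1); rewrite mulr_ge0 ?sqr_ge0|lra].
  have h1 : (1 - 2 * eta) * H <= q.
    apply: le_trans q1; apply: ler_wpM2r => //; have := sqr_ge0 eta; lra.
  apply: (@le_trans _ _ ((2 - mu - 3 * eta * mu) * ((1 - 2 * eta) * H))); last first.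
    by rewrite ler_wpM2l//; lra.
  rewrite mulrA ler_wpM2r//.
  have : 0 <= eta * eta * mu by rewrite !mulr_ge0// ltW.
  lra.
have : mu * ((2 - mu - 6 * eta) * H) <= mu * ((2 - mu * (1 + eta) ^+ 2) * q).
  by rewrite ler_wpM2l// ltW.
have c3 : (1 - mu * (2 - mu - 6 * eta)) * H <= (1 - mu + 6 * eta * mu) ^+ 2 * H.
  apply: ler_wpM2r => //.
  have : 0 <= eta * mu * (1 - 2 * mu) by rewrite mulr_ge0//; lra.
  have : 0 <= (eta * mu) ^+ 2 by rewrite sqr_ge0.
  lra.
lra.
Qed.

(** The left-hand side vanishes when s and b have the same sign.  Otherwise it is at
    most 2 |b| and |s - b| >= |b|, hence at most 4 (|s - b| - |b| / 2). *)
Lemma update_split (s b : R) :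
  `|(`|s| - `|b|) * Num.sg s - (s - b)| <= 4 * Num.max (`|s - b| - `|b| / 2) 0.
Proof.
have le_max0 (w : R) : w <= Num.max w 0 by rewrite le_max lexx.
have max_ge0 (w : R) : 0 <= Num.max w 0 by rewrite le_max lexx orbT.
have [s0|s0|->] := ltrgtP s 0.
- rewrite (ltr0_sg s0) (ltr0_norm s0).
  have -> : (- s - `|b|) * -1 - (s - b) = `|b| + b by ring.
  have [b0|b0] := ler0P b.
    by rewrite addrC subrr normr0 mulr_ge0.
  have := le_max0 (`|s - b| - b / 2).
  rewrite (ltr0_norm (_ : s - b < 0)); last lra.
  by rewrite ger0_norm; lra.
- rewrite (gtr0_sg s0) (gtr0_norm s0).
  have -> : (s - `|b|) * 1 - (s - b) = b - `|b| by ring.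
  have [b0|b0] := ger0P b.
    by rewrite subrr normr0 mulr_ge0.
  have := le_max0 (`|s - b| - (- b) / 2).
  rewrite (gtr0_norm (_ : 0 < s - b)); last lra.
  by rewrite ltr0_norm; lra.
- rewrite sgr0 mulr0 !sub0r opprK normrN.
  have := le_max0 (`|b| - `|b| / 2); have := normr_ge0 b; lra.
Qed.

Lemma gstep_split mu x z : gstep mu x z = (z - (mu / m) *: S z) +
  (mu / m) *: \sum_(i in D) (`|dotv (a i) x| * Num.sg (dotv (a i) z)) *: a i.
Proof.
rewrite /gstep -addrA; congr (_ + _).
have -> : \sum_(i in D) ((`|dotv (a i) z| - `|dotv (a i) x|) * Num.sg (dotv (a i) z)) *: a i =
    S z - \sum_(i in D) (`|dotv (a i) x| * Num.sg (dotv (a i) z)) *: a i.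
  rewrite /S -sumrB; apply: eq_bigr => i _; rewrite -scalerBl; congr (_ *: _).
  by rewrite mulrBl mulrC -numEsg.
by rewrite scalerBr opprB addrC.
Qed.

(** The step is a contraction by 1 - mu, up to O(eta), plus mu times a vector of
    norm at most (1 + eta)^2 |x|; the slack 20 eta makes the ball invariant. *)
Lemma gstep_norm mu x z : 0 < mu <= 2^-1 ->
  enorm z <= (1 + 20%:R * eta) * enorm x ->
  enorm (gstep mu x z) <= (1 + 20%:R * eta) * enorm x.
Proof.
move=> mu01 zx; have /andP[mu0 mu1] := mu01; have /andP[e0 e1] := eta0.
rewrite gstep_split; apply: (le_trans (enormD _ _)).
have h1 := gram_step z mu01.
have h2 := adjoint_bound (fun i => `|dotv (a i) x| * Num.sg (dotv (a i) z)).
have h3 : l2 D (fun i => `|dotv (a i) x| * Num.sg (dotv (a i) z)) <= (1 + eta) * Num.sqrt m * enorm x.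
  apply: le_trans (gb x).2; apply: l2_le => i _; rewrite normrM normr_id ler_piMr//.
  by rewrite normr_sg lern1 leq_b1.
have X0 := enorm_ge0 x; have Z0 := enorm_ge0 z.
rewrite enormZ ger0_norm; last by rewrite divr_ge0// ltW.
have h4 : mu / m * enorm (\sum_(i in D) (`|dotv (a i) x| * Num.sg (dotv (a i) z)) *: a i) <=
    mu * (1 + eta) ^+ 2 * enorm x.
  apply: (@le_trans _ _ (mu / m * ((1 + eta) * Num.sqrt m * ((1 + eta) * Num.sqrt m * enorm x)))).
    apply: ler_wpM2l; first by rewrite divr_ge0// ltW.
    apply: (le_trans h2); apply: ler_wpM2l => //; rewrite mulr_ge0 ?sqrtr_ge0//; lra.
  have -> : mu / m * ((1 + eta) * Num.sqrt m * ((1 + eta) * Num.sqrt m * enorm x)) =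
    mu / m * ((1 + eta) ^+ 2 * Num.sqrt m ^+ 2 * enorm x) by ring.
  by rewrite sm2 le_eqVlt; apply/orP; left; apply/eqP; field; rewrite gt_eqF.
have h5 : (1 - mu + 6 * eta * mu) * enorm z <= (1 - mu + 6 * eta * mu) * ((1 + 20%:R * eta) * enorm x).
  by apply: ler_wpM2l => //; have : 0 <= eta * mu; [rewrite mulr_ge0// ltW|lra].
apply: (le_trans (lerD h1 h4)); apply: (le_trans (lerD h5 (lexx _))).
rewrite mulrA -mulrDl; apply: ler_wpM2r => //.
have -> : (1 - mu + 6 * eta * mu) * (1 + 20%:R * eta) + mu * (1 + eta) ^+ 2 =
   (1 + 20%:R * eta) - mu * eta * (12%:R - 121%:R * eta) by ring.
rewrite gerBl mulr_ge0//; last lra.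
by rewrite mulr_ge0// ltW.
Qed.

(** The step maps h = z - x to h - mu S h plus the error of [update_split].  When
    2 L |h| <= |x|, the threshold |a_i . x| / 2 dominates
    L |h| |a_i . x| / |x|, so the error is at most 4 e |h| in mean square. *)
Lemma gstep_contract mu L e x z : 0 < mu <= 2^-1 -> 0 < L -> 0 <= e <= 11%:R / 100%:R ->
  x != 0 -> excess_bound L e ((enorm x)^-1 *: x) ->
  2 * L * enorm (z - x) <= enorm x ->
  enorm (gstep mu x z - x) <= (1 - mu / 4) * enorm (z - x).
Proof.
move=> mu01 L0 /andP[ee0 ee1] xn0 eb zx; have /andP[mu0 mu1] := mu01; have /andP[e0 e1] := eta0.
have X0 : 0 < enorm x by rewrite enorm_gt0.
set h := z - x.
pose c i := (`|dotv (a i) z| - `|dotv (a i) x|) * Num.sg (dotv (a i) z) - dotv (a i) h.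
have -> : gstep mu x z - x = (h - (mu / m) *: S h) - (mu / m) *: \sum_(i in D) c i *: a i.
  rewrite /gstep /S -addrA [- _ - x]addrC addrA -/h -[RHS]addrA; congr (_ + _).
  rewrite -opprD -scalerDr -big_split/=; congr (- (_ *: _)); apply: eq_bigr => i _.
  by rewrite -scalerDl /c addrCA subrr addr0.
apply: (le_trans (enormD _ _)); rewrite enormN enormZ ger0_norm; last by rewrite divr_ge0// ltW.
have h1 := gram_step h mu01; have h2 := adjoint_bound c.
have H0 := enorm_ge0 h.
have h3 : l2 D c <= 4 * (e * Num.sqrt m * enorm h).
  apply: (@le_trans _ _ (l2 D (fun i => 4 * Num.max (`|dotv (a i) h| -
      L * enorm h * `|dotv (a i) ((enorm x)^-1 *: x)|) 0))); last first.
    by rewrite l2Z (ger0_norm (_ : 0 <= 4))// ler_wpM2l.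
  apply: l2_le => i _; have := update_split (dotv (a i) z) (dotv (a i) x).
  rewrite -dotvBr -/h -/(c i) => /le_trans; apply.
  rewrite [leRHS]ger0_norm; last by rewrite mulr_ge0// le_max lexx orbT.
  rewrite ler_wpM2l// ge_max; apply/andP; split; last by rewrite le_max lexx orbT.
  rewrite le_max; apply/orP; left; rewrite lerD2l lerN2 dotvZr normrM (ger0_norm (_ : 0 <= (enorm x)^-1)); last by rewrite invr_ge0 ltW.
  have -> : L * enorm h * ((enorm x)^-1 * `|dotv (a i) x|) =
    (L * enorm h / enorm x) * `|dotv (a i) x| by ring.
  rewrite [leRHS]mulrC; apply: ler_wpM2r => //.
  by rewrite ler_pdivrMr//; lra.
have s2 : mu / m * enorm (\sum_(i in D) c i *: a i) <= mu * ((1 + eta) * (4 * e)) * enorm h.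
  apply: (@le_trans _ _ (mu / m * ((1 + eta) * Num.sqrt m * (4 * (e * Num.sqrt m * enorm h))))).
    apply: ler_wpM2l; first by rewrite divr_ge0// ltW.
    apply: (le_trans h2); apply: ler_wpM2l => //; rewrite mulr_ge0 ?sqrtr_ge0//; lra.
  have -> : mu / m * ((1 + eta) * Num.sqrt m * (4 * (e * Num.sqrt m * enorm h))) =
    mu / m * ((1 + eta) * (4 * e) * Num.sqrt m ^+ 2 * enorm h) by ring.
  by rewrite sm2 le_eqVlt; apply/orP; left; apply/eqP; field; rewrite gt_eqF.
apply: (le_trans (lerD h1 s2)); rewrite -mulrDl; apply: ler_wpM2r => //.
have -> : 1 - mu + 6 * eta * mu + mu * ((1 + eta) * (4 * e)) =
  1 - mu * (1 - 6 * eta - (1 + eta) * (4 * e)) by ring.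
rewrite lerD2l lerN2; apply: ler_wpM2l; first exact: ltW.
have : (1 + eta) * (4 * e) <= (1 + 100%:R^-1) * (4 * (11%:R / 100%:R)).
  by apply: ler_pM; lra.
lra.
Qed.

Lemma gstep_signal mu x z : x != 0 ->
  dotv (gstep mu x z) ((enorm x)^-1 *: x) / enorm x =
  dotv z ((enorm x)^-1 *: x) / enorm x - mu / m * \sum_(i in D)
    sgn_corr (dotv (a i) ((enorm x)^-1 *: z), dotv (a i) ((enorm x)^-1 *: x)).
Proof.
move=> xn0; have X0 : 0 < enorm x by rewrite enorm_gt0.
rewrite /gstep dotvBl dotvZl dotv_suml mulrBl; congr (_ - _).
rewrite -(mulrA (mu / m)); congr (_ * _); rewrite mulr_suml; apply: eq_bigr => i _.
rewrite dotvZl /sgn_corr /= !dotvZr sgrM (gtr0_sg (_ : 0 < (enorm x)^-1)) ?invr_gt0//.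
by rewrite !normrM (ger0_norm (_ : 0 <= (enorm x)^-1)) ?invr_ge0 ?(ltW X0)//; ring.
Qed.

End block_geometry.

Section scalar_dynamics.
Context {R : realType}.
Implicit Types t B : R.

Lemma growth_le B t : B <= t -> growth B <= growth t.
Proof.
move=> Bt; rewrite /growth.
have h1 : Num.min B (1 - B) <= Num.min t (1 - t) + (t - B).
  have [h|h] := leP t (1 - t).
    by rewrite ge_min; apply/orP; left; lra.
  by rewrite ge_min; apply/orP; right; lra.
lra.
Qed.

(** The gain zeta / 1000 is split into four parts: one pays for the norm slack tau,
    one for the fluctuation eps, one remains as growth, and the last absorbs the
    product terms. *)
Lemma growth_step mu zeta tau eps A B A' t :
  0 < mu <= 2^-1 -> 0 < zeta <= 1 -> 0 <= tau <= zeta / 4000%:R ->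
  0 < B <= 1 - zeta -> B <= t -> eps <= zeta * B / 4000%:R -> A = (1 + tau) * B ->
  (1 - mu) * A + mu * (growth t - eps) <= A' ->
  (1 + mu * zeta / 4000%:R) * A <= A'.
Proof.
move=> /andP[mu0 mu1] /andP[z0 z1] /andP[t0 t1] /andP[B0 B1] Bt eB AE.
apply: le_trans.
have gB : (1 + zeta / 1000%:R) * B <= growth t.
  apply: le_trans (growth_le Bt); rewrite /growth.
  have : zeta * B <= Num.min B (1 - B); last lra.
  rewrite le_min; apply/andP; split; first by rewrite ler_piMl// ltW.
  by apply: (@le_trans _ _ (zeta * 1)); [apply: ler_wpM2l; lra|lra].
have h : (1 + zeta / 4000%:R) * A + eps <= growth t.
  apply: le_trans gB; rewrite AE.
  apply: (@le_trans _ _ ((1 + zeta / 4000%:R) * ((1 + zeta / 4000%:R) * B) + zeta * B / 4000%:R)).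
    apply: lerD => //; apply: ler_wpM2l; first lra.
    by apply: ler_wpM2r; lra.
  have -> : (1 + zeta / 4000%:R) * ((1 + zeta / 4000%:R) * B) + zeta * B / 4000%:R =
    (1 + zeta / 4000%:R * (3 + zeta / 4000%:R)) * B by ring.
  apply: ler_wpM2r; first lra.
  rewrite lerD2l; apply: (@le_trans _ _ (zeta / 4000%:R * 4)); last lra.
  by apply: ler_wpM2l; lra.
have : mu * ((1 + zeta / 4000%:R) * A) <= mu * (growth t - eps).
  by apply: ler_wpM2l; lra.
lra.
Qed.

(** |z - x|^2 = |z|^2 - 2 <z, x> + |x|^2 is at most
    (tau^2 + 2 (1 + tau) zeta) |x|^2 <= 8 zeta |x|^2. *)
Lemma near_target (n : nat) (x z : 'cV[R]_n) gam zeta tau :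
  x != 0 -> 0 < gam < 1 -> zeta = gam ^+ 2 / 8 -> 0 <= tau <= zeta / 4000%:R ->
  enorm z <= (1 + tau) * enorm x ->
  (1 + tau) * (1 - zeta) * enorm x <= dotv z ((enorm x)^-1 *: x) ->
  enorm (z - x) <= gam * enorm x.
Proof.
move=> xn0 /andP[g0 g1] zE /andP[t0 t1] zx; have X0 : 0 < enorm x by rewrite enorm_gt0.
rewrite dotvZr => h.
have h2 : (1 + tau) * (1 - zeta) * enorm x ^+ 2 <= dotv z x.
  have := ler_wpM2l (ltW X0) h; rewrite [leRHS]mulrA mulfV ?gt_eqF// mul1r => /(le_trans _); apply.
  by rewrite le_eqVlt; apply/orP; left; apply/eqP; ring.
rewrite -(ler_pXn2r (n := 2))// ?nnegrE ?enorm_ge0//; last by rewrite mulr_ge0 ?ltW.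
rewrite enorm_sqr dotvBl !dotvBr (dotvC x z) -!enorm_sqr exprMn.
have hz : enorm z ^+ 2 <= (1 + tau) ^+ 2 * enorm x ^+ 2.
  by rewrite -exprMn; apply: lerXn2r; rewrite ?nnegrE ?enorm_ge0// mulr_ge0 ?enorm_ge0//; lra.
set X2 := enorm x ^+ 2 in hz h2 *; have X20 : 0 <= X2 by rewrite sqr_ge0.
have z0 : 0 <= zeta by rewrite zE divr_ge0 ?sqr_ge0.
have g2 : gam ^+ 2 <= 1 by rewrite expr_le1// ltW.
have hc : (1 + tau) ^+ 2 - 2 * ((1 + tau) * (1 - zeta)) + 1 <= gam ^+ 2.
  have -> : (1 + tau) ^+ 2 - 2 * ((1 + tau) * (1 - zeta)) + 1 = tau ^+ 2 + 2 * (1 + tau) * zeta by ring.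
  have tz : tau ^+ 2 <= zeta * 1.
    by rewrite expr2; apply: ler_pM; lra.
  have : (1 + tau) * zeta <= (1 + 1) * zeta by apply: ler_wpM2r; lra.
  lra.
have := ler_wpM2r X20 hc; lra.
Qed.

End scalar_dynamics.

(** * From a grid to all directions *)
Lemma le_of_sqr (R : realType) (x y : R) : 0 <= y -> x ^+ 2 <= y ^+ 2 -> x <= y.
Proof.
move=> y0 xy; have [x0|x0] := lerP 0 x; last by lra.
by rewrite -(ler_pXn2r (n := 2))// nnegrE.
Qed.

Section net.
Context {R : realType} {n N : nat}.
Variables (a : 'I_N -> 'cV[R]_n) (D : {set 'I_N}).
Hypothesis D0 : (0 < #|D|)%N.
Let m : R := #|D|%:R.
Let m0 : 0 < m. Proof. by rewrite ltr0n. Qed.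
Variable q : nat.
Hypotheses (n0 : (0 < n)%N) (q0 : (0 < q)%N).

(** The grid of mesh 1 / (n q) in the cube of side 2 centred at 0. *)
Definition grid_vec (k : {ffun 'I_n -> 'I_(n * q).*2.+1}) : 'cV[R]_n :=
  \col_j ((k j)%:R / (n * q)%:R - 1).

(** The constant 602 makes 6 / (602 - 2) = 1 / 100 in [integral2_excess]. *)
Definition grid_good (delta : R) (xh : 'cV[R]_n) :=
  forall k, dotv (grid_vec k) (grid_vec k) <= 4 ->
    [/\ \sum_(i in D) dotv (a i) (grid_vec k) ^+ 2 <= m * (dotv (grid_vec k) (grid_vec k) + delta),
        m * (dotv (grid_vec k) (grid_vec k) - delta) <= \sum_(i in D) dotv (a i) (grid_vec k) ^+ 2 &
        \sum_(i in D) (Num.max (`|dotv (a i) (grid_vec k)| - 602%:R * `|dotv (a i) xh|) 0) ^+ 2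
          <= m * (100%:R^-1 + delta)].

Let M : nat := (n * q)%N.
Let M0 : 0 < M%:R :> R. Proof. by rewrite ltr0n muln_gt0 n0 q0. Qed.

Lemma grid_unit (j : 'I_n) : exists k, grid_vec k = delta_mx j 0.
Proof.
exists [ffun i => if i == j then ord_max else inord (n * q)].
apply/matrixP => i l; rewrite !mxE ord1 ffunE eqxx andbT.
have [_|_] := eqVneq i j.
  by rewrite /= -mul2n natrM mulfK ?gt_eqF//; ring.
rewrite inordK ?divff ?subrr ?gt_eqF//.
by rewrite ltnS -addnn leq_addr.
Qed.

Lemma grid_round (u : 'cV[R]_n) : enorm u = 1 ->
  exists k, forall j, `|u j 0 - grid_vec k j 0| <= M%:R^-1.
Proof.
move=> u1.
have uj j : `|u j 0| <= 1.
  rewrite -(ler_pXn2r (n := 2))// ?nnegrE// expr1n real_normK ?num_real//.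
  rewrite -(expr1n _ 2) -u1 enorm_sqr /dotv (bigD1 j)//= -expr2 lerDl.
  by apply: sumr_ge0 => i _; rewrite -expr2 sqr_ge0.
exists [ffun j => inord (Num.truncn ((u j 0 + 1) * M%:R))] => j.
have := uj j; rewrite ler_norml => /andP[u_ge u_le].
have p0 : 0 <= (u j 0 + 1) * M%:R by rewrite mulr_ge0// ?(ltW M0)//; lra.
have /andP[t1 t2] := truncn_itv p0.
rewrite mxE ffunE inordK; last first.
  rewrite ltnS -(ler_nat R) (le_trans t1)// -mul2n natrM.
  by apply: ler_wpM2r; [exact: ltW | lra].
move: t1 t2; set k := Num.truncn _ => t1 t2.
have -> : u j 0 - (k%:R / (n * q)%:R - 1) = ((u j 0 + 1) * M%:R - k%:R) / M%:R.
  by rewrite -/M; field; rewrite gt_eqF.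
rewrite normrM [X in _ * X]ger0_norm ?invr_ge0 ?(ltW M0)// ler_piMl ?invr_ge0 ?(ltW M0)//.
rewrite ger0_norm; first by move: t2; rewrite -natr1; lra.
lra.
Qed.

Variables (eta delta : R) (xh : 'cV[R]_n).
Hypotheses (eta0 : 0 < eta <= 100%:R^-1) (q_eta : 8 <= eta * q%:R).
Hypothesis deltaE : delta = (eta / 4) ^+ 2.
Hypothesis good : grid_good delta xh.

Let sm0 : 0 < Num.sqrt m. Proof. by rewrite sqrtr_gt0. Qed.
Let sm2 : Num.sqrt m ^+ 2 = m. Proof. by rewrite sqr_sqrtr// ltW. Qed.
Let q0' : 0 < q%:R :> R. Proof. by rewrite ltr0n. Qed.
Let iq : q%:R^-1 <= eta / 8.
Proof. rewrite -[q%:R^-1]div1r ler_pdivrMr//; move: q_eta; lra. Qed.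

(** The coordinate vectors are grid points, so the sum of the |a_i|^2 is at most
    2 n m.  With Cauchy-Schwarz for each a_i this yields 2 n m |w|^2, and |w|^2
    is at most 1 / (n q^2). *)
Let error_bound (w : 'cV[R]_n) : (forall j, `|w j 0| <= M%:R^-1) ->
  enorm w <= q%:R^-1 /\ l2 D (fun i => dotv (a i) w) <= 2 * q%:R^-1 * Num.sqrt m.
Proof.
move=> wM; have /andP[e0 e1] := eta0.
have nR : 1 <= n%:R :> R by rewrite ler1n.
have w2 : dotv w w <= n%:R * M%:R^-1 ^+ 2.
  rewrite /dotv; apply: (@le_trans _ _ (\sum_(j < n) M%:R^-1 ^+ 2)).
    apply: ler_sum => j _; rewrite -expr2 -(real_normK (num_real (w j 0))).
    by apply: lerXn2r; rewrite ?nnegrE ?invr_ge0 ?(ltW M0).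
  by rewrite sumr_const card_ord mulr_natl.
have nM : n%:R * M%:R^-1 = q%:R^-1 :> R.
  by rewrite /M natrM invfM mulrA mulfV ?mul1r// gt_eqF// ltr0n.
split.
  rewrite -(ler_pXn2r (n := 2))// ?nnegrE ?enorm_ge0 ?invr_ge0 ?(ltW q0')// enorm_sqr.
  apply: (le_trans w2); rewrite -nM exprMn; apply: ler_wpM2r; first exact: sqr_ge0.
  by rewrite expr2 -[leLHS]mul1r; apply: ler_wpM2r => //; exact: ler0n.
have tr : \sum_(i in D) dotv (a i) (a i) <= 2 * n%:R * m.
  have -> : \sum_(i in D) dotv (a i) (a i) =
      \sum_(j < n) \sum_(i in D) dotv (a i) (delta_mx j 0) ^+ 2.
    rewrite [RHS]exchange_big/=; apply: eq_bigr => i _; apply: eq_bigr => j _.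
    have -> : dotv (a i) (delta_mx j 0) = a i j 0; last by rewrite expr2.
    rewrite /dotv (bigD1 j)//= mxE !eqxx mulr1.
    by rewrite big1 ?addr0// => k kj; rewrite mxE (negbTE kj) mulr0.
  apply: (@le_trans _ _ (\sum_(j < n) m * 2)); last first.
    by rewrite sumr_const card_ord -mulr_natl; lra.
  apply: ler_sum => j _; have [k kE] := grid_unit j.
  have d1 : dotv (delta_mx j 0 : 'cV[R]_n) (delta_mx j 0) = 1.
    rewrite /dotv (bigD1 j)//= mxE !eqxx mulr1 big1 ?addr0// => i ij.
    by rewrite mxE (negbTE ij) mulr0.
  have [] := @good k; rewrite kE d1; first lra.
  move=> h _ _; apply: (le_trans h); apply: ler_wpM2l; first exact: ltW.
  rewrite deltaE; have : (eta / 4) ^+ 2 <= 1 ^+ 2 by apply: lerXn2r; rewrite ?nnegrE; lra.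
  rewrite expr1n; lra.
apply: le_of_sqr.
  by rewrite mulr_ge0 ?(ltW sm0)// mulr_ge0// invr_ge0 ltW.
rewrite l2_sqr exprMn sm2.
apply: (@le_trans _ _ (\sum_(i in D) dotv (a i) (a i) * dotv w w)).
  apply: ler_sum => i _; rewrite -!enorm_sqr -exprMn -(real_normK (num_real (dotv (a i) w))).
  by apply: lerXn2r; rewrite ?nnegrE ?normr_dotv_le// mulr_ge0 ?enorm_ge0.
rewrite -mulr_suml; apply: (@le_trans _ _ (2 * n%:R * m * (n%:R * M%:R^-1 ^+ 2))).
  by apply: ler_pM => //; [apply: sumr_ge0 => i _|]; exact: dotv_ge0.
have -> : 2 * n%:R * m * (n%:R * M%:R^-1 ^+ 2) = 2 * (n%:R * M%:R^-1) ^+ 2 * m by ring.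
rewrite nM; apply: ler_wpM2r; first exact: ltW.
rewrite exprMn; apply: ler_wpM2r; first exact: sqr_ge0.
by lra.
Qed.

Let unit_bounds (u : 'cV[R]_n) : enorm u = 1 ->
  [/\ (1 - eta) * Num.sqrt m <= l2 D (fun i => dotv (a i) u),
      l2 D (fun i => dotv (a i) u) <= (1 + eta) * Num.sqrt m &
      l2 D (fun i => Num.max (`|dotv (a i) u| - 602%:R * `|dotv (a i) xh|) 0)
        <= 11%:R / 100%:R * Num.sqrt m].
Proof.
move=> u1; have /andP[e0 e1] := eta0; have iq1 := iq.
have [k kE] := grid_round u1; set v := grid_vec k in kE.
have [w1 wl] : enorm (u - v) <= q%:R^-1 /\
    l2 D (fun i => dotv (a i) (u - v)) <= 2 * q%:R^-1 * Num.sqrt m.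
  by apply: error_bound => j; have := kE j; rewrite !mxE.
have iq0 : 0 < q%:R^-1 :> R by rewrite invr_gt0.
have v_le : enorm v <= 1 + q%:R^-1.
  have -> : v = u + - (u - v) by rewrite opprB addrC subrK.
  by apply: (le_trans (enormD _ _)); rewrite enormN; lra.
have v_ge : 1 - q%:R^-1 <= enorm v.
  have := enormD (u - v) v; rewrite subrK u1; lra.
have vv : dotv v v <= 4.
  rewrite -enorm_sqr (_ : 4 = 2 ^+ 2 :> R); last by ring.
  apply: lerXn2r; [by rewrite nnegrE enorm_ge0 | by rewrite nnegrE | lra].
have [Qu Ql Qe] := @good k vv; rewrite -/v in Qu Ql Qe.
have lup : l2 D (fun i => dotv (a i) v) <= (1 + q%:R^-1 + eta / 4) * Num.sqrt m.
  apply: le_of_sqr.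
    by rewrite mulr_ge0 ?(ltW sm0)//; lra.
  rewrite l2_sqr exprMn sm2; apply: (le_trans Qu); rewrite mulrC; apply: ler_wpM2r; first exact: ltW.
  rewrite deltaE -enorm_sqr.
  have : enorm v ^+ 2 <= (1 + q%:R^-1) ^+ 2 by apply: lerXn2r; rewrite ?nnegrE ?enorm_ge0//; lra.
  rewrite [(1 + _ + _) ^+ 2]sqrrD.
  have : 0 <= (1 + q%:R^-1) * (eta / 4) by rewrite mulr_ge0; lra.
  lra.
have ldn : (1 - q%:R^-1 - eta / 4) * Num.sqrt m <= l2 D (fun i => dotv (a i) v).
  apply: le_of_sqr; first exact: l2_ge0.
  rewrite l2_sqr exprMn sm2; apply: le_trans Ql; rewrite mulrC; apply: ler_wpM2l; first exact: ltW.
  rewrite deltaE -enorm_sqr.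
  have : (1 - q%:R^-1) ^+ 2 <= enorm v ^+ 2 by apply: lerXn2r; rewrite ?nnegrE ?enorm_ge0//; lra.
  have : 0 <= (1 - q%:R^-1 - eta / 4) * (eta / 4) by rewrite mulr_ge0; lra.
  lra.
have lex : l2 D (fun i => Num.max (`|dotv (a i) v| - 602%:R * `|dotv (a i) xh|) 0) <=
    (10%:R^-1 + eta / 4) * Num.sqrt m.
  apply: le_of_sqr.
    by rewrite mulr_ge0 ?(ltW sm0)//; lra.
  rewrite l2_sqr exprMn sm2; apply: (le_trans Qe); rewrite mulrC; apply: ler_wpM2r; first exact: ltW.
  rewrite deltaE sqrrD; lra.
have smq : q%:R^-1 * Num.sqrt m <= eta / 8 * Num.sqrt m.
  by apply: ler_wpM2r; [exact: ltW | exact: iq].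
have se0 : 0 <= eta * Num.sqrt m by rewrite mulr_ge0 ?(ltW sm0)// ltW.
have se1 : eta * Num.sqrt m <= 100%:R^-1 * Num.sqrt m.
  by apply: ler_wpM2r => //; exact: ltW.
split.
- have := l2D D (fun i => dotv (a i) u) (fun i => -1 * dotv (a i) (u - v)).
  rewrite l2Z normrN1 mul1r (@eq_l2 _ _ D (fun i => _ + _) (fun i => dotv (a i) v)); last first.
    by move=> i _; rewrite dotvBr; ring.
  lra.
- have := l2D D (fun i => dotv (a i) v) (fun i => dotv (a i) (u - v)).
  rewrite (@eq_l2 _ _ D (fun i => _ + _) (fun i => dotv (a i) u)); last first.
    by move=> i _; rewrite dotvBr; ring.
  lra.
- apply: (@le_trans _ _ (l2 D (fun i => Num.max (`|dotv (a i) v| - 602%:R * `|dotv (a i) xh|) 0 +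
      `|dotv (a i) (u - v)|))).
    apply: l2_le => i _; rewrite [leLHS]ger0_norm; last by rewrite le_max lexx orbT.
    have mx0 (t : R) : 0 <= Num.max t 0 by rewrite le_max lexx orbT.
    rewrite [leRHS]ger0_norm ?addr_ge0// ge_max; apply/andP; split; last by rewrite addr_ge0.
    have : `|dotv (a i) v| - 602%:R * `|dotv (a i) xh| <=
      Num.max (`|dotv (a i) v| - 602%:R * `|dotv (a i) xh|) 0 by rewrite le_max lexx.
    have : `|dotv (a i) u| <= `|dotv (a i) v| + `|dotv (a i) (u - v)|.
      by apply: le_trans (ler_normD _ _); rewrite dotvBr addrC subrK.
    lra.
  apply: (le_trans (l2D _ _ _)).
  have -> : l2 D (fun i => `|dotv (a i) (u - v)|) = l2 D (fun i => dotv (a i) (u - v)).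
    by congr Num.sqrt; apply: eq_bigr => i _; rewrite real_normK ?num_real.
  lra.
Qed.

(** Homogeneity reduces the claim to unit vectors, for which the nearest grid vector
    and [error_bound] suffice. *)
Lemma net_bounds : gram_bounds a D eta /\ excess_bound a D 602%:R (11%:R / 100%:R) xh.
Proof.
suff h (u : 'cV[R]_n) :
  [/\ (1 - eta) * Num.sqrt m * enorm u <= l2 D (fun i => dotv (a i) u),
      l2 D (fun i => dotv (a i) u) <= (1 + eta) * Num.sqrt m * enorm u &
      l2 D (fun i => Num.max (`|dotv (a i) u| - 602%:R * enorm u * `|dotv (a i) xh|) 0)
        <= 11%:R / 100%:R * Num.sqrt m * enorm u].
  by split=> u; have [? ? ?] := h u.
have [->|u0] := eqVneq u 0.
  have e0 : enorm (0 : 'cV[R]_n) = 0 by apply/eqP; rewrite enorm_eq0.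
  have l0 : l2 D (fun i => 0 : R) = 0.
    by rewrite /l2 big1 ?sqrtr0// => i _; rewrite expr0n.
  have d0 i : dotv (a i) 0 = 0 by rewrite dotvC dotv0l.
  rewrite e0 !mulr0; split.
  - by rewrite (@eq_l2 _ _ D _ (fun=> 0)) ?l0.
  - by rewrite (@eq_l2 _ _ D _ (fun=> 0)) ?l0.
  - by rewrite (@eq_l2 _ _ D _ (fun=> 0)) ?l0// => i _; rewrite d0 normr0 mul0r subr0 maxxx.
have U0 : 0 < enorm u by rewrite enorm_gt0.
have u1 : enorm ((enorm u)^-1 *: u) = 1.
  by rewrite enormZ ger0_norm ?invr_ge0 ?(ltW U0)// mulVf ?gt_eqF.
have uE : u = enorm u *: ((enorm u)^-1 *: u) by rewrite scalerA mulfV ?scale1r// gt_eqF.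
have [h1 h2 h3] := unit_bounds u1.
set u' := (enorm u)^-1 *: u in u1 uE h1 h2 h3.
have aE i : dotv (a i) u = enorm u * dotv (a i) u' by rewrite {1}uE dotvZr.
have l2E : l2 D (fun i => dotv (a i) u) = enorm u * l2 D (fun i => dotv (a i) u').
  rewrite (@eq_l2 _ _ D _ (fun i => enorm u * dotv (a i) u')) => [|i _]; last exact: aE.
  by rewrite l2Z ger0_norm// ltW.
rewrite l2E; split.
- by rewrite [leRHS]mulrC; apply: ler_wpM2r => //; exact: ltW.
- by rewrite mulrC; apply: ler_wpM2r => //; exact: ltW.
- rewrite (@eq_l2 _ _ D _ (fun i => enorm u *
    Num.max (`|dotv (a i) u'| - 602%:R * `|dotv (a i) xh|) 0)) => [|i _].
    rewrite l2Z (ger0_norm (ltW U0)) [leRHS]mulrC; apply: ler_wpM2l => //; exact: ltW.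
  rewrite aE normrM (ger0_norm (ltW U0)) maxr_pMr ?(ltW U0)// mulr0; congr Num.max.
  by ring.
Qed.

End net.

(** * The two phases on the good event *)
Lemma divrn_gt0 (R : realType) (x : R) k : 0 < x -> 0 < x / k.+1%:R.
Proof. by move=> x0; rewrite divr_gt0// ltr0n. Qed.

Lemma ler_divrn (R : realType) (x y : R) k : x <= y -> x / k%:R <= y / k%:R.
Proof. by move=> xy; apply: ler_wpM2r => //; rewrite invr_ge0 ler0n. Qed.

Lemma excess_const (R : realType) :
  ((0 : R) <= 11%:R / 100%:R <= (11%:R / 100%:R : R)).
Proof. by apply/andP; split; lra. Qed.

Lemma contract_radius (R : realType) (e g X : R) :
  0 <= X -> e <= g * X -> g <= 1204%:R^-1 -> 2 * 602%:R * e <= X.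
Proof.
move=> X0 eg g1; apply: (@le_trans _ _ (2 * 602%:R * (1204%:R^-1 * X))).
  apply: ler_wpM2l; first by rewrite -natrM ler0n.
  by apply: (le_trans eg); apply: ler_wpM2r.
have -> : 2 * 602%:R = 1204%:R :> R by rewrite -(natrM _ 2 602).
by rewrite mulrA mulfV; [rewrite mul1r lexx|rewrite pnatr_eq0].
Qed.

Section trajectory.
Context {R : realType} {n N : nat}.
Implicit Types (a : 'I_N -> 'cV[R]_n) (D : {set 'I_N}) (x z : 'cV[R]_n).

(** The block D makes the correlation with x fall short of its mean growth by at
    least eps.  The first two clauses restrict this to the iterates for which the
    mean is under control. *)
Definition signal_bad a D x (eps : R) z :=
  let xh := (enorm x)^-1 *: x in
  let w := (enorm x)^-1 *: z in
  [/\ 0 < dotv w xh, enorm w <= 2 &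
   #|D|%:R * (dotv w xh - growth (dotv w xh / enorm w) + eps) <=
   \sum_(i in D) sgn_corr (dotv (a i) w, dotv (a i) xh)].

(** While B = A / (1 + tau) is below 1 - zeta it is multiplied by
    1 + mu zeta / 4000, which cannot last T steps.  At a step j where it
    exceeds 1 - zeta the iterate is within gam |x| of x, and from there on the
    distance contracts; the bound from T on only loses the steps between j and T. *)
Lemma trajectory a (Db : nat -> {set 'I_N}) (m T : nat) x (z : nat -> 'cV[R]_n)
    (mu gam zeta tau eps B0 : R) :
  (0 < m)%N -> (forall k, #|Db k| = m) -> 0 < mu <= 2^-1 -> x != 0 ->
  0 < gam <= 1204%:R^-1 -> zeta = gam ^+ 2 / 8 -> 0 < tau <= zeta / 4000%:R ->
  (forall k, z k.+1 = gstep a (Db k) mu x (z k)) ->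
  (forall k, gram_bounds a (Db k) (tau / 20%:R)) ->
  (forall k, excess_bound a (Db k) 602%:R (11%:R / 100%:R) ((enorm x)^-1 *: x)) ->
  enorm (z 0%N) <= (1 + tau) * enorm x ->
  0 < B0 -> (1 + tau) * B0 * enorm x <= dotv (z 0%N) ((enorm x)^-1 *: x) ->
  eps <= zeta * B0 / 4000%:R -> 1 <= (1 + mu * zeta / 4000%:R) ^+ T * B0 ->
  (forall k, (k < T)%N -> ~ signal_bad a (Db k) x eps (z k)) ->
  forall k, (T <= k)%N -> enorm (z k - x) <= gam * (1 - mu / 4) ^+ (k - T) * enorm x.
Proof.
move=> m0 Dm mu01 xn0 /andP[g0 g1] zetaE /andP[tau0 tau1] zS gb eb z0 B00 zB0 epsB big notbad.
have X0 : 0 < enorm x by rewrite enorm_gt0.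
have /andP[mu0 mu1] := mu01.
have D0 k : (0 < #|Db k|)%N by rewrite Dm.
have gam1 : gam < 1 by clear -g1; lra.
have zeta0 : 0 < zeta by rewrite zetaE divr_gt0 ?exprn_gt0.
have zeta1 : zeta <= 1.
  have : gam ^+ 2 <= 1 by rewrite expr_le1// ltW.
  by rewrite zetaE; clear; lra.
have tau2 : 0 <= tau / 20%:R <= 100%:R^-1 by apply/andP; clear -tau0 tau1 zeta1; split; lra.
have tauE : 20%:R * (tau / 20%:R) = tau by field.
have zn k : enorm (z k) <= (1 + tau) * enorm x.
  elim: k => // k IH; rewrite zS -tauE.
  by apply: (gstep_norm (D0 k) tau2 (gb k)) => //; rewrite tauE.
set xh := (enorm x)^-1 *: x in eb zB0 *.
pose A k := dotv (z k) xh / enorm x; pose B k := A k / (1 + tau).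
have t10 : 0 < 1 + tau by clear -tau0; lra.
have AB k : A k = (1 + tau) * B k by rewrite /B mulrC divfK// gt_eqF.
set th := mu * zeta / 4000%:R in big.
have th0 : 0 < th by apply: divrn_gt0; apply: mulr_gt0.
have B0E : B0 <= B 0%N.
  by rewrite /B /A !ler_pdivlMr//; move: zB0; rewrite [B0 * _]mulrC.
have [j jT jB] : exists2 j, (j <= T)%N & 1 - zeta < B j.
  apply: contrapT => nj.
  have Ble k : (k <= T)%N -> B k <= 1 - zeta.
    by move=> kT; rewrite leNgt; apply/negP => h; apply: nj; exists k.
  suff grow k : (k <= T)%N -> (1 + th) ^+ k * B0 <= B k.
    by have := grow T (leqnn _); have := Ble T (leqnn _); clear -big zeta0; lra.
  elim: k => [_|k IH kT]; first by rewrite expr0 mul1r.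
  have kT' := ltnW kT; have {IH}Bk := IH kT'.
  have p1 : 1 <= (1 + th) ^+ k by rewrite exprn_ege1// lerDl ltW.
  have Bk0 : B0 <= B k by apply: le_trans Bk; rewrite ler_peMl// ltW.
  have Bpos : 0 < B k by exact: lt_le_trans Bk0.
  have Apos : 0 < A k by rewrite AB mulr_gt0.
  have dpos : 0 < dotv (z k) xh by move: Apos; rewrite /A pmulr_lgt0 ?invr_gt0.
  have zk0 : z k != 0 by apply/eqP => zk0; move: dpos; rewrite zk0 dotv0l ltxx.
  have Zk : 0 < enorm (z k) by rewrite enorm_gt0.
  pose w := (enorm x)^-1 *: z k.
  have wE : dotv w xh = A k by rewrite /w dotvZl /A mulrC.
  have nw : enorm w = enorm (z k) / enorm x.
    by rewrite /w enormZ ger0_norm ?invr_ge0 ?(ltW X0)// mulrC.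
  have nw0 : 0 < enorm w by rewrite nw divr_gt0.
  have nw1 : enorm w <= 1 + tau by rewrite nw ler_pdivrMr.
  have sig : \sum_(i in Db k) sgn_corr (dotv (a i) w, dotv (a i) xh) <=
      m%:R * (A k - growth (A k / enorm w) + eps).
    rewrite leNgt; apply/negP => h; apply: (notbad k kT); split; rewrite -/w -/xh ?wE//.
      by apply: (le_trans nw1); clear -tau1 zeta1; lra.
    by rewrite Dm ltW.
  have AS : A k.+1 = A k - mu / m%:R * \sum_(i in Db k) sgn_corr (dotv (a i) w, dotv (a i) xh).
    by rewrite /A zS (gstep_signal a (Db k) mu (z k) xn0) Dm.
  have m0R : 0 < m%:R :> R by rewrite ltr0n.
  have lowA : (1 - mu) * A k + mu * (growth (A k / enorm w) - eps) <= A k.+1.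
    have : mu / m%:R * \sum_(i in Db k) sgn_corr (dotv (a i) w, dotv (a i) xh) <=
      mu / m%:R * (m%:R * (A k - growth (A k / enorm w) + eps)).
      by apply: ler_wpM2l => //; rewrite divr_ge0// ltW.
    have -> : mu / m%:R * (m%:R * (A k - growth (A k / enorm w) + eps)) =
       mu * (A k - growth (A k / enorm w) + eps) by field; rewrite gt_eqF.
    rewrite AS; clear; lra.
  have Bt : B k <= A k / enorm w.
    rewrite /B; apply: ler_wpM2l; first exact: ltW.
    by rewrite lef_pV2 ?posrE.
  have epsk : eps <= zeta * B k / 4000%:R.
    apply: (le_trans epsB); apply: ler_divrn.
    by apply: ler_wpM2l; first exact: ltW.
  have := @growth_step R mu zeta tau eps (A k) (B k) (A k.+1) (A k / enorm w) mu01.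
  rewrite zeta0 zeta1 (ltW tau0) tau1 Bpos (Ble k kT') /= => /(_ isT isT isT Bt epsk (AB k) lowA).
  rewrite -/th AB (AB k.+1) mulrCA ler_pM2l// => h.
  apply: le_trans h; rewrite exprS -mulrA; apply: ler_wpM2l => //; clear -th0; lra.
have near : enorm (z j - x) <= gam * enorm x.
  apply: (@near_target _ _ x (z j) gam zeta tau) => //.
  - by rewrite g0.
  - by rewrite (ltW tau0).
  - have := AB j; rewrite -/xh /A => E.
    have -> : dotv (z j) xh = (1 + tau) * B j * enorm x by rewrite -E divfK// gt_eqF.
    apply: ler_wpM2r; first exact: ltW.
    by apply: ler_wpM2l; apply: ltW.
have r0 : 0 <= 1 - mu / 4 by clear -mu1; lra.
have r1 : 1 - mu / 4 <= 1 by clear -mu0; lra.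
have contr i : enorm (z (j + i)%N - x) <= gam * (1 - mu / 4) ^+ i * enorm x.
  elim: i => [|i IH]; first by rewrite addn0 expr0 mulr1.
  rewrite addnS zS exprS mulrCA -mulrA.
  apply: (le_trans (gstep_contract (D0 _) tau2 (gb _) mu01 _ (excess_const R) xn0 (eb _) _)); first by rewrite ltr0n.
    have h : enorm (z (j + i)%N - x) <= gam * enorm x.
      apply: (le_trans IH); apply: ler_wpM2r; first exact: ltW.
      by rewrite ler_piMr ?(ltW g0)// exprn_ile1.
    exact: (contract_radius (ltW X0) h g1).
  by apply: ler_wpM2l => //; rewrite -mulrA in IH *; rewrite mulrA.
move=> k Tk; have jk : (j <= k)%N by exact: leq_trans Tk.
have := contr (k - j)%N; rewrite subnKC// => /le_trans; apply.
apply: ler_wpM2r; first exact: ltW.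
apply: ler_wpM2l; first exact: ltW.
by apply: ler_wiXn2l => //; rewrite leq_sub2l.
Qed.

End trajectory.

(** * Probability of the bad events *)
Section tails.
Context d (Omega : measurableType d) (R : realType) (P : probability Omega R).
Variables (n N : nat) (a : 'I_N -> Omega -> 'cV[R]_n).
Hypothesis ga : forall i, std_gaussian_vector P (a i).
Hypothesis ia : mutually_independent P a.
Local Notation NN := (@gauss R).
Local Notation RR := (measurableTypeR R * measurableTypeR R)%type.
Variables (D : {set 'I_N}) (eps : R).
Hypothesis eps01 : 0 <= eps <= 1.
Let m : R := #|D|%:R.

Definition tail_value : \bar R := (expR (- (m * eps ^+ 2 / 2 ^+ 18)))%:E.

Lemma tail_sqr_upper (v : 'cV[R]_n) : dotv v v <= 4 ->
  (P [set w | (m * (dotv v v + eps) <= \sum_(i in D) dotv (a i w) v ^+ 2)%R] <= tail_value)%E.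
Proof.
move=> v4; have z4 : dotv (0 : 'cV[R]_n) 0 <= 4 by rewrite dotv0l.
apply: (@block_tail _ _ _ P n N a ga ia D v 0 (fun z => z.1 ^+ 2) (dotv v v) eps v4 z4) => //.
- by apply: measurable_funX; exact: measurable_fst.
- by move=> z; rewrite ger0_norm ?sqr_ge0//; have := sqr_ge0 z.1; have := sqr_ge0 z.2; lra.
move=> p q r p0 r0 pp _; rewrite dotv0l => qr.
have [q0 r00] : q = 0 /\ r = 0.
  have := sqr_ge0 q; have := sqr_ge0 r => r2 q2.
  by split; apply/eqP; rewrite -sqrf_eq0; apply/eqP; lra.
rewrite q0 r00 -pp le_eqVlt; apply/orP; left; apply/eqP.
transitivity (\int[NN]_x \int[NN]_y ((3 * p ^+ 2) * x ^+ 2 + 0 * y ^+ 2)%:E)%E.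
  by apply: eq_integral => x _; apply: eq_integral => y _; congr _%:E; rewrite /=; ring.
rewrite integral2_sqr ?mulr_ge0 ?sqr_ge0//; congr _%:E; ring.
Qed.

(** The opposite of the square is used because [block_tail] is one-sided. *)
Lemma tail_sqr_lower (v : 'cV[R]_n) : dotv v v <= 4 ->
  (P [set w | (m * (- dotv v v + eps) <= \sum_(i in D) - dotv (a i w) v ^+ 2)%R] <= tail_value)%E.
Proof.
move=> v4; have z4 : dotv (0 : 'cV[R]_n) 0 <= 4 by rewrite dotv0l.
apply: (@block_tail _ _ _ P n N a ga ia D v 0 (fun z => - z.1 ^+ 2) (- dotv v v) eps v4 z4) => //.
- by apply: measurableT_comp => //; apply: measurable_funX; exact: measurable_fst.
- by move=> z; rewrite normrN ger0_norm ?sqr_ge0//; have := sqr_ge0 z.1; have := sqr_ge0 z.2; lra.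
move=> p q r p0 r0 pp _; rewrite dotv0l => qr.
have [q0 r00] : q = 0 /\ r = 0.
  have := sqr_ge0 q; have := sqr_ge0 r => r2 q2.
  by split; apply/eqP; rewrite -sqrf_eq0; apply/eqP; lra.
rewrite q0 r00 -pp le_eqVlt; apply/orP; left; apply/eqP.
transitivity (\int[NN]_x \int[NN]_y (p ^+ 2 * x ^+ 2 + 0 * y ^+ 2)%:E)%E.
  by apply: eq_integral => x _; apply: eq_integral => y _; congr _%:E; rewrite /=; ring.
rewrite integral2_sqr ?mulr_ge0 ?sqr_ge0//; congr _%:E; ring.
Qed.

(** The linear form in xh comes first, so that the triangular representation makes
    it a multiple of the first Gaussian variable, as [integral2_excess] requires. *)
Lemma tail_excess (v xh : 'cV[R]_n) : dotv v v <= 4 -> dotv xh xh = 1 ->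
  (P [set w | (m * (100%:R^-1 + eps) <= \sum_(i in D)
     (Num.max (`|dotv (a i w) v| - 602%:R * `|dotv (a i w) xh|) 0) ^+ 2)%R] <= tail_value)%E.
Proof.
move=> v4 x1; have x4 : dotv xh xh <= 4 by rewrite x1; lra.
have mF : measurable_fun setT (fun z : RR => (Num.max (`|z.2| - 602%:R * `|z.1|) 0) ^+ 2 : R).
  apply: measurable_funX; apply: measurable_maxr => //.
  apply: measurable_funB.
    by apply: (measurableT_comp (@normr_measurable R setT)); exact: measurable_snd.
  apply: measurable_funM => //.
  by apply: (measurableT_comp (@normr_measurable R setT)); exact: measurable_fst.
apply: (@block_tail _ _ _ P n N a ga ia D xh v (fun z => (Num.max (`|z.2| - 602%:R * `|z.1|) 0) ^+ 2) 100%:R^-1 eps x4 v4) => //.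
- move=> z; rewrite ger0_norm ?sqr_ge0//.
  have : (Num.max (`|z.2| - 602%:R * `|z.1|) 0) ^+ 2 <= `|z.2| ^+ 2.
    apply: lerXn2r; rewrite ?nnegrE ?le_max ?lexx ?orbT//.
    by rewrite ge_max normr_ge0 andbT gerBl; apply: mulr_ge0; [exact: ler0n|exact: normr_ge0].
  rewrite real_normK ?num_real//; have := sqr_ge0 z.1; have := sqr_ge0 z.2; lra.
move=> p q r p0 r0; rewrite x1 => pp pq qr.
have p1 : p = 1 by apply/eqP; rewrite -(eqrXn2 (n := 2))// pp expr1n.
pose f (z : RR) : R := (Num.max (`|q * z.1 + r * z.2| - 602%:R * `|z.1|) 0) ^+ 2.
pose g (z : RR) : R := 2 * ((p * z.1) ^+ 2 + (q * z.1 + r * z.2) ^+ 2).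
have ml : measurable_fun setT (fun z : RR => p * z.1).
  by apply: measurable_funM => //; exact: measurable_fst.
have mf : measurable_fun setT f.
  have m1 : measurable_fun setT (fun z : RR => z.1) by exact: measurable_fst.
  exact: (measurableT_comp mF (measurable_fun_pair m1 (measurable_lin2 q r))).
have mg : measurable_fun setT g.
  by apply: measurable_funM => //; apply: measurable_funD; apply: measurable_funX => //;
    exact: measurable_lin2.
have g0 z : 0 <= g z by rewrite mulr_ge0// addr_ge0 ?sqr_ge0.
have E := integral2D mf mg (fun z => sqr_ge0 _) g0.
rewrite p1 in g mg g0 E *.
under eq_integral do under eq_integral do rewrite /= mul1r.
have -> : (\int[NN]_x \int[NN]_y ((Num.max (`|q * x + r * y| - 602%:R * `|x|) 0) ^+ 2 +
   2 * (x ^+ 2 + (q * x + r * y) ^+ 2))%:E = \int[NN]_x \int[NN]_y (f (x, y) + g (x, y))%:E)%E.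
  by apply: eq_integral => x _; apply: eq_integral => y _; congr _%:E; rewrite /f /g /= mul1r.
rewrite E EFinD; apply: leeD.
  apply: (le_trans (integral2_excess (q := q) (r := r) (L := 602%:R) _ _)); first lra.
    by rewrite qr.
  by rewrite lee_fin ler_pdivrMr; lra.
rewrite (integral2_sym mg g0) -qr le_eqVlt; apply/orP; left; apply/eqP.
transitivity (\int[NN]_x \int[NN]_y ((2 * (1 + q ^+ 2)) * x ^+ 2 + (2 * r ^+ 2) * y ^+ 2)%:E)%E.
  by apply: eq_integral => x _; apply: eq_integral => y _; congr _%:E; rewrite /g /=; field.
rewrite integral2_sqr ?mulr_ge0 ?addr_ge0 ?sqr_ge0//; congr _%:E; ring.
Qed.

Lemma tail_signal (w0 xh : 'cV[R]_n) : enorm w0 <= 2 -> dotv xh xh = 1 -> 0 < dotv w0 xh ->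
  (P [set w | (m * (dotv w0 xh - growth (dotv w0 xh / enorm w0) + eps) <=
     \sum_(i in D) sgn_corr (dotv (a i w) w0, dotv (a i w) xh))%R] <= tail_value)%E.
Proof.
move=> w2 x1 wx.
have w4 : dotv w0 w0 <= 4.
  by rewrite -enorm_sqr (_ : 4 = 2 ^+ 2 :> R); [apply: lerXn2r; rewrite ?nnegrE ?enorm_ge0|ring].
have x4 : dotv xh xh <= 4 by rewrite x1; lra.
apply: (@block_tail _ _ _ P n N a ga ia D w0 xh _ (dotv w0 xh - growth (dotv w0 xh / enorm w0)) eps w4 x4 (@measurable_sgn_corr R)) => //; first exact: sgn_corr_le.
move=> p q r p0 r0 pp pq; rewrite x1 => qr.
have pE : p = enorm w0.
  by apply/eqP; rewrite -(eqrXn2 (n := 2))// ?enorm_ge0// enorm_sqr pp.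
have w00 : 0 < enorm w0.
  rewrite enorm_gt0; apply/eqP => w00; move: wx; rewrite w00 dotv0l ltxx//.
have p1 : 0 < p by rewrite pE.
have qE : q = dotv w0 xh / enorm w0 by rewrite -pE -pq [p * q]mulrC mulfK// gt_eqF.
have q0 : 0 <= q by rewrite qE divr_ge0// ltW.
rewrite -qE -pq -pp.
exact: integral2_signal.
Qed.

End tails.

Lemma measurable_ler_set d (T : measurableType d) (R : realType) (f g : T -> R) :
  measurable_fun setT f -> measurable_fun setT g -> measurable [set w | f w <= g w].
Proof.
move=> mf mg; have := measurable_fun_ler mf mg measurableT (Y := [set true]) I.
by rewrite setTI; congr measurable; apply/seteqP; split.
Qed.

Lemma measurable_ltr_set d (T : measurableType d) (R : realType) (f g : T -> R) :
  measurable_fun setT f -> measurable_fun setT g -> measurable [set w | f w < g w].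
Proof.
move=> mf mg; have := measurable_fun_ltr mf mg measurableT (Y := [set true]) I.
by rewrite setTI; congr measurable; apply/seteqP; split.
Qed.

(** * Fresh blocks are independent of the current iterate *)
Section iterate_measurability.
Context d (T : measurableType d) (R : realType) (n : nat).
Implicit Types U V : T -> 'cV[R]_n.
Local Notation mvec U := (forall j, measurable_fun setT (fun w => U w j 0)).

Lemma measurable_enorm U : mvec U -> measurable_fun setT (fun w => enorm (U w)).
Proof.
move=> mU; rewrite (_ : (fun w => _) = fun w => dotv (U w) (U w) `^ 2^-1).
  by apply: (measurableT_comp (@measurable_powR R 2^-1)); exact: measurable_dotv.
by apply/funext => w; rewrite powR12_sqrt ?dotv_ge0.
Qed.

Lemma measurable_scale (c : R) U : mvec U -> mvec (fun w => c *: U w).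
Proof.
move=> mU j; rewrite (_ : (fun w => _) = fun w => c * U w j 0).
  exact: measurable_funM.
by apply/funext => w; rewrite mxE.
Qed.

Lemma measurable_signal_bad N (a : 'I_N -> T -> 'cV[R]_n) (D : {set 'I_N}) x eps
    (Z : T -> 'cV[R]_n) :
  (forall i, i \in D -> mvec (a i)) -> mvec Z ->
  measurable [set w | signal_bad (a^~ w) D x eps (Z w)].
Proof.
move=> ma mZ.
pose xh := (enorm x)^-1 *: x; pose W w := (enorm x)^-1 *: Z w.
have mW : mvec W by exact: measurable_scale.
have mc (v : 'cV[R]_n) : mvec (fun _ : T => v) by move=> j.
have mWx : measurable_fun setT (fun w => dotv (W w) xh) by exact: measurable_dotv.
have mnW : measurable_fun setT (fun w => enorm (W w)) by exact: measurable_enorm.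
have mt : measurable_fun setT (fun w => dotv (W w) xh / enorm (W w)).
  apply: measurable_funM => //.
  rewrite (_ : (fun w => _) = fun w => enorm (W w) `^ (-1)).
    exact: (measurableT_comp (@measurable_powR R _) mnW).
  by apply/funext => w; rewrite powR_inv1 ?enorm_ge0.
have mg : measurable_fun setT (fun w => growth (dotv (W w) xh / enorm (W w))).
  rewrite /growth; apply: measurable_funD => //; apply: measurable_funM => //.
  by apply: measurable_minr => //; exact: measurable_funB.
have mS : measurable_fun setT (fun w =>
    \sum_(i in D) sgn_corr (dotv (a i w) (W w), dotv (a i w) xh)).
  under eq_fun do rewrite big_mkcond/=.
  apply: measurable_sum => i; case iD: (i \in D) => //.
  apply: (measurableT_comp (@measurable_sgn_corr R)).
  by apply: measurable_fun_pair; apply: measurable_dotv => //; exact: ma.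
have -> : [set w | signal_bad (a^~ w) D x eps (Z w)] = [set w | 0 < dotv (W w) xh] `&` [set w | enorm (W w) <= 2] `&`
  [set w | #|D|%:R * (dotv (W w) xh - growth (dotv (W w) xh / enorm (W w)) + eps) <=
     \sum_(i in D) sgn_corr (dotv (a i w) (W w), dotv (a i w) xh)].
  apply/seteqP; split=> w; [by case=> ? ? ? | by case=> -[? ?] ? ].
apply: measurableI; first apply: measurableI.
- exact: measurable_ltr_set.
- exact: measurable_ler_set.
apply: measurable_ler_set => //; apply: measurable_funM => //.
by apply: measurable_funD => //; exact: measurable_funB.
Qed.

(** Only the blocks used before step k matter: on the sigma-algebra that they
    generate, the other samples need not be measurable. *)
Lemma measurable_rwf (m K : nat) (mu : R) (blk : 'I_(m * K) -> 'I_K)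
    (a : 'I_(m * K) -> T -> 'cV[R]_n) (z0 : T -> 'cV[R]_n) x k :
  (forall i k', (k' < k)%N -> blk i = (k' %% K)%N :> nat -> mvec (a i)) -> mvec z0 ->
  mvec (fun w => rwf mu blk (a^~ w) (fun i => `|dotv (a i w) x|) (z0 w) k).
Proof.
elim: k => [//|k IH] ma mz.
pose z w := rwf mu blk (a^~ w) (fun i => `|dotv (a i w) x|) (z0 w) k.
have {IH}mk : mvec z.
  by apply: IH => // i k' kk; apply: ma; exact: ltnW.
move=> j /=.
rewrite (_ : (fun w => _) = fun w => z w j 0 - mu / m%:R *
    \sum_(i < m * K | blk i == (k %% K)%N :> nat)
      (`|dotv (a i w) (z w)| - `|dotv (a i w) x|) * Num.sg (dotv (a i w) (z w)) * a i w j 0).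
  apply: measurable_funB => //; apply: measurable_funM => //.
  under eq_fun do rewrite big_mkcond/=.
  apply: measurable_sum => i; case ik: (nat_of_ord (blk i) == (k %% K)%N) => //; move/eqP in ik.
  have mi : mvec (a i) by exact: ma ik.
  have mz' : measurable_fun setT (fun w => dotv (a i w) (z w)) by exact: measurable_dotv.
  have mx : measurable_fun setT (fun w => dotv (a i w) x).
    by apply: measurable_dotv => // j'.
  apply: measurable_funM => //; apply: measurable_funM.
    by apply: measurable_funB; exact: (measurableT_comp (@normr_measurable R setT)).
  exact: (measurableT_comp (@measurable_sgr R)).
apply/funext => w; rewrite !mxE summxE; congr (_ - _ * _).
by apply: eq_bigr => i _; rewrite mxE.
Qed.

End iterate_measurability.

Lemma measurable_on_fst d1 d2 (T1 : measurableType d1) (T2 : measurableType d2)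
    (R : realType) (f : T1 -> R) :
  measurable_fun setT f -> measurable_fun setT (fun p : T1 * T2 => f p.1).
Proof. by move=> mf; apply: (measurableT_comp mf); exact: measurable_fst. Qed.

Lemma measurable_on_snd d1 d2 (T1 : measurableType d1) (T2 : measurableType d2)
    (R : realType) (f : T2 -> R) :
  measurable_fun setT f -> measurable_fun setT (fun p : T1 * T2 => f p.2).
Proof. by move=> mf; apply: (measurableT_comp mf); exact: measurable_snd. Qed.

Section fresh_block.
Context d (Omega : measurableType d) (R : realType) (P : probability Omega R).
Variables (n m K : nat) (blk : 'I_(m * K) -> 'I_K).
Variables (a : 'I_(m * K) -> Omega -> 'cV[R]_n) (z0 : Omega -> 'cV[R]_n).
Hypothesis ga : forall i, std_gaussian_vector P (a i).
Hypothesis ia : mutually_independent P a.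
Hypothesis mz0 : random_vector z0.
Hypothesis iz0 : independent_of_family P z0 a.

(** [None] stands for the starting point, so that it and the samples form a single
    independent family. *)
Definition joint_sigma (o : option 'I_(m * K)) : set (set Omega) :=
  if o is Some i then coord_sigma a i else gen_sigma (fun (j : 'I_n) w => z0 w j 0).

Lemma joint_sigma_family : indep_family P joint_sigma.
Proof.
split.
- by case=> [i|]; exact: (@measurableT _ (g_sigma_algebraType _)).
- by case=> [i|] A B; exact: (@measurableI _ (g_sigma_algebraType _)).
- case=> [i|]; first exact: coord_sigma_measurable.
  apply: (smallest_sub (@sigma_algebra_measurable _ Omega)).
  by move=> _ [j _ [A mA <-]]; exact: mz0.
move=> E GE.
have -> : \bigcap_(o in [set: option 'I_(m * K)]) E o =
    E None `&` \bigcap_(i in [set: 'I_(m * K)]) E (Some i).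
  apply/seteqP; split => w.
    by move=> h; split=> [|i _]; exact: h.
  by move=> [h0 h] [i|] _ //; exact: h.
rewrite (bigD1 None)//= (reindex_omap Some id)/=; last by case.
rewrite (iz0 (GE None)); last first.
  apply: (@fin_bigcap_measurable _ (g_sigma_algebraType _)) => // i _.
  have := GE (Some i); apply: sub_sigma_algebra2.
  by move=> A [j _ Aj]; exists (i, j).
congr (_ * _)%E; rewrite (ia (E := fun i => E (Some i))) => [|i]; last exact: (GE (Some i)).
by apply: eq_bigl => i; rewrite eqxx.
Qed.

Variables (mu : R) (x : 'cV[R]_n).

Definition iterate k w := rwf mu blk (a^~ w) (fun i => `|dotv (a i w) x|) (z0 w) k.

Definition block k : {set 'I_(m * K)} := [set i | nat_of_ord (blk i) == (k %% K)%N]%SET.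

(** For k < K the iterate is a function of the starting point and of the blocks
    before k; conditioning on these, [tail_signal] applies to a fixed z. *)
Lemma signal_bad_prob (k : nat) (x' : 'cV[R]_n) (eps : R) : (k < K)%N -> x' != 0 ->
  0 <= eps <= 1 ->
  (P [set w | signal_bad (a^~ w) (block k) x' eps (iterate k w)] <=
    tail_value (block k) eps)%E.
Proof.
move=> kK xn0 eps01; set D := block k.
pose S1 : set (option 'I_(m * K)) := [set o | if o is Some i then i \notin D else true].
pose S2 : set (option 'I_(m * K)) := [set o | if o is Some i then i \in D else false].
have S12 : S1 `&` S2 = set0.
  by rewrite -subset0 => -[i|] [] //; rewrite /S1 /S2 /= => /negP.
have fam := joint_sigma_family; have [_ _ Gm _] := fam.
have sm S : sub_family joint_sigma S `<=` measurable.
  by move=> A [i0 _]; exact: Gm.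
have ind := indep_sub_family fam S12.
have m2 i (iD : i \in D) j : measurable_fun setT
    ((fun w => a i w j 0) : g_sigma_algebraType (sub_family joint_sigma S2) -> R).
  move=> _ A mA; rewrite setTI; apply: sub_sigma_algebra; exists (Some i) => //.
  by apply: sub_sigma_algebra; exists j => //; exists A => //; rewrite setTI.
have m1 j : measurable_fun setT
    ((fun w => iterate k w j 0) : g_sigma_algebraType (sub_family joint_sigma S1) -> R).
  apply: (@measurable_rwf _ (g_sigma_algebraType (sub_family joint_sigma S1)) R n m K mu blk a z0).
    move=> i k' kk ik j' _ A mA; rewrite setTI; apply: sub_sigma_algebra; exists (Some i).
      rewrite /S1 /= inE ik !modn_small//; last exact: ltn_trans kK.
      by rewrite neq_ltn kk.
    by apply: sub_sigma_algebra; exists j' => //; exists A => //; rewrite setTI.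
  move=> j' _ A mA; rewrite setTI; apply: sub_sigma_algebra; exists None => //.
  by apply: sub_sigma_algebra; exists j' => //; exists A => //; rewrite setTI.
pose B := [set p : g_sigma_algebraType (sub_family joint_sigma S1) *
    g_sigma_algebraType (sub_family joint_sigma S2) |
  signal_bad (a^~ p.2) D x' eps (iterate k p.1)].
apply: (@indep_section_le _ _ _ P _ _ (sm S1) (sm S2) ind B).
  apply: (@measurable_signal_bad _ (g_sigma_algebraType (sub_family joint_sigma S1) *
      g_sigma_algebraType (sub_family joint_sigma S2))%type R n _ (fun i p => a i p.2) D x' eps (fun p => iterate k p.1)).
    by move=> i iD j; exact: (measurable_on_snd (m2 i iD j)).
  by move=> j; exact: (measurable_on_fst (m1 j)).
move=> w; rewrite /B /=.
set z := iterate k w; pose xh := (enorm x')^-1 *: x'; pose v := (enorm x')^-1 *: z.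
have X0 : 0 < enorm x' by rewrite enorm_gt0.
have x1 : dotv xh xh = 1.
  by rewrite /xh dotvZl dotvZr -enorm_sqr expr2 mulKf ?mulVf ?gt_eqF.
have [vx|vx] := boolP (0 < dotv v xh); last first.
  rewrite (_ : [set _ | _] = set0) ?measure0 ?lee_fin ?expR_ge0//.
  by rewrite -subset0 => u [] h; rewrite -/v -/xh h in vx.
have [nv|nv] := boolP (enorm v <= 2); last first.
  rewrite (_ : [set _ | _] = set0) ?measure0 ?lee_fin ?expR_ge0//.
  by rewrite -subset0 => u [_ h]; rewrite -/v h in nv.
apply: le_trans (tail_signal ga ia D eps01 nv x1 vx).
rewrite le_eqVlt; apply/orP; left; apply/eqP; congr (P _).
by apply/seteqP; split => u; [case=> _ _|move=> h; split].
Qed.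

End fresh_block.

(** * Union bounds *)
Section small_events.
Context d (Omega : measurableType d) (R : realType) (P : probability Omega R).
Implicit Types (E : set Omega) (p : R).

(** A bound on the outer probability, so that bad events can be combined without
    proving them measurable. *)
Definition small_event E p :=
  exists B, [/\ measurable B, E `<=` B & (P B <= p%:E)%E].

Lemma small_event_sub E E' p p' : E `<=` E' -> p' <= p -> small_event E' p' -> small_event E p.
Proof.
move=> EE pp [B [mB EB PB]]; exists B; split => //; first exact: subset_trans EB.
by apply: (le_trans PB); rewrite lee_fin.
Qed.

Lemma small_event0 : small_event set0 0.
Proof. by exists set0; split => //; rewrite measure0. Qed.

Lemma small_eventU E1 E2 p1 p2 :
  small_event E1 p1 -> small_event E2 p2 -> small_event (E1 `|` E2) (p1 + p2).
Proof.
move=> [B1 [m1 s1 l1]] [B2 [m2 s2 l2]]; exists (B1 `|` B2); split.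
- exact: measurableU.
- exact: setUSS.
- by rewrite EFinD; apply: (le_trans (measureU2 _ m1 m2)); exact: leeD.
Qed.

Lemma small_event_bigcup (J : finType) (E : J -> set Omega) p :
  (forall j, small_event (E j) p) -> small_event (\bigcup_j E j) (#|J|%:R * p).
Proof.
move=> sE.
suff h (s : seq J) : small_event (\bigcup_(j in [set` s]) E j) ((size s)%:R * p).
  rewrite cardE; have := h (enum J); apply: small_event_sub => //.
  by move=> w [j _ Ej]; exists j => //=; rewrite mem_enum.
elim: s => [|j s IH].
  rewrite mul0r; apply: small_event_sub small_event0 => //.
  by move=> w [].
apply: small_event_sub (small_eventU (sE j) IH).
  move=> w [i /=]; rewrite in_cons => /orP[/eqP ->|si Ei]; first by left.
  by right; exists i.
by rewrite /= -natr1 mulrDl mul1r addrC.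
Qed.

Lemma small_event_compl (S : set Omega) p :
  measurable S -> small_event (~` S) p -> ((1 - p)%:E <= P S)%E.
Proof.
move=> mS [B [mB SB PB]].
have BS : ~` B `<=` S by rewrite -[S]setCK; exact: subsetC.
apply: (@le_trans _ _ (P (~` B))); last by apply: le_measure; rewrite ?inE//; exact: measurableC.
rewrite probability_setC//; have fB : P B \is a fin_num by exact: fin_num_measure.
by move: PB; rewrite -(fineK fB) lee_fin -EFinB lee_fin => h; lra.
Qed.

End small_events.

Section failure.
Context d (Omega : measurableType d) (R : realType) (P : probability Omega R).
Variables (n m K : nat) (blk : 'I_(m * K) -> 'I_K).
Variables (a : 'I_(m * K) -> Omega -> 'cV[R]_n) (z0 : Omega -> 'cV[R]_n).
Hypothesis ga : forall i, std_gaussian_vector P (a i).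
Hypothesis ia : mutually_independent P a.

Let mdot i v : measurable_fun setT (fun w => dotv (a i w) v).
Proof. by apply: measurable_dotv => // j; exact: (ga i).1. Qed.

(** Three one-sided tails for each grid vector of norm at most 2. *)
Lemma grid_failure (D : {set 'I_(m * K)}) (q : nat) (delta : R) (xh : 'cV[R]_n) :
  0 <= delta <= 1 -> dotv xh xh = 1 ->
  small_event P [set w | ~ grid_good (a^~ w) D q delta xh]
    (((n * q).*2.+1 ^ n)%:R * (3 * expR (- (#|D|%:R * delta ^+ 2 / 2 ^+ 18)))).
Proof.
move=> d01 x1; set p := expR _.
have p0 : 0 <= p by exact: expR_ge0.
rewrite -[((n * q).*2.+1)]card_ord -[n in (_ ^ n)%N]card_ord -card_ffun.
pose F (k : {ffun 'I_n -> 'I_(n * q).*2.+1}) : set Omega :=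
  [set w | dotv (grid_vec k) (grid_vec k) <= (4 : R) /\ ~
    [/\ \sum_(i in D) dotv (a i w) (grid_vec k) ^+ 2 <=
          #|D|%:R * (dotv (grid_vec k) (grid_vec k) + delta),
        #|D|%:R * (dotv (grid_vec k) (grid_vec k) - delta) <=
          \sum_(i in D) dotv (a i w) (grid_vec k) ^+ 2 &
        \sum_(i in D) (Num.max (`|dotv (a i w) (grid_vec k)| -
             602%:R * `|dotv (a i w) xh|) 0) ^+ 2 <= #|D|%:R * (100%:R^-1 + delta)]].
have sF k : small_event P (F k) (3 * p).
  rewrite /F; set v : 'cV[R]_n := grid_vec k.
  have [v4|v4] := boolP (dotv v v <= 4); last first.
    apply: small_event_sub (small_event0 P); last by rewrite mulr_ge0.
    by move=> w [].
  have m1 : measurable_fun setT (fun w => \sum_(i in D) dotv (a i w) v ^+ 2).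
    under eq_fun do rewrite big_mkcond/=.
    apply: measurable_sum => i; case: (i \in D) => //.
    by apply: measurable_funX; exact: mdot.
  have m2 : measurable_fun setT (fun w => \sum_(i in D) - dotv (a i w) v ^+ 2).
    by under eq_fun do rewrite sumrN; exact: measurableT_comp.
  have m3 : measurable_fun setT (fun w => \sum_(i in D) (Num.max (`|dotv (a i w) v| -
             602%:R * `|dotv (a i w) xh|) 0) ^+ 2).
    under eq_fun do rewrite big_mkcond/=.
    apply: measurable_sum => i; case: (i \in D) => //.
    apply: measurable_funX; apply: measurable_maxr => //; apply: measurable_funB.
      by apply: (measurableT_comp (@normr_measurable R setT)).
    by apply: measurable_funM => //; apply: (measurableT_comp (@normr_measurable R setT)).
  have -> : 3 * p = p + (p + p) by ring.
  apply: (@small_event_sub _ _ _ _ _ ([set w | #|D|%:R * (dotv v v + delta) <=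
       \sum_(i in D) dotv (a i w) v ^+ 2] `|`
     ([set w | #|D|%:R * (- dotv v v + delta) <= \sum_(i in D) - dotv (a i w) v ^+ 2] `|`
      [set w | #|D|%:R * (100%:R^-1 + delta) <= \sum_(i in D)
         (Num.max (`|dotv (a i w) v| - 602%:R * `|dotv (a i w) xh|) 0) ^+ 2])) _ (p + (p + p))) => //.
    move=> w [_]; apply: contraPP => /not_orP[/negP h1 /not_orP[/negP h2 /negP h3]]; apply.
    move: h1 h2 h3; rewrite -!ltNge => /ltW h1 /ltW h2 /ltW h3; split => //.
    by move: h2; rewrite sumrN; lra.
  apply: small_eventU; last apply: small_eventU.
  - eexists; split; [|exact: subset_refl|exact: (tail_sqr_upper ga ia D d01 v4)].
    exact: measurable_ler_set.
  - eexists; split; [|exact: subset_refl|exact: (tail_sqr_lower ga ia D d01 v4)].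
    exact: measurable_ler_set.
  - eexists; split; [|exact: subset_refl|exact: (tail_excess ga ia D d01 v4 x1)].
    exact: measurable_ler_set.
apply: small_event_sub (small_event_bigcup sF) => // w /= bad.
apply: contrapT => nF; apply: bad => k v4; apply: contrapT => h.
by apply: nF; exists k.
Qed.

Hypothesis mz0 : random_vector z0.
Hypothesis iz0 : independent_of_family P z0 a.
Variables (mu : R) (x : 'cV[R]_n).
Local Notation z k w := (iterate blk a z0 mu x k w).
Local Notation block := (block blk).

Lemma signal_failure (k : nat) (x' : 'cV[R]_n) (eps : R) : (k < K)%N -> x' != 0 ->
  0 <= eps <= 1 ->
  small_event P [set w | signal_bad (a^~ w) (block k) x' eps (z k w)]
    (expR (- (#|block k|%:R * eps ^+ 2 / 2 ^+ 18))).
Proof.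
move=> kK x0 e01; eexists; split; [|exact: subset_refl|exact: signal_bad_prob].
apply: (@measurable_signal_bad _ Omega R n _ a).
  by move=> i _ j; exact: (ga i).1.
by apply: (@measurable_rwf _ Omega R n m K mu blk a z0) => // i k' _ _ j; exact: (ga i).1.
Qed.

(** The Gram and excess bounds are required of all K blocks, since these are reused
    for ever; the signal only matters before T, but for both signs of x because
    the sign of the initial correlation is random. *)
Lemma failure (T q : nat) (delta eps : R) : (0 < K)%N -> (T <= K)%N -> x != 0 ->
  (forall k, #|block k| = m) -> 0 <= delta <= 1 -> 0 <= eps <= 1 ->
  small_event P [set w | ~ ((forall k, grid_good (a^~ w) (block k) q delta ((enorm x)^-1 *: x)) /\
      forall k, (k < T)%N -> ~ signal_bad (a^~ w) (block k) x eps (z k w) /\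
         ~ signal_bad (a^~ w) (block k) (- x) eps (z k w))]
    (K%:R * (((n * q).*2.+1 ^ n)%:R * (3 * expR (- (m%:R * delta ^+ 2 / 2 ^+ 18)))) +
     T%:R * (2 * expR (- (m%:R * eps ^+ 2 / 2 ^+ 18)))).
Proof.
move=> K0 TK x0 bm d01 e01.
have X0 : 0 < enorm x by rewrite enorm_gt0.
have x1 : dotv ((enorm x)^-1 *: x) ((enorm x)^-1 *: x) = 1.
  by rewrite dotvZl dotvZr -enorm_sqr expr2 mulKf ?mulVf ?gt_eqF.
have g (t : 'I_K) : small_event P
    [set w | ~ grid_good (a^~ w) (block t) q delta ((enorm x)^-1 *: x)]
    (((n * q).*2.+1 ^ n)%:R * (3 * expR (- (m%:R * delta ^+ 2 / 2 ^+ 18)))).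
  by have := grid_failure (block t) q d01 x1; rewrite bm.
have s (k : 'I_T) : small_event P
    ([set w | signal_bad (a^~ w) (block k) x eps (z k w)] `|`
     [set w | signal_bad (a^~ w) (block k) (- x) eps (z k w)])
    (2 * expR (- (m%:R * eps ^+ 2 / 2 ^+ 18))).
  have kK : (k < K)%N by exact: leq_trans TK.
  have xN0 : - x != 0 by rewrite oppr_eq0.
  have := small_eventU (signal_failure kK x0 e01) (signal_failure kK xN0 e01).
  by rewrite bm; set p := expR _; rewrite (_ : 2 * p = p + p)//; ring.
have := small_eventU (small_event_bigcup g) (small_event_bigcup s).
rewrite !card_ord; apply: small_event_sub => // w /= bad.
apply: contrapT => /not_orP[ng ns]; apply: bad; split.
  move=> k; apply: contrapT => h; apply: ng.
  have kE : block (k %% K)%N = block k by apply/setP => i; rewrite !inE modn_mod.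
  by exists (Ordinal (ltn_pmod k K0)) => //=; rewrite kE.
move=> k kT; split => h; apply: ns; exists (Ordinal kT) => //; [left|right]; exact: h.
Qed.

End failure.

Lemma margin_small (R : realType) (gam zeta tau : R) : 0 < gam <= 1204%:R^-1 ->
  zeta = gam ^+ 2 / 8 -> 0 < tau <= zeta / 4000%:R -> 0 < tau / 20%:R <= 100%:R^-1.
Proof.
move=> /andP[g0 g1] zE /andP[t0 t1].
have g2 : gam ^+ 2 <= 1 by rewrite expr_le1 ?(ltW g0)//; clear -g1; lra.
have z1 : zeta / 4000%:R <= 1 / 4000%:R.
  by apply: ler_divrn; rewrite zE; clear -g2; lra.
by apply/andP; clear -t0 t1 z1; split; lra.
Qed.

Section success.
Context {R : realType} {n m K : nat}.
Variables (blk : 'I_(m * K) -> 'I_K) (a : 'I_(m * K) -> 'cV[R]_n) (z0 x : 'cV[R]_n).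
Variables (mu gam zeta tau eps B0 : R) (q T : nat).
Local Notation block := (block blk).
Local Notation z k := (rwf mu blk a (fun i => `|dotv (a i) x|) z0 k).
Hypotheses (n0 : (0 < n)%N) (m0 : (0 < m)%N) (q0 : (0 < q)%N).
Hypothesis bm : forall k, #|block k| = m.
Hypotheses (mu01 : 0 < mu <= 2^-1) (xn0 : x != 0).
Hypotheses (gam01 : 0 < gam <= 1204%:R^-1) (zetaE : zeta = gam ^+ 2 / 8).
Hypothesis tau01 : 0 < tau <= zeta / 4000%:R.

Lemma rwf_gstep k x' : x' = x \/ x' = - x -> z k.+1 = gstep a (block k) mu x' (z k).
Proof.
move=> xx /=; rewrite /gstep bm; congr (_ - _ *: _).
apply: eq_big => [i|i _]; first by rewrite inE.
by case: xx => ->; rewrite ?dotvNr ?normrN.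
Qed.

Lemma excess_boundN D L e y : excess_bound a D L e (- y) = excess_bound a D L e y.
Proof.
rewrite /excess_bound; apply: eq_forall => u.
by congr (_ <= _); apply: eq_l2 => i _; rewrite dotvNr normrN.
Qed.

(** The step does not distinguish x from - x, so [trajectory] is applied to the one
    that has nonnegative correlation with the starting point. *)
Lemma success : 8 <= tau / 20%:R * q%:R ->
  (forall k, grid_good a (block k) q ((tau / 20%:R / 4) ^+ 2) ((enorm x)^-1 *: x)) ->
  (forall k, (k < T)%N -> ~ signal_bad a (block k) x eps (z k) /\
                          ~ signal_bad a (block k) (- x) eps (z k)) ->
  enorm z0 <= (1 + tau) * enorm x ->
  0 < B0 -> (1 + tau) * B0 * enorm x <= `|dotv z0 ((enorm x)^-1 *: x)| ->
  eps <= zeta * B0 / 4000%:R -> 1 <= (1 + mu * zeta / 4000%:R) ^+ T * B0 ->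
  forall k, (T <= k)%N ->
    distpm (z k) x <= gam * (1 - mu / 4) ^+ (k - T) * enorm x.
Proof.
move=> tq gg nb zn B00 zB eB big k Tk.
have X0 : 0 < enorm x by rewrite enorm_gt0.
have t01 := margin_small gam01 zetaE tau01.
have D0 t : (0 < #|block t|)%N by rewrite bm.
have net t := net_bounds (D0 t) n0 q0 t01 tq erefl (gg t).
have main x' : x' = x \/ x' = - x -> 0 <= dotv z0 ((enorm x)^-1 *: x') ->
    enorm (z k - x') <= gam * (1 - mu / 4) ^+ (k - T) * enorm x.
  move=> xx s0; have nx : enorm x' = enorm x by case: xx => ->; rewrite ?enormN.
  have := @trajectory R n _ a block m T x' (fun k => z k) mu gam zeta tau eps B0 m0 bm mu01.
  rewrite nx; apply => //.
  - by rewrite -enorm_gt0 nx.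
  - by move=> t; exact: rwf_gstep.
  - by move=> t; have [] := net t.
  - move=> t; have [_] := net t.
    by case: xx => ->//; rewrite scalerN excess_boundN.
  - rewrite -(ger0_norm s0); suff -> : `|dotv z0 ((enorm x)^-1 *: x')| =
      `|dotv z0 ((enorm x)^-1 *: x)| by [].
    by case: xx => ->//; rewrite scalerN dotvNr normrN.
  - by move=> t tT; have [? ?] := nb t tT; case: xx => ->.
have [s|s] := leP 0 (dotv z0 ((enorm x)^-1 *: x)).
  by rewrite /distpm ge_min (main x)//; left.
rewrite /distpm ge_min; apply/orP; right; rewrite -[x in _ + x]opprK.
by apply: main; [right|rewrite scalerN dotvNr oppr_ge0 ltW].
Qed.

End success.

(** * Constants *)
Section constants.
Context {R : realType}.
Implicit Types (theta l s r : R).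

Lemma natr_expR (k : nat) : (0 < k)%N -> k%:R = expR (ln k%:R) :> R.
Proof. by move=> k0; rewrite lnK// posrE ltr0n. Qed.

Lemma le_expR l : l <= expR l.
Proof. by have := expR_ge1Dx l; lra. Qed.

Lemma growth_expR theta : 0 <= theta <= 1 -> expR (theta / 2) <= 1 + theta.
Proof.
move=> /andP[t0 t1]; have h := expR_ge1Dx (- (theta / 2)).
have e0 := expR_gt0 (theta / 2).
have : (1 - theta / 2) * expR (theta / 2) <= 1.
  apply: (@le_trans _ _ (expR (- (theta / 2)) * expR (theta / 2))).
    by apply: ler_wpM2r; [exact: ltW|lra].
  by rewrite -expRD addNr expR0.
have : 1 <= (1 + theta) * (1 - theta / 2) by nra.
nra.
Qed.

(** (1 + theta)^T >= exp (theta T / 2) >= exp (2 l), which beats 4 r s because both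
    4 r and s are at most exp l. *)
Lemma phase_length theta l s r (T : nat) : 0 < theta <= 1 -> 0 < r -> 0 < s ->
  4 * r <= l -> s <= expR l -> 4 * l / theta <= T%:R ->
  1 <= (1 + theta) ^+ T * (4 * r * s)^-1.
Proof.
move=> /andP[t0 t1] r0 s0 rl sl Tl.
have rs0 : 0 < 4 * r * s by rewrite !mulr_gt0.
rewrite ler_pdivlMr// mul1r.
apply: (@le_trans _ _ (expR l * expR l)).
  by apply: ler_pM; rewrite ?mulr_ge0 ?(ltW r0) ?(ltW s0)//; exact: le_trans (le_expR l).
rewrite -expRD; apply: (@le_trans _ _ (expR (theta / 2) ^+ T)); last first.
  by apply: lerXn2r; rewrite ?nnegrE ?expR_ge0 ?growth_expR ?(ltW t0)//; lra.
rewrite -expRM_natl ler_expR.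
by move: Tl; rewrite ler_pdivrMr//; lra.
Qed.

(** Each grid coordinate takes at most 3 n q <= n^2 values, so the grid has at most
    exp (2 n l) points, against exp (- 4 n l). *)
Lemma grid_term (n q K : nat) (C0 M : R) : (0 < n)%N -> (0 < q)%N ->
  let l := ln (n%:R : R) in
  1 <= l -> 3 * q%:R <= l -> 0 <= C0 -> K%:R <= C0 * l + 1 -> 4 * (n%:R * l) <= M ->
  K%:R * (((n * q).*2.+1 ^ n)%:R * (3 * expR (- M))) <= 3 * (C0 + 1) * expR (- n%:R).
Proof.
move=> n0 q0 l l1 ql C00 Kl lM.
have nE : n%:R = expR l by exact: natr_expR.
have n1 : 1 <= n%:R :> R by rewrite ler1n.
have q1 : 1 <= q%:R :> R by rewrite ler1n.
have ln : l <= n%:R by rewrite nE le_expR.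
have g1 : ((n * q).*2.+1)%:R <= expR (2 * l).
  have -> : 2 * l = l + l by ring.
  rewrite expRD -nE -natr1 -muln2 !natrM.
  apply: (@le_trans _ _ (n%:R * (3 * q%:R))); first by nra.
  by apply: ler_wpM2l => //; exact: le_trans ql ln.
have g2 : (((n * q).*2.+1 ^ n)%:R : R) <= expR (n%:R * (2 * l)).
  by rewrite natrX expRM_natl; apply: lerXn2r; rewrite ?nnegrE ?expR_ge0.
have g3 : K%:R <= (C0 + 1) * expR l.
  rewrite -nE; apply: (le_trans Kl); apply: (@le_trans _ _ ((C0 + 1) * l)); first by lra.
  by apply: ler_wpM2l => //; lra.
apply: (@le_trans _ _ ((C0 + 1) * expR l * (expR (n%:R * (2 * l)) * (3 * expR (- M))))).
  apply: ler_pM g3 _; [exact: ler0n|by rewrite mulr_ge0// mulr_ge0// expR_ge0|].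
  by apply: ler_wpM2r => //; rewrite mulr_ge0// expR_ge0.
have -> : (C0 + 1) * expR l * (expR (n%:R * (2 * l)) * (3 * expR (- M))) =
  3 * (C0 + 1) * expR (l + n%:R * (2 * l) - M) by rewrite !expRD; ring.
apply: ler_wpM2l; first by lra.
rewrite ler_expR; nra.
Qed.

(** One of the eleven powers of m is spent on the number T of steps. *)
Lemma signal_term (m T : nat) (c' l M : R) : (0 < m)%N ->
  0 <= c' -> T%:R <= c' * l -> l <= m%:R -> 11%:R * ln m%:R <= M ->
  T%:R * (2 * expR (- M)) <= 2 * c' * m%:R ^- 10.
Proof.
move=> m0 c0 Tl lm LM; set L := ln m%:R in LM.
have mE : m%:R = expR L by exact: natr_expR.
have mX : m%:R ^- 10 = expR (- (10%:R * L)).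
  by rewrite expRN expRM_natl -mE.
apply: (@le_trans _ _ (c' * expR L * (2 * expR (- (11%:R * L))))).
  apply: ler_pM; [exact: ler0n|by rewrite mulr_ge0// expR_ge0| |].
    by apply: (le_trans Tl); apply: ler_wpM2l => //; rewrite -mE.
  by apply: ler_wpM2l => //; rewrite ler_expR lerN2.
have -> : c' * expR L * (2 * expR (- (11%:R * L))) = 2 * c' * expR (L - 11%:R * L).
  by rewrite expRD; ring.
by rewrite mX le_eqVlt; apply/orP; left; apply/eqP; congr (_ * expR _); ring.
Qed.

(** Sample size needed by [grid_term]; X stands for n log n and D for the square of
    the grid tolerance. *)
Lemma sample_grid (W D C X L m : R) : 0 < W -> 0 < D -> 0 <= X -> 1 <= L ->
  4 * W / D <= C -> C * X * L <= m -> 4 * X <= m * D / W.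
Proof.
move=> W0 D0 X0 L1; rewrite ler_pdivrMr// => WC CX; rewrite ler_pdivlMr//.
have h1 : X * (4 * W) <= X * (C * D) by apply: ler_wpM2l.
have C0 : 0 <= C * D by apply: le_trans WC; rewrite mulr_ge0// ltW.
have h2 : X * (C * D) * 1 <= X * (C * D) * L by apply: ler_wpM2l => //; rewrite mulr_ge0.
have h3 : C * X * L * D <= m * D by apply: ler_wpM2r => //; exact: ltW.
by lra.
Qed.

(** The fluctuation eps = tau / (4 r s) with s^2 = X = n log n turns m eps^2 into a
    multiple of m / X, which is why m must exceed X by a power of log m. *)
Lemma sample_signal (W C X L m r tau s : R) : 0 < W -> 0 < X -> 0 < r -> 0 < tau ->
  s ^+ 2 = X -> 0 < s -> 1 <= L ->
  11%:R * W * (16 * r ^+ 2) / tau ^+ 2 <= C -> C * X * L ^+ 3 <= m ->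
  11%:R * L <= m * (tau * (4 * r * s)^-1) ^+ 2 / W.
Proof.
move=> W0 X0 r0 t0 sX s0 L1; rewrite ler_pdivrMr ?exprn_gt0// => WC CX.
have -> : m * (tau * (4 * r * s)^-1) ^+ 2 / W = m * tau ^+ 2 / (16 * r ^+ 2 * X * W).
  rewrite -sX; field; by rewrite !gt_eqF.
have d0 : 0 < 16 * r ^+ 2 * X * W by rewrite !mulr_gt0// exprn_gt0.
rewrite ler_pdivlMr//.
have L3 : L <= L ^+ 3 by rewrite -[leLHS]expr1; apply: ler_weXn2l.
have h1 : 11%:R * W * (16 * r ^+ 2) * (X * L ^+ 3) <= C * tau ^+ 2 * (X * L ^+ 3).
  by apply: ler_wpM2r => //; rewrite mulr_ge0 ?(ltW X0)// exprn_ge0//; lra.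
have h2 : C * X * L ^+ 3 * tau ^+ 2 <= m * tau ^+ 2 by apply: ler_wpM2r => //; rewrite sqr_ge0.
have h3 : 11%:R * W * (16 * r ^+ 2) * X * L <= 11%:R * W * (16 * r ^+ 2) * X * L ^+ 3.
  apply: ler_wpM2l => //.
  have r2 : 0 <= 16 * r ^+ 2 by rewrite mulr_ge0// sqr_ge0.
  by apply: mulr_ge0 (ltW X0); apply: mulr_ge0 r2; apply: mulr_ge0 (ltW W0); exact: ler0n.
have -> : 11%:R * L * (16 * r ^+ 2 * X * W) = 11%:R * W * (16 * r ^+ 2) * X * L by ring.
apply: (le_trans h3); apply: le_trans h2; move: h1; congr (_ <= _); ring.
Qed.

End constants.

(** * Assembling the estimate *)
Lemma measurable_target d (T : measurableType d) (R : realType) (n m K : nat) (mu : R)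
    (blk : 'I_(m * K) -> 'I_K) (a : 'I_(m * K) -> T -> 'cV[R]_n) (z0 : T -> 'cV[R]_n) x
    (N : nat) (bound : nat -> R) :
  (forall i, random_vector (a i)) -> random_vector z0 ->
  measurable [set w | forall k : nat, (N <= k)%N ->
    distpm (rwf mu blk (a^~ w) (fun i => `|dotv (a i w) x|) (z0 w) k) x <= bound k].
Proof.
move=> ma mz.
have -> : [set w | forall k : nat, (N <= k)%N ->
    distpm (rwf mu blk (a^~ w) (fun i => `|dotv (a i w) x|) (z0 w) k) x <= bound k] =
  \bigcap_k [set w | (N <= k)%N ->
    distpm (rwf mu blk (a^~ w) (fun i => `|dotv (a i w) x|) (z0 w) k) x <= bound k].
  by apply/seteqP; split => w h k; [move=> _; exact: h|exact: (h k I)].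
apply: bigcapT_measurable => k; case Nk: (N <= k)%N; last first.
  by rewrite (_ : [set w | _] = setT)//; apply/seteqP; split.
rewrite (_ : [set w | _] = [set w | distpm (rwf mu blk (a^~ w)
    (fun i => `|dotv (a i w) x|) (z0 w) k) x <= bound k]); last first.
  by apply/seteqP; split => w; [exact|move=> h _].
apply: measurable_ler_set => //.
have mk := @measurable_rwf _ T R n m K mu blk a z0 x k (fun i _ _ _ => ma i) mz.
apply: measurable_minr; apply: measurable_enorm => j.
  by under eq_fun do rewrite !mxE; exact: measurable_funB.
by under eq_fun do rewrite !mxE; exact: measurable_funD.
Qed.

(** The lower bounds on log n and log m make the constants above effective; B0 is
    half of the lower bound for the initial correlation <z, x> / |x|^2 obtained from
    |x| <= r, which leaves room for the factor 1 + tau. *)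
Lemma high_probability (R : realType) (mu gam r zeta tau theta C0 C : R) (q : nat) :
  0 < mu <= 2^-1 -> 0 < gam <= 1204%:R^-1 -> 0 < r -> zeta = gam ^+ 2 / 8 ->
  tau = zeta / 4000%:R -> theta = mu * zeta / 4000%:R -> (0 < q)%N ->
  8 <= tau / 20%:R * q%:R -> 4 / theta + 4 <= C0 ->
  4 * 2 ^+ 18 / ((tau / 20%:R / 4) ^+ 2) ^+ 2 <= C ->
  11%:R * 2 ^+ 18 * (16 * r ^+ 2) / tau ^+ 2 <= C -> 1 <= C ->
  forall (n m K : nat) (x : 'cV[R]_n)
    (d : measure_display) (Omega : measurableType d) (P : probability Omega R)
    (blk : 'I_(m * K) -> 'I_K)
    (a : 'I_(m * K) -> Omega -> 'cV[R]_n) (y : 'I_(m * K) -> Omega -> R)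
    (z0 : Omega -> 'cV[R]_n),
  let logn := ln (n%:R : R) in
  let logm := ln (m%:R : R) in
  (1 < n)%N -> (0 < m)%N ->
  x != 0 -> enorm x <= r ->
  (0 < K)%N -> `|K%:R - C0 * logn| < 1 ->
  (forall t : 'I_K, #|[set i | blk i == t]%SET| = m) ->
  (forall i, std_gaussian_vector P (a i)) ->
  mutually_independent P a ->
  (forall i w, y i w = `|dotv (a i w) x|) ->
  random_vector z0 ->
  independent_of_family P z0 a ->
  {ae P, forall w,
    [/\ (2 * Num.sqrt (n%:R * logn))^-1 <= `|dotv (z0 w) x| / enorm x,
        (1 - logn^-1) * enorm x <= enorm (z0 w)
      & enorm (z0 w) <= (1 + logn^-1) * enorm x]} ->
  C * n%:R * logn * logm ^+ 3 <= m%:R ->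
  tau^-1 <= logn -> 4 * r <= logn -> (4 * r)^-1 <= logn -> 3 * q%:R <= logn ->
  1 <= logn -> 1 <= logm ->
  exists T : nat, (T%:R : R) <= (4 / theta + 1) * logn /\
    ((1 - (3 * (C0 + 1) * expR (- n%:R) + 2 * (4 / theta + 1) * m%:R ^- 10))%:E <=
     P [set w | forall k : nat, (T <= k)%N ->
         (distpm (rwf mu blk (a^~ w) (y^~ w) (z0 w) k) x <=
          gam * (1 - mu / 4) ^+ (k - T) * enorm x)%R])%E.
Proof.
move=> mu01 gam01 r0 zetaE tauE thetaE q0 tq C0ge C1 C2 C3.
move=> n m K x d Omega P blk a y z0 l L n1 m0 xn0 xr K0 KC bm ga ia yE mz0 iz0 ini mC.
move=> l_tau l_r l_r' l_q l1 L1.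
have n0 : (0 < n)%N by exact: ltnW.
have X0 : 0 < enorm x by rewrite enorm_gt0.
have /andP[mu0 mu1] := mu01.
have zeta0 : 0 < zeta by rewrite zetaE; rewrite divr_gt0// exprn_gt0//; case/andP: gam01.
have tau0 : 0 < tau by rewrite tauE; apply: divrn_gt0.
have tau01 : 0 < tau <= zeta / 4000%:R by rewrite tau0 tauE lexx.
have eta01 := margin_small gam01 zetaE tau01.
have tau1 : tau <= 1 by have /andP[_] := eta01; clear; lra.
have thE : theta = mu * tau by rewrite thetaE tauE mulrA.
have th0 : 0 < theta by rewrite thE mulr_gt0.
have th1 : theta <= 1 by rewrite thE; clear -mu0 mu1 tau0 tau1; nra.
have nE : n%:R = expR l :> R by exact: natr_expR.
have ln : l <= n%:R by rewrite nE le_expR.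
have n0R : 0 < n%:R :> R by rewrite ltr0n.
pose X := n%:R * l; pose s := Num.sqrt X.
have l0 : 0 < l by exact: lt_le_trans l1.
have X00 : 0 < X by rewrite mulr_gt0.
have s0 : 0 < s by rewrite sqrtr_gt0.
have sX : s ^+ 2 = X by rewrite sqr_sqrtr// ltW.
have sn : s <= n%:R by apply: le_of_sqr; rewrite ?sX /X; [exact: ltW|clear -ln n0R; nra].
have ls : l <= s by apply: le_of_sqr; rewrite ?sX /X; [exact: ltW|clear -ln l0; nra].
pose B0 := (4 * r * s)^-1; pose eps := tau * B0.
have rs0 : 0 < 4 * r * s by rewrite !mulr_gt0.
have B00 : 0 < B0 by rewrite invr_gt0.
have B01 : B0 <= 1.
  have r4 : 0 < 4 * r by rewrite mulr_gt0.
  rewrite invf_le1//; apply: (@le_trans _ _ (4 * r * (4 * r)^-1)).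
    by rewrite mulfV// gt_eqF.
  by apply: ler_wpM2l; [exact: ltW|exact: le_trans ls].
have eps01 : 0 <= eps <= 1 by rewrite /eps; clear -tau0 tau1 B00 B01; apply/andP; split; nra.
pose delta := (tau / 20%:R / 4) ^+ 2.
have /andP[e0 e1] := eta01; have e4 : 0 < tau / 20%:R / 4 by clear -e0; lra.
have delta01 : 0 <= delta <= 1.
  by rewrite sqr_ge0 /delta expr_le1 ?(ltW e4)//; clear -e1; lra.
have delta0 : 0 < delta by rewrite exprn_gt0.
pose T := (Num.truncn (4 * l / theta)).+1.
have lth0 : 0 <= 4 * l / theta by rewrite divr_ge0 ?(ltW th0)// mulr_ge0// ltW.
have /andP[T1 T2] := truncn_itv lth0.
have Tle : T%:R <= 4 * l / theta + 1 :> R by rewrite /T -natr1 lerD2r.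
have TcL : T%:R <= (4 / theta + 1) * l by apply: (le_trans Tle); clear -l1; lra.
have TK : (T <= K)%N.
  rewrite -(ler_nat R); apply: (le_trans Tle).
  move: KC; rewrite ltr_norml => /andP[KC _].
  have : (4 / theta + 4) * l <= C0 * l by apply: ler_wpM2r => //; exact: ltW.
  clear -KC l1; lra.
have th4 : 0 < 4 / theta by rewrite divr_gt0.
have C00 : 0 <= C0 by clear -C0ge th4; lra.
have c'0 : 0 <= 4 / theta + 1 by clear -th4; lra.
have bm' k : #|block blk k| = m.
  apply: etrans (bm (Ordinal (ltn_pmod k K0))); apply: eq_card => i.
  by rewrite !inE.
have yE' : y = fun i w => `|dotv (a i w) x| by apply/funext => i; apply/funext => w.
rewrite yE'; exists T; split => //.
apply: small_event_compl.
  by apply: measurable_target => // i; exact: (ga i).1.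
have L31 : 1 <= L ^+ 3 by rewrite exprn_ege1.
have mC' : C * X * L ^+ 3 <= m%:R by rewrite /X [C * (_ * _)]mulrA.
have p18 : 0 < 2 ^+ 18 :> R by rewrite exprn_gt0.
have d2 : 0 < delta ^+ 2 by rewrite exprn_gt0.
have M1 := sample_grid p18 d2 (ltW X00) L31 C1 mC'.
have M2 := sample_signal p18 X00 r0 tau0 sX s0 L1 C2 mC'.
have lm : l <= m%:R.
  apply: le_trans mC'; rewrite /X.
  have h1 : 1 <= C * n%:R by rewrite mulr_ege1 ?ler1n.
  have h2 : 1 <= C * n%:R * L ^+ 3 by rewrite mulr_ege1.
  by rewrite (_ : C * (n%:R * l) * L ^+ 3 = C * n%:R * L ^+ 3 * l);
    [rewrite ler_peMl// ltW|ring].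
have KC0 : K%:R <= C0 * l + 1.
  by move: KC; rewrite ltr_norml => /andP[_]; clear; lra.
have tg := grid_term n0 q0 l1 l_q C00 KC0 M1.
have ts := signal_term m0 c'0 TcL lm M2.
have [Nul [mNul PNul sNul]] := ini.
have sE : small_event P Nul 0 by exists Nul; split => //; rewrite PNul.
have fl := @failure _ Omega R P n m K blk a z0 ga ia mz0 iz0 mu x T q delta eps
  K0 TK xn0 bm' delta01 eps01.
apply: small_event_sub (small_eventU sE fl); last by rewrite add0r; exact: lerD.
move=> w /=; apply: contra_notP => /not_orP[/= wN /contrapT [gg nb]].
have [i1 _ i3] : [/\ (2 * Num.sqrt (n%:R * l))^-1 <= `|dotv (z0 w) x| / enorm x,
        (1 - l^-1) * enorm x <= enorm (z0 w)
      & enorm (z0 w) <= (1 + l^-1) * enorm x].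
  by apply: contrapT => h; apply: wN; exact: sNul.
apply: (@success R n m K blk (a^~ w) (z0 w) x mu gam zeta tau eps B0 q T) => //.
- apply: (le_trans i3); apply: ler_wpM2r; first exact: ltW.
  by rewrite lerD2l -[leRHS]invrK lef_pV2 ?posrE ?invr_gt0.
- rewrite dotvZr normrM ger0_norm ?invr_ge0 ?(ltW X0)// [leRHS]mulrC.
  apply: le_trans i1.
  apply: (@le_trans _ _ (2 * B0 * r)).
    by apply: ler_pM => //; [rewrite mulr_ge0 ?(ltW B00)// addr_ge0 ?(ltW tau0)|exact: ltW|
      apply: ler_wpM2r; [exact: ltW|clear -tau1; lra]].
  rewrite le_eqVlt; apply/orP; left; apply/eqP; rewrite /B0 -/X -/s.
  by field; rewrite !gt_eqF.
- by rewrite /eps tauE mulrAC lexx.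
- rewrite -thetaE; apply: (phase_length (l := l)) => //.
  + by rewrite th0 th1.
  + by rewrite -nE.
  + exact: ltW.
Qed.

(* [c], [C0], [C] and the hidden constants may depend on a bound [r] of the
   norm of the fixed signal x: the lower bound on |<z_0, x>| / ||x|| does not
   scale with x, so no choice works for all x at once. [gamma0], [c1] and [rho]
   do not depend on [r]. *)
Theorem theorem2p1 (R : realType) :
  exists (c gamma0 c1 : R),
    [/\ 0 < c <= 2^-1, 0 < gamma0 < 1 & 0 < c1] /\
  forall mu : R, 0 < mu <= c ->
  exists rho : R, 0 < rho < 1 /\
  forall gamma : R, 0 < gamma <= gamma0 ->
  forall r : R, 0 < r ->
  exists Cmin : R, 0 < Cmin /\
  forall C0 : R, Cmin <= C0 ->
  exists (C c' A B : R), [/\ 0 < C, 0 < c', 0 < A & 0 < B] /\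
  forall (n m K : nat) (x : 'cV[R]_n)
    (d : measure_display) (Omega : measurableType d) (P : probability Omega R)
    (blk : 'I_(m * K) -> 'I_K)
    (a : 'I_(m * K) -> Omega -> 'cV[R]_n) (y : 'I_(m * K) -> Omega -> R)
    (z0 : Omega -> 'cV[R]_n),
  let logn := ln (n%:R : R) in
  let logm := ln (m%:R : R) in
  (1 < n)%N -> (0 < m)%N ->
  x != 0 -> enorm x <= r ->
  (0 < K)%N -> `|K%:R - C0 * logn| < 1 ->
  (forall t : 'I_K, #|[set i | blk i == t]%SET| = m) ->
  (forall i, std_gaussian_vector P (a i)) ->
  mutually_independent P a ->
  (forall i w, y i w = `|dotv (a i w) x|) ->
  random_vector z0 ->
  independent_of_family P z0 a ->
  {ae P, forall w,
    [/\ (2 * Num.sqrt (n%:R * logn))^-1 <= `|dotv (z0 w) x| / enorm x,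
        (1 - logn^-1) * enorm x <= enorm (z0 w)
      & enorm (z0 w) <= (1 + logn^-1) * enorm x]} ->
  C * n%:R * logn * logm ^+ 3 <= m%:R ->
  exists T : nat, (T%:R : R) <= c' * logn /\
    ((1 - A * expR (- (c1 * n%:R)) - B * m%:R ^- 10)%:E <=
     P [set w | forall k : nat, (T <= k)%N ->
         (distpm (rwf mu blk (a^~ w) (y^~ w) (z0 w) k) x <=
          gamma * (1 - rho) ^+ (k - T) * enorm x)%R])%E.
Proof.
exists 2^-1, 1204%:R^-1, 1; split.
  split => //; apply/andP; split; lra.
move=> mu /andP[mu0 mu1]; exists (mu / 4); split; first by apply/andP; split; lra.
move=> gam gam01 r r0.
have [zeta zetaE] : exists zeta, zeta = gam ^+ 2 / 8 by exists (gam ^+ 2 / 8).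
have [tau tauE] : exists tau, tau = zeta / 4000%:R by exists (zeta / 4000%:R).
have [theta thetaE] : exists theta, theta = mu * zeta / 4000%:R by exists (mu * zeta / 4000%:R).
have zeta0 : 0 < zeta by rewrite zetaE divr_gt0// exprn_gt0//; case/andP: gam01.
have tau0 : 0 < tau by rewrite tauE; apply: divrn_gt0.
have theta0 : 0 < theta by rewrite thetaE; apply: divrn_gt0; rewrite mulr_gt0.
(* The mesh must be fine compared with eta = tau / 20. *)
have [q q0 tq] : exists2 q, (0 < q)%N & 8 <= tau / 20%:R * q%:R.
  exists (Num.truncn (160%:R / tau)).+1 => //.
  have p0 : 0 <= 160%:R / tau by rewrite divr_ge0 ?(ltW tau0)// ler0n.
  have /andP[_] := truncn_itv p0; rewrite ltr_pdivrMr//; clear; lra.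
have th4 : 0 < 4 / theta by rewrite divr_gt0.
exists (4 / theta + 4); split; first by rewrite addr_gt0.
move=> C0 C0ge.
have C00 : 0 < C0 by clear -C0ge th4; lra.
pose C1 := 4 * 2 ^+ 18 / ((tau / 20%:R / 4) ^+ 2) ^+ 2.
pose C2 := 11%:R * 2 ^+ 18 * (16 * r ^+ 2) / tau ^+ 2.
have p18 : 0 < 2 ^+ 18 :> R by rewrite exprn_gt0.
have C10 : 0 <= C1 by rewrite divr_ge0 ?sqr_ge0// mulr_ge0// ltW.
have C20 : 0 <= C2.
  rewrite divr_ge0 ?sqr_ge0//; apply: mulr_ge0; last by rewrite mulr_ge0 ?sqr_ge0.
  by apply: mulr_ge0 (ltW p18); exact: ler0n.
(* Above this value of log n all requirements of [high_probability] hold. *)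
pose Lam := 1 + tau^-1 + 4 * r + (4 * r)^-1 + 3 * q%:R.
exists (C1 + C2 + 1), (4 / theta + 1), (expR (expR Lam) + 3 * (C0 + 1)),
  (2 * (4 / theta + 1) + expR 10%:R).
have c'0 : 0 < 4 / theta + 1 by rewrite addr_gt0.
have CC1 : C1 <= C1 + C2 + 1 by clear -C10 C20; lra.
have CC2 : C2 <= C1 + C2 + 1 by clear -C10 C20; lra.
have CC3 : 1 <= C1 + C2 + 1 by clear -C10 C20; lra.
split.
  split => //; first exact: lt_le_trans CC3.
    by rewrite addr_gt0 ?expR_gt0// mulr_gt0// addr_gt0.
  by rewrite addr_gt0 ?expR_gt0// mulr_gt0.
move=> n m K x d Omega P blk a y z0 l L n1 m0 xn0 xr K0 KC bm ga ia yE mz0 iz0 ini mC.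
have n0 : (0 < n)%N by exact: ltnW.
have nE : n%:R = expR l :> R by exact: natr_expR.
have mE : m%:R = expR L :> R by exact: natr_expR.
rewrite mul1r.
have l0 : 0 <= l by rewrite ln_ge0// ler1n.
set A := expR (expR Lam); set A' := 3 * (C0 + 1); set B' := 2 * (4 / theta + 1).
have A'0 : 0 <= A' by rewrite mulr_ge0// addr_ge0// ltW.
have B'0 : 0 <= B' by rewrite mulr_ge0// ltW.
have e0 : 0 <= expR (- n%:R) :> R by exact: expR_ge0.
have m10 : 0 <= m%:R ^- 10 :> R by rewrite invr_ge0 exprn_ge0.
have AE0 : 0 <= A * expR (- n%:R) by exact: mulr_ge0 (expR_ge0 _) e0.
have BM0 : 0 <= expR 10%:R * m%:R ^- 10 :> R by exact: mulr_ge0 (expR_ge0 _) m10.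
have A'E0 : 0 <= A' * expR (- n%:R) by exact: mulr_ge0.
have B'M0 : 0 <= B' * m%:R ^- 10 by exact: mulr_ge0.
(* For small n or m the claimed lower bound is nonpositive. *)
have trivial_case : 1 <= A * expR (- n%:R) \/ 1 <= expR 10%:R * m%:R ^- 10 :> R ->
    exists T : nat, (T%:R : R) <= (4 / theta + 1) * l /\
    ((1 - (A + A') * expR (- n%:R) - (B' + expR 10%:R) * m%:R ^- 10)%:E <=
     P [set w | forall k : nat, (T <= k)%N ->
         (distpm (rwf mu blk (a^~ w) (y^~ w) (z0 w) k) x <=
          gam * (1 - mu / 4) ^+ (k - T) * enorm x)%R])%E.
  move=> h; exists 0%N; split; first by rewrite mulr_ge0// ltW.
  apply: (@le_trans _ _ 0%E); last exact: measure_ge0.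
  by rewrite lee_fin !mulrDl; case: h => h; clear -h AE0 BM0 A'E0 B'M0; lra.
have [lLam|Laml] := ltP l Lam.
  apply: trivial_case; left; rewrite /A nE -expRD -expR0 ler_expR subr_ge0 ler_expR.
  exact: ltW.
have [L1|L1] := ltP L 1.
  apply: trivial_case; right.
  have -> : m%:R ^- 10 = expR (- (10%:R * L)) :> R by rewrite expRN expRM_natl -mE.
  rewrite -expRD; apply: le_trans (expR_ge1Dx _); clear -L1; lra.
have t'0 : 0 < tau^-1 by rewrite invr_gt0.
have r4 : 0 < 4 * r by rewrite mulr_gt0.
have r'4 : 0 < (4 * r)^-1 by rewrite invr_gt0.
have q3 : 0 <= 3 * q%:R :> R by rewrite mulr_ge0// ler0n.
have [l1 l2 l3 l4 l5] : [/\ tau^-1 <= l, 4 * r <= l, (4 * r)^-1 <= l, 3 * q%:R <= l & 1 <= l].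
  by move: Laml; rewrite /Lam; clear -t'0 r4 r'4 q3; split; lra.
have mu01 : 0 < mu <= 2^-1 by rewrite mu0.
have [T [TL TP]] := high_probability mu01 gam01 r0 zetaE tauE thetaE q0 tq C0ge CC1 CC2 CC3
  n1 m0 xn0 xr K0 KC bm ga ia yE mz0 iz0 ini mC l1 l2 l3 l4 l5 L1.
exists T; split=> //; apply: le_trans TP; rewrite lee_fin -/A' -/B' !mulrDl.
by clear -AE0 BM0; lra.
Qed.
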